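(* Let $H$ be a complex Hilbert space, $n$ a positive integer such that $\dim H \ge 2n$, and $\phi : P_n(H) \to P_n(H)$ a map (not assumed injective or surjective) satisfying $$\mathrm{ma}(\phi(P),\phi(Q)) = \mathrm{ma}(P,Q)$$ for all $P,Q \in P_n(H)$. Then there exists a linear or conjugate-linear isometry $U : H \to H$ such that either $$\phi(P) = UPU^\ast \quad \text{for every } P \in P_n(H),$$ or $\dim H = 2n$ and $$\phi(P) = U(I-P)U^\ast \quad \text{for every } P \in P_n(H).$$
   Context: $H$ may be finite- or infinite-dimensional. ''Projection'' means orthogonal projection (bounded self-adjoint idempotent); $P_n(H)$ is the set of all rank $n$ projections on $H$; $\mathrm{Im}\,P$ is the image of $P$; $I$ is the identity operator. For unit vectors $x,y \in H$, $\angle(x,y) = \arccos|\langle x,y\rangle| \in [0,\pi/2]$. For $P,Q \in P_n(H)$ the minimal angle (first principal angle) is $$\mathrm{ma}(P,Q) = \min\{\angle(x,y) : x \in \mathrm{Im}\,P,\ y \in \mathrm{Im}\,Q,\ \|x\|=\|y\|=1\} \in [0,\pi/2].$$ A linear isometry $U:H\to H$ is a linear map with $\langle Ux,Uy\rangle = \langle x,y\rangle$ for all $x,y$; a conjugate-linear isometry is a conjugate-linear map with $\langle Ux,Uy\rangle = \langle y,x\rangle$ for all $x,y$. Neither is assumed surjective. For a conjugate-linear $U$, the adjoint $U^\ast$ is the conjugate-linear map with $\langle Ux,y\rangle = \overline{\langle x,U^\ast y\rangle}$. In both cases, for a projection $P$, $UPU^\ast$ is the orthogonal projection onto $U(\mathrm{Im}\,P)$.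 *)

(* Defs.v *)
From HB Require Import structures.
From mathcomp Require Import all_boot all_order all_algebra.
From mathcomp Require Import complex.
From mathcomp Require Import all_classical all_reals all_analysis.

Set Implicit Arguments.
Unset Strict Implicit.
Unset Printing Implicit Defensive.

Import Order.TTheory GRing.Theory Num.Theory.
Import numFieldNormedType.Exports.

Local Open Scope classical_set_scope.
Local Open Scope ring_scope.

(* A complex Hilbert space is presented as a completeNormedModType over R[i],
   R : realType, together with dot : {dot H for Num.conj} (linear in the first
   argument, conjugate-linear in the second) such that dot x x = `|x| ^+ 2. The
   norm takes its values in R[i]. *)

Section Dimension.
Variables (K : fieldType) (V : lmodType K).

Definition lin_indep (m : nat) (e : 'I_m -> V) : Prop :=
  forall c : 'I_m -> K, \sum_i c i *: e i = 0 -> forall i, c i = 0.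

Definition lin_span (m : nat) (e : 'I_m -> V) : set V :=
  range (fun c : 'I_m -> K => \sum_i c i *: e i).

(* The space V, possibly infinite-dimensional, has dimension at least m. *)
Definition dim_ge (m : nat) : Prop := exists e : 'I_m -> V, lin_indep e.

(* The subset A of V is a linear subspace of finite dimension m. *)
Definition has_dim (A : set V) (m : nat) : Prop :=
  exists e : 'I_m -> V, lin_indep e /\ lin_span e = A.

End Dimension.

Arguments dim_ge {K} V m.

Section Operators.
Variables (R : realType) (H : completeNormedModType R[i]).
Variable dot : {dot H for Num.conj}.

Definition bounded_operator (T : H -> H) : Prop :=
  exists M : R[i], forall x, `|T x| <= M * `|x|.

(* Either condition determines Us from U, since dot is definite; neither U nor
   Us is assumed linear or conjugate-linear here. *)
Definition is_adjoint (U Us : H -> H) : Prop :=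
  forall x y, dot (U x) y = dot x (Us y).

Definition is_conj_adjoint (U Us : H -> H) : Prop :=
  forall x y, dot (U x) y = (dot x (Us y))^*%R.

Lemma dot_inj (y y' : H) : (forall x, dot x y = dot x y') -> y = y'.
Proof.
move=> h; apply/eqP; rewrite -subr_eq0; apply/negPn/negP => yy'.
have := @neq0_dnorm_gt0 _ _ _ dot _ yy'.
have -> : dot (y - y') (y - y') = dot (y - y') y - dot (y - y') y'.
  exact: (linearBr dot).
by rewrite h subrr ltxx.
Qed.

Lemma is_adjoint_uniq (U Us Us' : H -> H) :
  is_adjoint U Us -> is_adjoint U Us' -> Us =1 Us'.
Proof. by move=> h h' y; apply: dot_inj => x; rewrite -h -h'. Qed.

Lemma is_conj_adjoint_uniq (U Us Us' : H -> H) :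
  is_conj_adjoint U Us -> is_conj_adjoint U Us' -> Us =1 Us'.
Proof.
move=> h h' y; apply: dot_inj => x.
by apply: (can_inj (@conjCK _)); rewrite -h -h'.
Qed.

Definition linear_isometry (U : H -> H) : Prop :=
  linear U /\ forall x y, dot (U x) (U y) = dot x y.

Definition conj_linear_isometry (U : H -> H) : Prop :=
  linear_for (Num.conj \; *:%R) U /\ forall x y, dot (U x) (U y) = dot y x.

Definition is_projection (P : H -> H) : Prop :=
  [/\ linear P, bounded_operator P, is_adjoint P P & P \o P =1 P].

Record Pn (n : nat) : Type := MkPn {
  Pn_fun :> H -> H;
  Pn_projection : is_projection Pn_fun;
  Pn_rank : has_dim (range Pn_fun) n
}.

Definition angle (x y : H) : R := acos (ComplexField.Normc.normc (dot x y)).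

Definition unit_vectors (A : set H) : set H := [set x | A x /\ `|x| = 1].

End Operators.

(* The least element of A, and 0 if A has none. *)
Definition minimum (R : realType) (A : set R) : R := xget 0 (A `&` lbound A).

Lemma minimum_eq (R : realType) (A : set R) (m : R) :
  A m -> lbound A m -> minimum A = m.
Proof.
move=> Am lAm; apply: xget_unique => // y [Ay lAy].
by apply/le_anti/andP; split; [exact: lAy | exact: lAm].
Qed.

(* For 0 < n the minimum is attained, the unit spheres of the ranges of P and Q
   being nonempty and compact. *)
Definition ma (R : realType) (H : completeNormedModType R[i])
    (dot : {dot H for Num.conj}) (n : nat) (P Q : Pn dot n) : R :=
  minimum [set angle dot x y | x in unit_vectors (range P)
                             & y in unit_vectors (range Q)].

(* Main.v *)
(* Only the cosine of the minimal angle matters: it is 1 when the two subspaces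
   meet and 0 when they are orthogonal.

   If H is infinite-dimensional and n > 1, take P through x and pairwise orthogonal
   Q_1, ..., Q_n, each meeting P along one axis, with x in Q_1. Then phi P meets n
   pairwise orthogonal subspaces, so it is the orthogonal sum of the n lines
   phi P /\ phi Q_i. The line phi P /\ phi Q_1 turns out to depend on x only, and
   this map on lines does not increase |<x, y>|, hence preserves it by Parseval;
   Wigner's theorem gives U.

   If H has finite dimension d >= 2n, compactness makes phi bijective: for suitable
   j > 0 the iterates phi^j are nearly the identity, and a limit of the phi^(j-1) S
   is a preimage of S. Adjacency and pencils can be expressed through the relation
   of meeting, hence are preserved, and connectedness of the Grassmann graph shows
   that either all stars go to stars or all stars go to tops. In the first case phi
   induces a map on the (n-1)-dimensional subspaces which preserves the minimal
   angle, and one concludes by induction on n from Wigner's theorem. The second case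
   forces d = 2n and reduces to the first one after taking orthogonal complements. *)
From HB Require Import structures.
Require Import Defs.
From mathcomp Require Import all_boot all_order all_algebra.
From mathcomp Require Import complex.
From mathcomp Require Import all_classical all_reals all_analysis.
From mathcomp Require Import ring lra zify.

Set Implicit Arguments.
Unset Strict Implicit.
Unset Printing Implicit Defensive.

Import Order.TTheory GRing.Theory Num.Theory.
Import numFieldNormedType.Exports.
Local Open Scope classical_set_scope.
Local Open Scope ring_scope.

(** * Orthonormal frames *)

(** The two regimes call for different tools. In infinite dimension [phi] may fail to be surjective,
    so a relation that quantifies over all subspaces does not pass to their images; what is
    available there is an unlimited supply of fresh orthogonal axes. In dimension [2n] this supply
    is missing: no three subspaces of dimension [n] are pairwise orthogonal, and taking complements
    preserves the angle, so stars and tops have to be told apart before any [U] can be found. The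
    bound [2n <= d] is what makes the relation informative: a subspace is determined by the
    [n]-dimensional subspaces orthogonal to it, and for [n > 1] a plane that misses [R] extends to
    an [n]-dimensional subspace that misses [R]. In both regimes it is enough to send [P] into
    [phi P], or into its complement: equality then follows from equality of finite dimensions. The
    angle is traded for its cosine, whose extremality is a plain inequality between inner
    products. *)

Section InnerProduct.
Variables (C : numClosedFieldType) (H : lmodType C) (dot : {dot H for Num.conj}).

Local Notation "''[' u , v ]" := (dot u%R v%R) : ring_scope.

Lemma dotC u v : '[u, v] = '[v, u]^*.
Proof. by rewrite hermC expr0 mul1r. Qed.

Lemma dotDl u v w : '[u + v, w] = '[u, w] + '[v, w].
Proof. exact: (linearDl dot). Qed.

Lemma dotDr u v w : '[u, v + w] = '[u, v] + '[u, w].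
Proof. exact: (linearDr dot). Qed.

Lemma dotBl u v w : '[u - v, w] = '[u, w] - '[v, w].
Proof. exact: (linearBl dot). Qed.

Lemma dotBr u v w : '[u, v - w] = '[u, v] - '[u, w].
Proof. exact: (linearBr dot). Qed.

Lemma dot0l u : '[0, u] = 0.
Proof. by rewrite -[X in '[X, _]](subrr u) dotBl subrr. Qed.

Lemma dot0r u : '[u, 0] = 0.
Proof. by rewrite dotC dot0l conjC0. Qed.

Lemma dotZl a u v : '[a *: u, v] = a * '[u, v].
Proof. exact: (linearZl_LR dot). Qed.

Lemma dotZr a u v : '[u, a *: v] = a^* * '[u, v].
Proof. exact: (linearZr_LR dot). Qed.

Lemma dot_suml (I : Type) (r : seq I) (P : pred I) (F : I -> H) u :
  '[\sum_(i <- r | P i) F i, u] = \sum_(i <- r | P i) '[F i, u].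
Proof. exact: (linear_sumlz dot). Qed.

Lemma dot_sumr (I : Type) (r : seq I) (P : pred I) (F : I -> H) u :
  '[u, \sum_(i <- r | P i) F i] = \sum_(i <- r | P i) '[u, F i].
Proof. exact: (linear_sumr dot). Qed.

Lemma dot_eq0C u v : '[u, v] = 0 -> '[v, u] = 0.
Proof. by move=> uv; rewrite dotC uv conjC0. Qed.

Lemma dotxx_eq0 u : '[u, u] = 0 -> u = 0.
Proof. by move/eqP; rewrite dnorm_eq0 => /eqP. Qed.

Lemma sum1E (I : finType) (j : I) (F : I -> C) :
  \sum_i F i * (i == j)%:R = F j.
Proof.
rewrite (bigD1 j) //= eqxx mulr1 big1 ?addr0 // => i /negbTE ->.
by rewrite mulr0.
Qed.

Lemma dot_proj_line u v : '[v, v] = 1 ->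
  '[u - '[u, v] *: v, u - '[u, v] *: v] = '[u, u] - `|'[u, v]| ^+ 2.
Proof.
move=> v1; rewrite dotBl !dotBr !dotZl !dotZr v1 normCK (dotC v u).
ring.
Qed.

Lemma cauchy_schwarz1 u v : '[v, v] = 1 -> `|'[u, v]| ^+ 2 <= '[u, u].
Proof.
by move=> v1; rewrite -subr_ge0 -dot_proj_line // dnorm_ge0.
Qed.

Lemma parallelogram u v :
  '[u - v, u - v] = 2%:R * '[u, u] + 2%:R * '[v, v] - '[u + v, u + v].
Proof. by rewrite !(dotDl, dotDr, dotBl, dotBr); ring. Qed.

Lemma unit_scale u : u != 0 -> exists2 a : C, 0 < a & '[a *: u, a *: u] = 1.
Proof.
move=> u0; have uu : 0 < '[u, u] by rewrite dnorm_gt0.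
exists (sqrtC '[u, u])^-1; first by rewrite invr_gt0 sqrtC_gt0.
rewrite dotZl dotZr mulrA geC0_conj ?invr_ge0 ?sqrtC_ge0 ?ltW //.
by rewrite -invfM -expr2 sqrtCK mulVf // gt_eqF.
Qed.

Lemma cauchy_schwarz u v : `|'[u, v]| ^+ 2 <= '[u, u] * '[v, v].
Proof.
have [->|v0] := eqVneq v 0; first by rewrite !dot0r normr0 expr0n mulr0.
have [a a0 av] := unit_scale v0.
have := cauchy_schwarz1 u av; rewrite dotZr normrM exprMn norm_conjC.
rewrite (gtr0_norm a0) => h.
have -> : '[v, v] = (a ^+ 2)^-1.
  apply: (mulfI (lt0r_neq0 (exprn_gt0 2 a0))).
  rewrite mulfV ?lt0r_neq0 ?exprn_gt0 // -av dotZl dotZr geC0_conj ?ltW //.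
  by rewrite mulrA.
by rewrite ler_pdivlMr ?exprn_gt0 // mulrC.
Qed.

Lemma parallel_of_dot u v :
  '[v, v] = 1 -> `|'[u, v]| ^+ 2 = '[u, u] -> u = '[u, v] *: v.
Proof.
move=> v1 uv; apply/eqP; rewrite -subr_eq0; apply/eqP/dotxx_eq0.
by rewrite dot_proj_line // uv subrr.
Qed.

Definition onf n (f : 'I_n -> H) := forall i j, '[f i, f j] = (i == j)%:R.

Definition projf n (f : 'I_n -> H) (x : H) := \sum_i '[x, f i] *: f i.

Lemma dot_comb n (f : 'I_n -> H) (c : 'I_n -> C) j :
  onf f -> '[\sum_i c i *: f i, f j] = c j.
Proof.
move=> of_; rewrite dot_suml -[RHS]sum1E; apply: eq_bigr => i _.
by rewrite dotZl of_.
Qed.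

Lemma onf_indep n (f : 'I_n -> H) : onf f -> lin_indep f.
Proof. by move=> of_ c c0 i; rewrite -(dot_comb c i of_) c0 dot0l. Qed.

Lemma projf_span n (f : 'I_n -> H) x : lin_span f (projf f x).
Proof. by exists (fun i => '[x, f i]). Qed.

Lemma projf_id n (f : 'I_n -> H) x : onf f -> lin_span f x -> projf f x = x.
Proof.
move=> of_ [c _ <-]; apply: eq_bigr => i _.
by rewrite dot_comb.
Qed.

Lemma span_self n (f : 'I_n -> H) i : lin_span f (f i).
Proof.
exists (fun j => (j == i)%:R) => //.
rewrite (bigD1 i) //= eqxx scale1r big1 ?addr0 // => j /negbTE ->.
by rewrite scale0r.
Qed.

Lemma spanD n (f : 'I_n -> H) x y :
  lin_span f x -> lin_span f y -> lin_span f (x + y).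
Proof.
move=> [c _ <-] [c' _ <-]; exists (fun i => c i + c' i) => //.
by rewrite -big_split; apply: eq_bigr => i _; rewrite scalerDl.
Qed.

Lemma spanZ n (f : 'I_n -> H) a x : lin_span f x -> lin_span f (a *: x).
Proof.
move=> [c _ <-]; exists (fun i => a * c i) => //.
by rewrite scaler_sumr; apply: eq_bigr => i _; rewrite scalerA.
Qed.

Lemma span0 n (f : 'I_n -> H) : lin_span f 0.
Proof.
by exists (fun=> 0) => //; rewrite big1 // => i _; rewrite scale0r.
Qed.

Lemma spanB n (f : 'I_n -> H) x y :
  lin_span f x -> lin_span f y -> lin_span f (x - y).
Proof. by move=> fx fy; rewrite -scaleN1r; apply/spanD/spanZ. Qed.

Lemma span_sum n m (f : 'I_n -> H) (F : 'I_m -> H) :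
  (forall i, lin_span f (F i)) -> lin_span f (\sum_i F i).
Proof.
move=> fF; elim/big_rec : _ => [|i x _ fx]; first exact: span0.
exact: spanD.
Qed.

Lemma span_sub n m (f : 'I_n -> H) (g : 'I_m -> H) :
  (forall i, lin_span g (f i)) -> lin_span f `<=` lin_span g.
Proof.
by move=> fg _ [c _ <-]; apply: span_sum => i; exact: spanZ.
Qed.

Lemma dot_span0 n (f : 'I_n -> H) x y :
  (forall i, '[x, f i] = 0) -> lin_span f y -> '[x, y] = 0.
Proof.
move=> xf [c _ <-]; rewrite dot_sumr big1 // => i _.
by rewrite dotZr xf mulr0.
Qed.

Lemma dot_projf n (f : 'I_n -> H) x i : onf f -> '[x - projf f x, f i] = 0.
Proof. by move=> of_; rewrite dotBl dot_comb // subrr. Qed.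

Lemma dot_projf_span n (f : 'I_n -> H) x y :
  onf f -> lin_span f y -> '[x - projf f x, y] = 0.
Proof. by move=> of_; apply: dot_span0 => i; exact: dot_projf. Qed.

Lemma projfD n (f : 'I_n -> H) x y : projf f (x + y) = projf f x + projf f y.
Proof.
rewrite -big_split; apply: eq_bigr => i _.
by rewrite dotDl scalerDl.
Qed.

Lemma projfZ n (f : 'I_n -> H) a x : projf f (a *: x) = a *: projf f x.
Proof.
rewrite scaler_sumr; apply: eq_bigr => i _.
by rewrite dotZl scalerA.
Qed.

Lemma dot_projf_sym n (f : 'I_n -> H) x y :
  '[projf f x, y] = '[x, projf f y].
Proof.
rewrite dot_suml dot_sumr; apply: eq_bigr => i _.
by rewrite dotZl dotZr -dotC mulrC.
Qed.

Lemma dot_projf_idem n (f : 'I_n -> H) x y : onf f ->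
  '[projf f x, projf f y] = '[projf f x, y].
Proof.
move=> of_; rewrite [RHS]dotC -[in RHS](subrK (projf f y) y) dotDl.
by rewrite dot_projf_span ?add0r -?dotC //; exact: projf_span.
Qed.

Lemma parseval n (f : 'I_n -> H) x : onf f -> lin_span f x ->
  '[x, x] = \sum_i `|'[x, f i]| ^+ 2.
Proof.
move=> of_ fx; rewrite -[X in '[X, _]](projf_id of_ fx) dot_suml.
by apply: eq_bigr => i _; rewrite dotZl normCK -dotC.
Qed.

Lemma dot_dprojf n (f : 'I_n -> H) x : onf f ->
  '[x, x] = '[projf f x, projf f x] + '[x - projf f x, x - projf f x].
Proof.
move=> of_; have := dot_projf_idem x x of_.
rewrite dotBl !dotBr (dot_projf_idem _ _ of_) -(dot_projf_sym f x x) => _.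
ring.
Qed.

Lemma dot_projf_le n (f : 'I_n -> H) x : onf f ->
  '[projf f x, projf f x] <= '[x, x].
Proof.
by move=> of_; rewrite [leRHS](dot_dprojf x of_) lerDl dnorm_ge0.
Qed.

Definition fcons n (x : H) (f : 'I_n -> H) : 'I_n.+1 -> H :=
  fun i => if unlift ord0 i is Some j then f j else x.

Lemma fcons0 n x (f : 'I_n -> H) : fcons x f ord0 = x.
Proof. by rewrite /fcons unlift_none. Qed.

Lemma fconsS n x (f : 'I_n -> H) i : fcons x f (lift ord0 i) = f i.
Proof. by rewrite /fcons liftK. Qed.

Lemma onf_fcons n x (f : 'I_n -> H) :
  onf f -> '[x, x] = 1 -> (forall i, '[x, f i] = 0) -> onf (fcons x f).
Proof.
move=> of_ x1 xf i j.
have [i' ->|->] := unliftP ord0 i; have [j' ->|->] := unliftP ord0 j;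
  rewrite ?fcons0 ?fconsS ?eqxx ?(inj_eq (@lift_inj _ _)) //.
by rewrite dot_eq0C ?xf // eq_sym eq_liftF.
Qed.

Lemma span_fcons n x (f : 'I_n -> H) a y :
  lin_span f y -> lin_span (fcons x f) (a *: x + y).
Proof.
move=> fy; apply: spanD.
  by apply: spanZ; rewrite -[in X in lin_span _ X](fcons0 x f); exact: span_self.
move: y fy; apply: span_sub => i; rewrite -(fconsS x f i); exact: span_self.
Qed.

Lemma gram_schmidt n (e : 'I_n -> H) : lin_indep e ->
  exists f : 'I_n -> H, onf f /\ lin_span f = lin_span e.
Proof.
elim: n e => [|n IH] e ie.
  exists e; split=> // i; by case: i.
pose e' i := e (lift ord0 i).
have [|f [of_ fe']] := IH e'.
  move=> c c0 i.
  pose c' (i : 'I_n.+1) := if unlift ord0 i is Some j then c j else 0.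
  have : c' (lift ord0 i) = 0.
    apply: ie; rewrite big_ord_recl /c' unlift_none scale0r add0r -[RHS]c0.
    by apply: eq_bigr => j _; rewrite liftK.
  by rewrite /c' liftK.
have xnz : e ord0 - projf f (e ord0) != 0.
  rewrite subr_eq0; apply/negP => /eqP e0.
  have : lin_span e' (e ord0) by rewrite -fe' e0; exact: projf_span.
  move=> [c _ ec].
  pose c' (i : 'I_n.+1) := if unlift ord0 i is Some j then c j else -1.
  have : c' ord0 = 0.
    apply: ie; rewrite big_ord_recl {1}/c' unlift_none scaleN1r -ec.
    apply/eqP; rewrite addrC subr_eq0; apply/eqP.
    by apply: eq_bigr => j _; rewrite /c' liftK.
  by rewrite /c' unlift_none => /eqP; rewrite oppr_eq0 oner_eq0.
have [a a0 a1] := unit_scale xnz.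
set x := a *: _ in a1.
exists (fcons x f); split.
  by apply: onf_fcons => // i; rewrite dotZl dot_projf ?mulr0.
have fe i : lin_span e (f i).
  have : lin_span e' (f i) by rewrite -fe'; exact: span_self.
  by apply: (@span_sub _ _ e' e) => j; exact: span_self.
apply/seteqP; split; apply: span_sub => i.
  have [i' ->|->] := unliftP ord0 i; rewrite ?fconsS ?fcons0 //.
  apply: spanZ; apply: spanB; first exact: span_self.
  exact: (span_sub fe (projf_span f (e ord0))).
have [i' ->|->] := unliftP ord0 i.
  rewrite -[e _]add0r -(scale0r x); apply: span_fcons; rewrite fe'.
  exact: (span_self e').
have -> : e ord0 = a^-1 *: x + projf f (e ord0).
  by rewrite scalerA mulVf ?scale1r ?subrK // gt_eqF.
by apply: span_fcons; exact: projf_span.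
Qed.

(** Orthogonality to the [m] vectors [g] puts [m] linear conditions on [n > m] coefficients, so the
    matrix of inner products has a nonzero left kernel. *)
Lemma exists_orthogonal_comb n m (e : 'I_n -> H) (g : 'I_m -> H) : (m < n)%N ->
  exists2 c : 'I_n -> C, (exists i, c i != 0) &
    forall j, '[\sum_i c i *: e i, g j] = 0.
Proof.
move=> mn; pose M := \matrix_(i < n, j < m) '[e i, g j].
have : kermx M != 0.
  rewrite kermx_eq0 /row_free; apply: contraTN mn => /eqP <-.
  by rewrite -leqNgt rank_leq_col.
case/rowV0Pn => v vM v0; exists (fun i => v 0 i).
  apply/existsP; apply: contraNT v0; rewrite negb_exists => /forallP v0.
  by apply/eqP/rowP => i; rewrite mxE; apply/eqP; have := v0 i; rewrite negbK.
move=> j; move/sub_kermxP: vM => /rowP /(_ j); rewrite !mxE => <-.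
rewrite dot_suml; apply: eq_bigr => i _.
by rewrite dotZl mxE.
Qed.

Lemma exists_orthogonal_unit n m (e : 'I_n -> H) (g : 'I_m -> H) :
  lin_indep e -> (m < n)%N ->
  exists x, [/\ lin_span e x, '[x, x] = 1 & forall j, '[x, g j] = 0].
Proof.
move=> ie mn; have [c [i ci] cg] := exists_orthogonal_comb e g mn.
have : \sum_i c i *: e i != 0.
  by apply: contra_neq ci => /ie /(_ i).
case/unit_scale => a _ a1; exists (a *: \sum_i c i *: e i); split => //.
  by apply: spanZ; exists c.
by move=> j; rewrite dotZl cg mulr0.
Qed.

(** If [m < n], some unit vector of the first span is orthogonal to all of [g]; lying in the span of
    [g], it is orthogonal to itself. *)
Lemma onf_leq n m (f : 'I_n -> H) (g : 'I_m -> H) :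
  lin_indep f -> onf g -> lin_span f `<=` lin_span g -> (n <= m)%N.
Proof.
move=> if_ og fg; rewrite leqNgt; apply/negP => mn.
have [x [fx x1 xg]] := exists_orthogonal_unit g if_ mn.
have := dot_span0 xg (fg _ fx); rewrite x1 => /eqP; by rewrite oner_eq0.
Qed.

Lemma onf_full n (f g : 'I_n -> H) :
  onf f -> onf g -> lin_span f `<=` lin_span g -> lin_span g `<=` lin_span f.
Proof.
move=> of_ og fg x gx; apply: contrapT => nfx.
have xnz : x - projf f x != 0.
  rewrite subr_eq0; apply/negP => /eqP xE; apply: nfx.
  by rewrite xE; exact: projf_span.
have [a a0 a1] := unit_scale xnz.
suff : (n.+1 <= n)%N by rewrite ltnn.
apply: (@onf_leq _ _ (fcons (a *: (x - projf f x)) f) g) => //.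
  apply: onf_indep; apply: onf_fcons => // i.
  by rewrite dotZl dot_projf ?mulr0.
apply: span_sub => i; have [i' ->|->] := unliftP ord0 i; rewrite ?fconsS ?fcons0.
  by apply: fg; exact: span_self.
by apply/spanZ/spanB => //; apply: fg; exact: projf_span.
Qed.

End InnerProduct.

(** * Wigner's theorem, by Bargmann's argument *)

Section Wigner.
Variables (C : numClosedFieldType) (H : lmodType C) (dot : {dot H for Num.conj}).

Local Notation "''[' u , v ]" := (dot u%R v%R) : ring_scope.

(** Equality case of Cauchy-Schwarz, for a [v] that is not normalized. *)
Lemma parallel u v : v != 0 -> `|'[u, v]| ^+ 2 = '[u, u] * '[v, v] ->
  u = ('[u, v] / '[v, v]) *: v.
Proof.
move=> v0; have [a a0 av] := unit_scale dot v0 => uv.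
have vE : '[v, v] = (a ^+ 2)^-1.
  apply: (mulfI (lt0r_neq0 (exprn_gt0 2 a0))).
  rewrite mulfV ?lt0r_neq0 ?exprn_gt0 // -av dotZl dotZr geC0_conj ?ltW //.
  by rewrite mulrA.
rewrite [LHS](@parallel_of_dot _ _ dot _ (a *: v)) //.
  rewrite dotZr geC0_conj ?ltW // scalerA vE invrK; congr (_ *: _); ring.
rewrite dotZr normrM exprMn norm_conjC (gtr0_norm a0) uv vE mulrC divfK //.
by rewrite expf_neq0 // gt_eqF.
Qed.

Variable psi : H -> H.
Hypothesis psi_dot : forall x y, `|'[psi x, psi y]| = `|'[x, y]|.

Lemma psi_norm x : '[psi x, psi x] = '[x, x].
Proof.
by have := psi_dot x x; rewrite !ger0_norm // dnorm_ge0.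
Qed.

Lemma psi_line x a : x != 0 -> exists b, psi (a *: x) = b *: psi x.
Proof.
move=> x0; have p0 : psi x != 0 by rewrite -(dnorm_eq0 dot) psi_norm dnorm_eq0.
eexists; apply: (parallel p0).
rewrite psi_dot !psi_norm !dotZl dotZr normrM exprMn (ger0_norm (dnorm_ge0 _ _)).
rewrite normCK; ring.
Qed.

Section Bargmann.
Variable e : H.
Hypothesis e1 : '[e, e] = 1.

(* [psi (e + y)] rescaled so that its component along [psi e] is 1; [T y] is the
   other component. *)
Variables w T : H -> H.
Hypothesis wE : forall y, w y = '[psi (e + y), psi e]^* *: psi (e + y).
Hypothesis TE : forall y, T y = w y - psi e.

Let pe1 : '[psi e, psi e] = 1.
Proof. by rewrite psi_norm. Qed.

Lemma w_phase y : '[y, e] = 0 -> `|'[psi (e + y), psi e]| = 1.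
Proof. by move=> ye; rewrite psi_dot dotDl e1 ye addr0 normr1. Qed.

Lemma w_dot_e y : '[y, e] = 0 -> '[w y, psi e] = 1.
Proof.
by move=> ye; rewrite wE dotZl mulrC -normCK w_phase // expr1n.
Qed.

Lemma T_dot_e y : '[y, e] = 0 -> '[T y, psi e] = 0.
Proof. by move=> ye; rewrite TE dotBl w_dot_e // pe1 subrr. Qed.

Lemma w_T y : w y = psi e + T y.
Proof. by rewrite TE addrC subrK. Qed.

Lemma w_dot y z : '[y, e] = 0 -> '[z, e] = 0 -> '[w y, w z] = 1 + '[T y, T z].
Proof.
move=> ye ze; rewrite !w_T dotDl !dotDr pe1 T_dot_e //.
by rewrite (dot_eq0C (T_dot_e ze)) addr0 add0r.
Qed.

Lemma w_norm y z : '[y, e] = 0 -> '[z, e] = 0 ->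
  `|1 + '[T y, T z]| = `|1 + '[y, z]|.
Proof.
move=> ye ze; rewrite -w_dot // !wE dotZl dotZr !normrM !norm_conjC !w_phase //.
rewrite !mul1r psi_dot dotDl !dotDr e1 ye (dot_eq0C ze); congr `|_|; ring.
Qed.

Lemma T_norm y : '[y, e] = 0 -> '[T y, T y] = '[y, y].
Proof.
move=> ye; apply: (addrI 1); have := w_norm ye ye.
by rewrite !ger0_norm ?addr_ge0 ?ler01 ?dnorm_ge0.
Qed.

Lemma T0 : T 0 = 0.
Proof. by apply: (@dotxx_eq0 _ _ dot); rewrite T_norm dot0l. Qed.

(** [psi y] is orthogonal to [psi e], so its product with [T y] is its product with [w y], whose
    modulus is the largest that Cauchy-Schwarz allows. *)
Lemma T_psi y : '[y, e] = 0 -> exists b, T y = b *: psi y.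
Proof.
move=> ye; have [->|y0] := eqVneq y 0; first by exists 0; rewrite T0 scale0r.
have p0 : psi y != 0 by rewrite -(dnorm_eq0 dot) psi_norm dnorm_eq0.
exists ('[T y, psi y] / '[psi y, psi y]); apply: (parallel p0).
have pye : '[psi e, psi y] = 0.
  by apply/eqP; rewrite -normr_eq0 psi_dot (dot_eq0C ye) normr0.
rewrite {1}TE dotBl pye subr0 wE dotZl normrM norm_conjC w_phase // mul1r.
by rewrite psi_dot dotDl (dot_eq0C ye) add0r T_norm // psi_norm ger0_norm ?dnorm_ge0.
Qed.

Lemma T_abs y z : '[y, e] = 0 -> '[z, e] = 0 ->
  `|'[T y, T z]| = `|'[y, z]|.
Proof.
move=> ye ze.
have [->|y0] := eqVneq y 0; first by rewrite T0 !dot0l.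
have [->|z0] := eqVneq z 0; first by rewrite T0 !dot0r.
have [b bT] := T_psi ye; have [c cT] := T_psi ze.
have unit u d : u != 0 -> '[u, e] = 0 -> T u = d *: psi u -> `|d| = 1.
  move=> u0 ue uT; have := T_norm ue.
  rewrite uT dotZl dotZr psi_norm mulrA -normCK -[RHS]mul1r.
  move/mulIf; rewrite dnorm_eq0 => /(_ u0) /eqP.
  by rewrite sqrp_eq1 ?normr_ge0 // => /eqP.
rewrite bT cT dotZl dotZr !normrM norm_conjC psi_dot.
by rewrite (unit _ _ y0 ye bT) (unit _ _ z0 ze cT) !mul1r.
Qed.

(** [|1 + a| ^+ 2] is [1 + 2 Re a + |a| ^+ 2]; as [|1 + a|] and [|a|] are both preserved, so is the
    real part. *)
Lemma T_re y z : '[y, e] = 0 -> '[z, e] = 0 ->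
  '[T y, T z] + '[T z, T y] = '[y, z] + '[z, y].
Proof.
move=> ye ze; have expand (a : C) : `|1 + a| ^+ 2 = 1 + (a + a^*) + `|a| ^+ 2.
  by rewrite !normCK rmorphD rmorph1; ring.
have := expand '[y, z]; rewrite -w_norm // expand T_abs //.
by move/addIr/addrI; rewrite -!dotC.
Qed.

(** The squared norm of [T (y + z) - (T y + T z)] expands into norms and real parts, all preserved
    by [T]; it therefore equals that of [(y + z) - (y + z)]. The same computation gives [T_real]. *)
Lemma T_add y z : '[y, e] = 0 -> '[z, e] = 0 -> T (y + z) = T y + T z.
Proof.
move=> ye ze; apply/eqP; rewrite -subr_eq0; apply/eqP/(@dotxx_eq0 _ _ dot).
have yze : '[y + z, e] = 0 by rewrite dotDl ye ze addr0.
have expand (a b c : H) : '[a - (b + c), a - (b + c)] =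
    '[a, a] + '[b, b] + '[c, c] - ('[a, b] + '[b, a]) - ('[a, c] + '[c, a])
    + ('[b, c] + '[c, b]).
  by rewrite !(dotBl, dotBr, dotDl, dotDr); ring.
by rewrite expand !T_norm // !T_re // -expand subrr dot0l.
Qed.

Lemma T_real a y : a \is Num.real -> '[y, e] = 0 -> T (a *: y) = a *: T y.
Proof.
move=> ar ye; apply/eqP; rewrite -subr_eq0; apply/eqP/(@dotxx_eq0 _ _ dot).
have aye : '[a *: y, e] = 0 by rewrite dotZl ye mulr0.
have expand (u v : H) : '[u - a *: v, u - a *: v] =
    '[u, u] + a ^+ 2 * '[v, v] - a * ('[u, v] + '[v, u]).
  by rewrite !(dotBl, dotBr, dotZl, dotZr) (CrealP ar); ring.
by rewrite expand !T_norm // T_re // -expand subrr dot0l.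
Qed.

Lemma perp_i y : '[y, e] = 0 -> '['i *: y, e] = 0.
Proof. by move=> ye; rewrite dotZl ye mulr0. Qed.

(** ['[T ('i *: y), T y]] is purely imaginary of modulus ['[y, y]], which leaves two values. *)
Lemma T_i y : '[y, e] = 0 ->
  T ('i *: y) = 'i *: T y \/ T ('i *: y) = - 'i *: T y.
Proof.
move=> ye; have [->|y0] := eqVneq y 0; first by left; rewrite scaler0 T0 scaler0.
have Ty0 : T y != 0 by rewrite -(dnorm_eq0 dot) T_norm // dnorm_eq0.
have iye := perp_i ye.
set h := '[T ('i *: y), T y].
have hre : h + h^* = 0.
  rewrite -dotC T_re // dotZl dotZr conjCi; ring.
have habs : `|h| = '[y, y].
  by rewrite T_abs // dotZl normrM normCi mul1r ger0_norm ?dnorm_ge0.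
have hpar : T ('i *: y) = (h / '[y, y]) *: T y.
  rewrite -(T_norm ye); apply: (parallel Ty0).
  by rewrite habs !T_norm // dotZl dotZr mulrA -normCK normCi expr1n mul1r.
have : h ^+ 2 = ('i * '[y, y]) ^+ 2.
  rewrite -habs exprMn sqrCi mulN1r normCK.
  move/eqP: hre; rewrite addrC addr_eq0 => /eqP ->; ring.
have yy0 : '[y, y] != 0 by rewrite dnorm_eq0.
move/eqP; rewrite eqf_sqr => /orP[] /eqP hE; [left|right]; rewrite hpar hE.
  by rewrite mulfK.
by rewrite mulNr mulfK.
Qed.

(** If [y] and [z] had opposite signs, additivity at [y + z], which has a sign of its own, would
    make [T y] or [T z] vanish; a vector with [T] zero has both signs. *)
Lemma T_i_uniform :
  (forall y, '[y, e] = 0 -> T ('i *: y) = 'i *: T y) \/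
  (forall y, '[y, e] = 0 -> T ('i *: y) = - 'i *: T y).
Proof.
have [|/existsNP[y /not_implyP[ye nTy]]] :=
  pselect (forall y, '[y, e] = 0 -> T ('i *: y) = 'i *: T y); first by left.
have Tiy : T ('i *: y) = - 'i *: T y by case: (T_i ye).
right=> z ze; case: (T_i ze) => // Tiz.
have yze : '[y + z, e] = 0 by rewrite dotDl ye ze addr0.
have i0 : 'i *+ 2 != 0 :> C by rewrite mulrn_eq0 /= neq0Ci.
have half (u : H) : 'i *: u = - 'i *: u -> u = 0.
  move/eqP; rewrite -subr_eq0 -scalerBl opprK -mulr2n scaler_eq0 (negbTE i0).
  by move=> /eqP.
have := T_add (perp_i ye) (perp_i ze); rewrite -scalerDr Tiy Tiz.
case: (T_i yze) => ->; rewrite T_add // scalerDr.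
  move/addIr/half => Ty0; case: nTy.
  by rewrite Tiy Ty0 !scaler0.
by move/addrI/esym/half => Tz0; rewrite Tz0 !scaler0.
Qed.

Section Extension.
(** [chi] will be the identity or the conjugation, so that the linear and the conjugate-linear
    extension of [T] from the complement of [e] to [H] are treated together. *)
Variable chi : {rmorphism C -> C}.
Hypothesis chi_conj : forall c, chi c^* = (chi c)^*.
Hypothesis T_semilin : forall c y, '[y, e] = 0 -> T (c *: y) = chi c *: T y.
Hypothesis T_dot : forall y z, '[y, e] = 0 -> '[z, e] = 0 ->
  '[T y, T z] = chi '[y, z].

Variables P U : H -> H.
Hypothesis PE : forall x, P x = x - '[x, e] *: e.
Hypothesis UE : forall x, U x = chi '[x, e] *: psi e + T (P x).

Let P_e x : '[P x, e] = 0.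
Proof. by rewrite PE dotBl dotZl e1 mulr1 subrr. Qed.

Lemma U_add x y : U (x + y) = U x + U y.
Proof.
rewrite !UE; have -> : P (x + y) = P x + P y.
  by rewrite !PE dotDl scalerDl opprD addrACA.
by rewrite T_add // dotDl rmorphD scalerDl addrACA.
Qed.

Lemma U_scale c x : U (c *: x) = chi c *: U x.
Proof.
rewrite !UE; have -> : P (c *: x) = c *: P x.
  by rewrite !PE dotZl scalerBr scalerA.
by rewrite T_semilin // dotZl rmorphM scalerDr scalerA.
Qed.

Lemma U_dot x y : '[U x, U y] = chi '[x, y].
Proof.
rewrite !UE !(dotDl, dotDr, dotZl, dotZr) T_dot // pe1 T_dot_e //.
rewrite (dot_eq0C (T_dot_e (P_e y))) !PE !(dotBl, dotBr, dotZl, dotZr) e1.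
rewrite (dotC dot e y) !(rmorphB, rmorphM, rmorph1) /= !chi_conj; ring.
Qed.

(** A vector not orthogonal to [e] is a multiple of some [e + y] with [y] orthogonal to [e], and
    [w y] lies on the line of [psi (e + y)]. *)
Lemma U_psi x : exists a, U x = a *: psi x.
Proof.
have [->|x0] := eqVneq x 0.
  by exists 0; rewrite -{1}(scale0r 0) U_scale rmorph0 !scale0r.
have [xe|xe] := eqVneq '[x, e] 0.
  rewrite UE PE xe scale0r subr0 rmorph0 scale0r add0r; exact: T_psi.
set a := '[x, e] in xe *; pose y := a^-1 *: P x.
have ye : '[y, e] = 0 by rewrite dotZl P_e mulr0.
have xE : x = a *: (e + y).
  by rewrite scalerDr scalerA mulfV // scale1r PE addrC subrK.
have UxE : U x = chi a *: w y.
  rewrite UE -/a w_T scalerDr -T_semilin //.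
  by rewrite scalerA mulfV // scale1r.
have [b bE] := psi_line a^-1 x0.
exists (chi a * ('[psi (e + y), psi e]^* * b)).
rewrite UxE wE -[in RHS]scalerA; congr (_ *: _).
rewrite -[in RHS]scalerA -bE; congr (_ *: psi _).
by rewrite [in RHS]xE scalerA mulVf ?scale1r.
Qed.

End Extension.

End Bargmann.

Lemma half_sum (A B a b : C) : A + B = a + b -> A - B = a - b -> A = a.
Proof.
move=> hs hd; have two0 : 2%:R != 0 :> C by rewrite pnatr_eq0.
apply: (mulfI two0); have -> : 2%:R * A = (A + B) + (A - B) by ring.
by rewrite hs hd; ring.
Qed.

Lemma wigner_at_unit e : '[e, e] = 1 -> exists U : H -> H,
  ((linear U /\ forall x y, '[U x, U y] = '[x, y]) \/
   (linear_for (Num.conj \; *:%R) U /\ forall x y, '[U x, U y] = '[y, x])) /\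
  forall x, exists a, U x = a *: psi x.
Proof.
move=> e1.
have [w wE] : exists w, forall y, w y = '[psi (e + y), psi e]^* *: psi (e + y).
  by exists (fun y => '[psi (e + y), psi e]^* *: psi (e + y)).
have [T TE] : exists T, forall y, T y = w y - psi e.
  by exists (fun y => w y - psi e).
have perp_i y : '[y, e] = 0 -> '['i *: y, e] = 0.
  by move=> ye; rewrite dotZl ye mulr0.
have split_re (c : C) y : '[y, e] = 0 ->
    T (c *: y) = 'Re c *: T y + 'Im c *: T ('i *: y).
  move=> ye; rewrite {1}(Crect c) mulrC scalerDl -scalerA.
  rewrite (T_add e1 wE TE) ?dotZl ?ye ?mulr0 //.
  rewrite (T_real e1 wE TE (Creal_Re c) ye).
  by rewrite (T_real e1 wE TE (Creal_Im c) (perp_i _ ye)).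
(* The real part at ['i *: y] is, up to sign, the imaginary part at [y]. Together with [T_re] it
   yields ['[T y, T z]] through [half_sum]: either ['[y, z]] or its conjugate, according to the sign
   in [T_i_uniform]. *)
have polar y z : '[y, e] = 0 -> '[z, e] = 0 ->
    '[T ('i *: y), T z] + '[T z, T ('i *: y)] = 'i * ('[y, z] - '[z, y]).
  move=> ye ze; rewrite (T_re e1 wE TE) ?perp_i // dotZl dotZr conjCi; ring.
case: (T_i_uniform e1 wE TE) => Ti.
- have semi c y : '[y, e] = 0 -> T (c *: y) = (idfun : {rmorphism C -> C}) c *: T y.
    by move=> ye; rewrite split_re // Ti // scalerA -scalerDl mulrC -Crect.
  have Td y z : '[y, e] = 0 -> '[z, e] = 0 ->
      '[T y, T z] = (idfun : {rmorphism C -> C}) '[y, z].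
    move=> ye ze; apply: half_sum (T_re e1 wE TE ye ze) _.
    apply: (mulfI (neq0Ci C)).
    rewrite -(polar y z) // Ti // dotZl dotZr conjCi; ring.
  pose P x := x - '[x, e] *: e.
  pose U x := (idfun : {rmorphism C -> C}) '[x, e] *: psi e + T (P x).
  have PE x : P x = x - '[x, e] *: e by [].
  have UE x : U x = (idfun : {rmorphism C -> C}) '[x, e] *: psi e + T (P x) by [].
  exists U; split; [left; split|exact: (U_psi e1 wE TE semi PE UE)].
    move=> c x y; rewrite (U_add e1 wE TE PE UE).
    by rewrite (U_scale e1 semi PE UE).
  by move=> x y; exact: (U_dot e1 wE TE _ Td PE UE).
- have semi c y : '[y, e] = 0 ->
      T (c *: y) = (Num.conj : {rmorphism C -> C}) c *: T y.
    move=> ye; rewrite split_re // Ti // scalerA -scalerDl /=.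
    by rewrite [in RHS](Crect c) conjC_rect ?Creal_Re ?Creal_Im // mulrN mulrC.
  have Td y z : '[y, e] = 0 -> '[z, e] = 0 ->
      '[T y, T z] = (Num.conj : {rmorphism C -> C}) '[y, z].
    move=> ye ze; rewrite /= -dotC.
    apply: (@half_sum _ '[T z, T y] _ '[y, z]).
      by rewrite (T_re e1 wE TE ye ze) addrC.
    apply: (mulfI (neq0Ci C)).
    have -> : 'i * ('[z, y] - '[y, z]) = - ('i * ('[y, z] - '[z, y])) by ring.
    rewrite -(polar y z) // Ti //.
    rewrite dotZl dotZr rmorphN /= conjCi; ring.
  pose P x := x - '[x, e] *: e.
  pose U x := (Num.conj : {rmorphism C -> C}) '[x, e] *: psi e + T (P x).
  have PE x : P x = x - '[x, e] *: e by [].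
  have UE x : U x = (Num.conj : {rmorphism C -> C}) '[x, e] *: psi e + T (P x).
    by [].
  exists U; split; [right; split|exact: (U_psi e1 wE TE semi PE UE)].
    move=> c x y; rewrite (U_add e1 wE TE PE UE).
    by rewrite (U_scale e1 semi PE UE).
  move=> x y; rewrite (dotC dot y x).
  by apply: (U_dot e1 wE TE _ Td PE UE).
Qed.

Theorem wigner : exists U : H -> H,
  ((linear U /\ forall x y, '[U x, U y] = '[x, y]) \/
   (linear_for (Num.conj \; *:%R) U /\ forall x y, '[U x, U y] = '[y, x])) /\
  forall x, exists a, U x = a *: psi x.
Proof.
have [[x x0]|H0] := pselect (exists x : H, x != 0).
  by have [a _ a1] := unit_scale dot x0; exact: wigner_at_unit a1.
have H0' (x : H) : x = 0.
  by apply/eqP/negPn/negP => x0; apply: H0; exists x.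
exists idfun; split; first by left; split.
by move=> x; exists 0; rewrite [LHS]H0' scale0r.
Qed.

End Wigner.

(** * Limits along ultrafilters and attainment of the minimal angle *)

Section UltraLimit.
Variables (R : realType) (F : set_system nat).
Hypothesis F_ultra : UltraFilter F.

Let F_proper : ProperFilter F.
Proof. exact: ultra_proper. Qed.

(** The limit is the supremum of the [r] such that [r <= u k] on a set of the ultrafilter. *)
Lemma ultra_lim_real (u : nat -> R) (M : R) : (forall k, `|u k| <= M) ->
  exists x, forall e, 0 < e -> F [set k | `|u k - x| < e].
Proof.
move=> uM; pose E := [set r | F [set k | r <= u k]].
have EM : E (- M).
  rewrite /E /=; have -> : [set k | - M <= u k] = setT.
    by apply/seteqP; split=> k //= _; have := uM k; rewrite ler_norml => /andP[].
  exact: filterT.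
have ubE : ubound E M.
  move=> r Er; have [k /= rk] := filter_ex Er.
  apply: le_trans rk _; by have := uM k; rewrite ler_norml => /andP[].
have supE : has_sup E by split; [exists (- M) | exists M].
exists (sup E) => e e0.
have [r Er re] := sup_adherent e0 supE.
have Fe : F (~` [set k | sup E + e / 2 <= u k]).
  have [|//] := in_ultra_setVsetC [set k | sup E + e / 2 <= u k] F_ultra.
  move=> Fs; have : E (sup E + e / 2) by [].
  move/(ub_le_sup (proj2 supE)); rewrite gerDl leNgt divr_gt0 //.
apply: filterS (filterI Er Fe) => k /= [rk /negP]; rewrite -ltNge => ku.
rewrite ltr_norml ltrBlDl ltrBrDl; apply/andP; split.
  exact: lt_le_trans re rk.
apply: lt_trans ku _; rewrite ltrD2l ltr_pdivrMr // mulr_natr mulr2n.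
by rewrite ltrDl.
Qed.

Lemma ultra_lim_complex (u : nat -> R[i]) (M : R[i]) : (forall k, `|u k| <= M) ->
  exists x, forall e, 0 < e -> F [set k | `|u k - x| < e].
Proof.
move=> uM.
have partM k : `|complex.Re (u k)| <= complex.Re M /\ `|complex.Im (u k)| <= complex.Re M.
  have := uM k; rewrite normc_def lecE => /andP[_ /= h].
  by split; apply: le_trans h; rewrite -sqrtr_sqr ler_wsqrtr // (lerDl, lerDr) sqr_ge0.
have [a ha] := ultra_lim_real (fun k => proj1 (partM k)).
have [b hb] := ultra_lim_real (fun k => proj2 (partM k)).
exists (a +i* b)%C => e; case: e => er ei; rewrite ltcE /= => /andP[/eqP -> er0].
have e2 : 0 < er / 2 by rewrite divr_gt0.
apply: filterS (filterI (ha _ e2) (hb _ e2)) => k /= [hak hbk].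
case: (u k) hak hbk => x y /= hx hy.
rewrite normc_def ltcE /= eqxx /=.
apply: le_lt_trans (_ : `|x - a| + `|y - b| < er).
  have -> : `|x - a| + `|y - b| = Num.sqrt ((`|x - a| + `|y - b|) ^+ 2).
    by rewrite sqrtr_sqr [RHS]ger0_norm ?addr_ge0.
  apply: ler_wsqrtr; rewrite [leRHS]sqrrD !real_normK ?num_real //.
  by rewrite -addrA [_ *+ 2 + _]addrC addrA lerDl mulrn_wge0 // mulr_ge0.
by rewrite [ltRHS](splitr er) ltrD.
Qed.

End UltraLimit.

(** Limits along a free ultrafilter replace convergent subsequences: one choice serves all bounded
    sequences at once. *)
Lemma free_ultrafilter : exists2 F : set_system nat, UltraFilter F &
  forall m, F [set k | (m <= k)%N].
Proof.
have [F [uF sF]] := @ultraFilterLemma nat \oo _.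
exists F => // m; apply: sF; exact: nbhs_infty_ge.
Qed.

(** * Norms and cosines from the inner product alone *)

Section Norm.
Variables (C : numClosedFieldType) (H : lmodType C) (dot : {dot H for Num.conj}).

Local Notation "''[' u , v ]" := (dot u%R v%R) : ring_scope.

(** The norm is recomputed from [dot], because the spaces here are bare modules without a normed
    structure. *)
Definition nrm (x : H) : C := sqrtC '[x, x].

Lemma nrm_ge0 x : 0 <= nrm x.
Proof. by rewrite sqrtC_ge0 dnorm_ge0. Qed.

Lemma nrm_sqr x : nrm x ^+ 2 = '[x, x].
Proof. exact: sqrtCK. Qed.

Lemma nrm_subC x y : nrm (x - y) = nrm (y - x).
Proof.
have -> : x - y = (-1) *: (y - x) by rewrite scaleN1r opprB.
by rewrite /nrm dotZl dotZr rmorphN1 mulrA mulrNN !mul1r.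
Qed.

Lemma nrm_eq1 x : (nrm x = 1) <-> ('[x, x] = 1).
Proof.
rewrite -nrm_sqr; split=> [->|/eqP]; first by rewrite expr1n.
by rewrite sqrp_eq1 ?nrm_ge0 // => /eqP.
Qed.

Lemma nrm1 x : '[x, x] = 1 -> nrm x = 1.
Proof. by move/nrm_eq1. Qed.

Lemma dot_le_nrm x y : `|'[x, y]| <= nrm x * nrm y.
Proof.
rewrite -(@ler_pXn2r _ 2) ?nnegrE ?mulr_ge0 ?nrm_ge0 //.
by rewrite exprMn !nrm_sqr cauchy_schwarz.
Qed.

(* [c] is the cosine of the minimal angle between the subspaces [A] and [B]. *)
Definition is_cos (A B : set H) (c : C) :=
  (exists x y, [/\ A x, B y, '[x, x] = 1, '[y, y] = 1 & `|'[x, y]| = c]) /\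
  (forall x y, A x -> B y -> '[x, x] = 1 -> '[y, y] = 1 -> `|'[x, y]| <= c).

Lemma is_cos_uniq A B c c' : is_cos A B c -> is_cos A B c' -> c = c'.
Proof.
move=> [[x [y [Ax By x1 y1 <-]]] hc] [[x' [y' [Ax' By' x'1 y'1 <-]]] hc'].
by apply/le_anti/andP; split; [exact: hc' | exact: hc].
Qed.

Lemma is_cosC A B c : is_cos A B c -> is_cos B A c.
Proof.
move=> [[x [y [Ax By x1 y1 xy]]] hc]; split.
  by exists y, x; split=> //; rewrite dotC norm_conjC.
by move=> u v Bu Av u1 v1; rewrite dotC norm_conjC; exact: hc.
Qed.

Lemma is_cos_ge0 A B c : is_cos A B c -> 0 <= c.
Proof. by move=> [[x [y [_ _ _ _ <-]]] _]. Qed.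

Lemma is_cos_le1 A B c : is_cos A B c -> c <= 1.
Proof.
move=> [[x [y [_ _ x1 y1 <-]]] _].
by apply: le_trans (dot_le_nrm _ _) _; rewrite !nrm1 ?mulr1.
Qed.

End Norm.

Section Limits.
Variables (R : realType) (H : lmodType R[i]) (dot : {dot H for Num.conj}).
Variable F : set_system nat.
Hypothesis F_ultra : UltraFilter F.

Local Notation "''[' u , v ]" := (dot u%R v%R) : ring_scope.
Local Notation nrm := (nrm dot).
Local Notation C := R[i].

Let F_proper : ProperFilter F.
Proof. exact: ultra_proper. Qed.

Definition ulim (v : nat -> H) (w : H) :=
  forall e, 0 < e -> F [set k | nrm (v k - w) < e].

Lemma ulim_span n (f : 'I_n -> H) (v : nat -> H) (M : C) : onf dot f ->
  (forall k, lin_span f (v k)) -> (forall k, nrm (v k) <= M) ->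
  exists2 w, lin_span f w & ulim v w.
Proof.
move=> of_ fv vM.
have coord i : exists z, forall e, 0 < e -> F [set k | `|'[v k, f i] - z| < e].
  apply: (ultra_lim_complex F_ultra (M := M)) => k.
  apply: le_trans (dot_le_nrm _ _ _) _.
  by rewrite [X in _ * X]nrm1 ?mulr1 // of_ eqxx.
have [z hz] := choice coord.
have fw : lin_span f (\sum_i z i *: f i) by exists z.
exists (\sum_i z i *: f i) => // e e0.
(* The [n] coordinates contribute at most [n * d ^+ 2]; dividing by [n.+1] makes this strictly less
   than [e ^+ 2] and covers [n = 0]. *)
pose d := e / sqrtC n.+1%:R.
have d0 : 0 < d by rewrite divr_gt0 // sqrtC_gt0 ltr0n.
have hall : F [set k | forall i, `|'[v k, f i] - z i| < d].
  by apply: filter_forall => i; exact: hz.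
apply: filterS hall => k /= hk.
rewrite -(@ltr_pXn2r _ 2) ?nnegrE ?nrm_ge0 ?(ltW e0) // nrm_sqr.
rewrite (parseval of_ (spanB (fv k) fw)).
apply: le_lt_trans (_ : \sum_(i < n) d ^+ 2 < _).
  apply: ler_sum => i _; rewrite dotBl dot_comb //.
  by rewrite ler_pXn2r ?nnegrE ?normr_ge0 ?(ltW d0) // ltW.
rewrite sumr_const card_ord /d expr_div_n sqrtCK -[_ *+ n]mulr_natl mulrCA.
rewrite gtr_pMr ?exprn_gt0 // ltr_pdivrMr ?ltr0n // mul1r ltr_nat; exact: ltnSn.
Qed.

Lemma ulim_dot v v' w w' (M : C) : ulim v w -> ulim v' w' ->
  (forall k, nrm (v' k) <= M) ->
  forall e, 0 < e -> F [set k | `|'[v k, v' k] - '[w, w']| < e].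
Proof.
move=> vw vw' vM e e0.
have M0 : 0 <= M by apply: le_trans (vM 0%N); exact: nrm_ge0.
(* The summand 1 keeps the denominator positive and the final estimate strict. *)
have S0 : 0 < M + nrm w + 1 by rewrite ltr_wpDl // addr_ge0 // nrm_ge0.
pose d := e / (M + nrm w + 1); have d0 : 0 < d by rewrite divr_gt0.
apply: filterS (filterI (vw d d0) (vw' d d0)) => k /= [h h'].
have -> : '[v k, v' k] - '[w, w'] = '[v k - w, v' k] + '[w, v' k - w'].
  by rewrite dotBl dotBr addrA subrK.
apply: le_lt_trans (ler_normD _ _) _.
apply: le_lt_trans (_ : d * M + nrm w * d < _).
  apply: lerD; apply: le_trans (dot_le_nrm _ _ _) _.
    by rewrite ler_pM ?nrm_ge0 // ltW.
  by rewrite ler_wpM2l ?nrm_ge0 // ltW.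
rewrite [X in _ + X]mulrC -mulrDr -[ltRHS](divfK (lt0r_neq0 S0)) -/d.
by rewrite ltr_pM2l // ltrDl.
Qed.

Lemma ulim_dot_const v v' w w' c : ulim v w -> ulim v' w' ->
  (forall k, nrm (v' k) <= 1) -> (forall k, '[v k, v' k] = c) -> '[w, w'] = c.
Proof.
move=> vw vw' v1 vc; apply/eqP; rewrite eq_sym -subr_eq0 -normr_eq0.
apply/negPn/negP => n0.
have e0 : 0 < `|c - '[w, w']| by rewrite lt_def n0 normr_ge0.
have [k /=] := filter_ex (ulim_dot vw vw' v1 e0).
by rewrite vc ltxx.
Qed.

End Limits.

Section CosExists.
Variables (R : realType) (H : lmodType R[i]) (dot : {dot H for Num.conj}).

Local Notation "''[' u , v ]" := (dot u%R v%R) : ring_scope.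
Local Notation C := R[i].

(** Nearly optimal pairs of unit vectors stay in finite-dimensional spans, so they converge along an
    ultrafilter, to unit vectors at which the supremum is attained. *)
Lemma is_cos_exists n m (f : 'I_n -> H) (g : 'I_m -> H) :
  (0 < n)%N -> (0 < m)%N -> onf dot f -> onf dot g ->
  exists c, is_cos dot (lin_span f) (lin_span g) c.
Proof.
move=> n0 m0 of_ og; have [F uF Foo] := free_ultrafilter.
have pF : ProperFilter F := ultra_proper.
pose E := [set r : R | exists x y, [/\ lin_span f x, lin_span g y, '[x, x] = 1,
  '[y, y] = 1 & `|'[x, y]| = r%:C%C]].
have normE (z : C) : `|z| = (complex.Re `|z|)%:C%C by rewrite normc_def.
have E_in x y : lin_span f x -> lin_span g y -> '[x, x] = 1 -> '[y, y] = 1 ->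
    E (complex.Re `|'[x, y]|).
  by move=> fx gy x1 y1; exists x, y; split.
have supE : has_sup E.
  split.
    exists (complex.Re `|'[f (Ordinal n0), g (Ordinal m0)]|); apply: E_in;
      by [exact: span_self | rewrite (of_, og) eqxx].
  exists 1 => r [x [y [_ _ x1 y1 xy]]]; rewrite -lecR -xy.
  by apply: le_trans (dot_le_nrm _ _ _) _; rewrite !nrm1 ?mulr1.
have approx k : exists xy : H * H, [/\ lin_span f xy.1, lin_span g xy.2,
    '[xy.1, xy.1] = 1, '[xy.2, xy.2] = 1 & (sup E - k.+1%:R^-1)%:C%C <= `|'[xy.1, xy.2]|].
  have k0 : 0 < k.+1%:R^-1 :> R by rewrite invr_gt0 ltr0n.
  have [r [x [y [fx gy x1 y1 xy]]] hr] := sup_adherent k0 supE.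
  by exists (x, y); split => //; rewrite xy lecR ltW.
have [s hs] := choice approx.
have [||x fx xl] := @ulim_span _ _ dot F uF _ f (fun k => (s k).1) 1 of_.
- by move=> k; case: (hs k).
- by move=> k; rewrite nrm1 //; case: (hs k).
have [||y gy yl] := @ulim_span _ _ dot F uF _ g (fun k => (s k).2) 1 og.
- by move=> k; case: (hs k).
- by move=> k; rewrite nrm1 //; case: (hs k).
have s21 k : nrm dot (s k).2 <= 1 by rewrite nrm1 //; case: (hs k).
have s11 k : nrm dot (s k).1 <= 1 by rewrite nrm1 //; case: (hs k).
have x1 : '[x, x] = 1.
  by apply: (ulim_dot_const uF xl xl s11) => k; case: (hs k).
have y1 : '[y, y] = 1.
  by apply: (ulim_dot_const uF yl yl s21) => k; case: (hs k).
have supxy : sup E <= complex.Re `|'[x, y]|.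
  rewrite leNgt; apply/negP => lt; pose d := (sup E - complex.Re `|'[x, y]|) / 2.
  have d0 : 0 < d by rewrite divr_gt0 // subr_gt0.
  have d0' : 0 < d%:C%C :> C by rewrite ltcR.
  have [N hN] : exists N, (N.+1%:R^-1 : R) < d.
    have := archi_boundP (ltW (_ : 0 < d^-1)); rewrite invr_gt0 => /(_ d0) hN.
    exists (Num.bound d^-1); rewrite invf_plt ?posrE ?ltr0n //.
    by apply: lt_trans hN _; rewrite ltr_nat.
  have [k /= [hk mk]] := filter_ex (filterI (ulim_dot uF xl yl s21 d0') (Foo N)).
  case: (hs k) => _ _ _ _ hle.
  suff /(le_lt_trans hle) : `|'[(s k).1, (s k).2]| < (sup E - k.+1%:R^-1)%:C%C.
    by rewrite ltxx.
  have -> : '[(s k).1, (s k).2] = ('[(s k).1, (s k).2] - '[x, y]) + '[x, y].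
    by rewrite subrK.
  apply: le_lt_trans (ler_normD _ _) _.
  apply: lt_le_trans (_ : d%:C%C + `|'[x, y]| <= _); first by rewrite ltrD2r.
  rewrite (normE '[x, y]) -rmorphD lecR.
  have -> : sup E = d + d + complex.Re `|'[x, y]|.
    by rewrite -mulr2n -mulr_natr divfK ?pnatr_eq0 // subrK.
  have kd : k.+1%:R^-1 <= d.
    by apply/ltW; apply: le_lt_trans hN; rewrite lef_pV2 ?posrE ?ltr0n // ler_nat.
  move: (complex.Re _) (k.+1%:R^-1) kd => r q kd; move: (d) kd => d1 kd.
  lra.
exists `|'[x, y]|; split; first by exists x, y.
move=> u v fu gv u1 v1; rewrite (normE '[u, v]) (normE '[x, y]) lecR.
apply: le_trans supxy.
exact: (ub_le_sup (proj2 supE) (E_in _ _ fu gv u1 v1)).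
Qed.

End CosExists.

(** * Projections as orthonormal frames, angles as cosines *)

Section Projections.
Variables (R : realType) (H : completeNormedModType R[i]).
Variables (dot : {dot H for Num.conj}).
Hypothesis dot_norm : forall x : H, dot x x = `|x| ^+ 2.

Local Notation "''[' u , v ]" := (dot u%R v%R) : ring_scope.

Lemma norm_eq1 (x : H) : (`|x| = 1) <-> ('[x, x] = 1).
Proof.
rewrite dot_norm; split=> [->|/eqP]; first by rewrite expr1n.
by rewrite sqrp_eq1 // => /eqP.
Qed.

Lemma Pn_range n (P : Pn dot n) x : range P x <-> P x = x.
Proof.
have [_ _ _ idem] := Pn_projection P.
by split=> [[y _ <-]|<-]; [exact: idem | exists x].
Qed.

(** [P] is self-adjoint and fixes its range, so the coordinates of [P x] in a frame of the range are
    those of [x]. *)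
Lemma Pn_frame n (P : Pn dot n) : exists f : 'I_n -> H,
  [/\ onf dot f, range P = lin_span f & P =1 projf dot f].
Proof.
have [e [ie eP]] := Pn_rank P.
have [f [of_ fe]] := gram_schmidt dot ie.
have rP : range P = lin_span f by rewrite fe.
exists f; split => // x.
have [_ _ adj idem] := Pn_projection P.
have fPx : lin_span f (P x) by rewrite -rP; exists x.
rewrite -[LHS](projf_id of_ fPx); apply: eq_bigr => i _.
have /Pn_range Pf : range P (f i) by rewrite rP; exact: span_self.
by rewrite adj Pf.
Qed.

Lemma Pn_of_frame n (f : 'I_n -> H) : onf dot f ->
  exists P : Pn dot n, range P = lin_span f.
Proof.
move=> of_.
have rf : range (projf dot f) = lin_span f.
  apply/seteqP; split=> [_ [x _ <-]|x fx]; first exact: projf_span.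
  by exists x => //; exact: projf_id.
have pf : is_projection dot (projf dot f).
  split.
  - by move=> a x y; rewrite projfD projfZ.
  - exists 1 => x; rewrite mul1r -(@ler_pXn2r _ 2) ?nnegrE //.
    by rewrite -!dot_norm dot_projf_le.
  - by move=> x y; rewrite dot_projf_sym.
  - by move=> x /=; rewrite projf_id //; exact: projf_span.
have df : has_dim (range (projf dot f)) n.
  by exists f; split; [exact: onf_indep of_ | rewrite rf].
by exists (MkPn pf df).
Qed.

Lemma Pn_cos n (P Q : Pn dot n) : (0 < n)%N ->
  exists c, is_cos dot (range P) (range Q) c.
Proof.
move=> n0; have [f [of_ -> _]] := Pn_frame P; have [g [og -> _]] := Pn_frame Q.
exact: is_cos_exists.
Qed.

(** The greatest cosine gives the least angle, because [acos] is decreasing; this is drawn from the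
    strict monotonicity of [cos] on [[0, pi]]. *)
Lemma ma_acos n (P Q : Pn dot n) c : is_cos dot (range P) (range Q) c ->
  ma P Q = acos (complex.Re c).
Proof.
move=> [[x [y [Px Qy x1 y1 xy]]] hc]; apply: minimum_eq.
  exists x; first by split=> //; apply/norm_eq1.
  exists y; first by split=> //; apply/norm_eq1.
  by rewrite /angle -xy.
move=> _ [u [Pu /norm_eq1 u1] [v [Qv /norm_eq1 v1] <-]].
rewrite /angle; set a := ComplexField.Normc.normc _.
have ac : a <= complex.Re c.
  by have := hc _ _ Pu Qv u1 v1; rewrite lecE => /andP[_].
have a0 : 0 <= a by have := normr_ge0 '[u, v]; rewrite lecE => /andP[_].
have c1 : complex.Re c <= 1.
  rewrite -xy.
  have := dot_le_nrm dot x y; rewrite !nrm1 // mulr1.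
  by rewrite lecE => /andP[_].
have aI : -1 <= a <= 1.
  by rewrite (le_trans _ a0) ?lerN10 // (le_trans ac).
have cI : -1 <= complex.Re c <= 1.
  by rewrite c1 andbT (le_trans _ (le_trans a0 ac)) ?lerN10.
rewrite leNgt; apply/negP => lt.
have : cos (acos (complex.Re c)) < cos (acos a).
  by rewrite ltr_cos ?in_itv /= ?acos_ge0 ?acos_lepi.
by rewrite !acosK ?in_itv // ltNge ac.
Qed.

Lemma ma_cos n (P Q P' Q' : Pn dot n) c : (0 < n)%N -> ma P Q = ma P' Q' ->
  is_cos dot (range P) (range Q) c -> is_cos dot (range P') (range Q') c.
Proof.
move=> n0 mE hc; have [c' hc'] := Pn_cos P' Q' n0.
suff -> : c = c' by [].
move: mE; rewrite (ma_acos hc) (ma_acos hc') => aE.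
have reI (A B : set H) (d : R[i]) : is_cos dot A B d -> complex.Re d \in `[(-1 : R), 1] /\ d = (complex.Re d)%:C%C.
  move=> hd; have := is_cos_ge0 hd; have := is_cos_le1 hd.
  rewrite !lecE /= => /andP[/eqP _ d1] /andP[/eqP dI d0].
  split; last by case: (d) dI => x y /= ->.
  by rewrite in_itv /= d1 andbT (le_trans _ d0) ?lerN10.
have [cI ->] := reI _ _ _ hc; have [cI' ->] := reI _ _ _ hc'.
by rewrite -[in LHS](acosK cI) aE acosK.
Qed.

End Projections.

(** * Finite-dimensional subspaces as sets, incidence through cosines *)

Section Grassmannian.
Variables (C : numClosedFieldType) (H : lmodType C) (dot : {dot H for Num.conj}).

Local Notation "''[' u , v ]" := (dot u%R v%R) : ring_scope.
Local Notation onf := (onf dot).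
Local Notation is_cos := (is_cos dot).

(** Keeping a subspace as a set with an orthonormal frame makes no reference to the dimension of
    [H], so the finite and the infinite case share one interface. *)
Definition gr n (A : set H) := exists2 f : 'I_n -> H, onf f & A = lin_span f.

Definition semi_isometry (U : H -> H) :=
  (linear U /\ forall x y, '[U x, U y] = '[x, y]) \/
  (linear_for (Num.conj \; *:%R) U /\ forall x y, '[U x, U y] = '[y, x]).

Lemma grZ n A a x : gr n A -> A x -> A (a *: x).
Proof. by move=> [f _ ->]; exact: spanZ. Qed.

Lemma grB n A x y : gr n A -> A x -> A y -> A (x - y).
Proof. by move=> [f _ ->]; exact: spanB. Qed.

Lemma gr_unit n A : gr n.+1 A -> exists2 x, A x & '[x, x] = 1.
Proof.
by move=> [f of_ ->]; exists (f ord0); [exact: span_self | rewrite of_ eqxx].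
Qed.

(** Greedy completion: [k.+1 <= m] vectors leave a unit vector of the [m.+1]-dimensional [A]
    orthogonal to all of them. *)
Lemma gr_frame m A x : gr m.+1 A -> A x -> '[x, x] = 1 ->
  exists f : 'I_m -> H, onf (fcons x f) /\ A = lin_span (fcons x f).
Proof.
move=> [g og AE] Ax x1.
have step k : (k <= m)%N -> exists f : 'I_k -> H,
    [/\ onf f, forall i, A (f i) & forall i, '[x, f i] = 0].
  elim: k => [|k IH] km; first by exists (fun=> 0); split; case.
  have [f [of_ Af xf]] := IH (ltnW km).
  have [y [gy y1 yf]] :=
    exists_orthogonal_unit dot (fcons x f) (onf_indep og) (km : (k.+1 < m.+1)%N).
  have yf' i : '[y, f i] = 0 by have := yf (lift ord0 i); rewrite fconsS.
  exists (fcons y f); split; first exact: onf_fcons.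
    by move=> i; have [j ->|->] := unliftP ord0 i;
       rewrite ?fconsS ?fcons0 // AE.
  move=> i; have [j ->|->] := unliftP ord0 i; rewrite ?fconsS ?fcons0 //.
  by apply: dot_eq0C; have := yf ord0; rewrite fcons0.
have [f [of_ Af xf]] := step m (leqnn m).
have oxf := onf_fcons of_ x1 xf.
have sub : lin_span (fcons x f) `<=` lin_span g.
  apply: span_sub => i; rewrite -AE.
  by have [j ->|->] := unliftP ord0 i; rewrite ?fconsS ?fcons0.
by exists f; split => //; rewrite AE; apply/seteqP; split=> //; exact: onf_full.
Qed.

Lemma gr_eq n A B : gr n A -> gr n B -> A `<=` B -> A = B.
Proof.
move=> [f of_ ->] [g og ->] fg; apply/seteqP; split=> //; exact: onf_full.
Qed.

Lemma cos1_meet A B : is_cos A B 1 ->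
  (forall a x, B x -> B (a *: x)) -> exists x, [/\ A x, B x & '[x, x] = 1].
Proof.
move=> [[x [y [Ax By x1 y1 xy]]] _] BZ; exists x; split=> //.
by rewrite (parallel_of_dot y1 (u := x)) ?xy ?expr1n //; exact: BZ.
Qed.

Lemma meet_cos1 A B x : A x -> B x -> '[x, x] = 1 -> is_cos A B 1.
Proof.
move=> Ax Bx x1; split; first by exists x, x; split=> //; rewrite x1 normr1.
move=> u v _ _ u1 v1.
by apply: le_trans (dot_le_nrm _ _ _) _; rewrite !nrm1 // mulr1.
Qed.

Lemma perp_cos0 n m A B : gr n.+1 A -> gr m.+1 B ->
  (forall u v, A u -> B v -> '[u, v] = 0) -> is_cos A B 0.
Proof.
move=> gA gB AB; have [x Ax x1] := gr_unit gA; have [y By y1] := gr_unit gB.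
split; first by exists x, y; split=> //; rewrite AB // normr0.
by move=> u v Au Bv _ _; rewrite AB // normr0.
Qed.

Lemma cos0_perp n m A B u v : gr n A -> gr m B ->
  is_cos A B 0 -> A u -> B v -> '[u, v] = 0.
Proof.
move=> gA gB [_ AB] Au Bv.
have [->|u0] := eqVneq u 0; first by rewrite dot0l.
have [->|v0] := eqVneq v 0; first by rewrite dot0r.
have [a a0 a1] := unit_scale dot u0; have [b b0 b1] := unit_scale dot v0.
have := AB _ _ (grZ a gA Au) (grZ b gB Bv) a1 b1.
rewrite normr_le0 dotZl dotZr !mulf_eq0 conjC_eq0 (gt_eqF a0) (gt_eqF b0) /=.
by move/eqP.
Qed.

Lemma semi_isometry0 U : semi_isometry U -> U 0 = 0.
Proof.
by case=> -[lU _]; have := lU (-1) 0 0;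
  rewrite scaler0 addr0 /= ?rmorphN1 scaleN1r addNr.
Qed.

Lemma semi_isometryZ U a x : semi_isometry U -> exists b, U (a *: x) = b *: U x.
Proof.
move=> sU; have U0 := semi_isometry0 sU.
case: sU => -[lU _]; have := lU a x 0; rewrite U0 !addr0 => ->.
  by exists a.
by exists a^*.
Qed.

Lemma semi_isometry_into n k A B U : semi_isometry U -> gr n A -> gr k B ->
  (forall z, A z -> '[z, z] = 1 -> B (U z)) -> forall x, A x -> B (U x).
Proof.
move=> sU gA gB AB x Ax; have [->|x0] := eqVneq x 0.
  by rewrite semi_isometry0 //; case: gB => f _ ->; exact: span0.
have [a a0 a1] := unit_scale dot x0.
have -> : x = a^-1 *: (a *: x) by rewrite scalerA mulVf ?scale1r // gt_eqF.
have [b ->] := semi_isometryZ a^-1 (a *: x) sU.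
by apply: (grZ _ gB); apply: AB => //; exact: grZ gA Ax.
Qed.

(** [psi] is extended from the unit sphere by positive homogeneity, which brings it under
    [wigner]. *)
Lemma wigner_unit (psi : H -> H) :
  (forall x, '[x, x] = 1 -> '[psi x, psi x] = 1) ->
  (forall x y, '[x, x] = 1 -> '[y, y] = 1 -> `|'[psi x, psi y]| = `|'[x, y]|) ->
  exists2 U, semi_isometry U &
    forall x, '[x, x] = 1 -> exists a, U x = a *: psi x.
Proof.
move=> psi1 psid.
pose Psi x := nrm dot x *: psi ((nrm dot x)^-1 *: x).
have unit x : x != 0 -> '[(nrm dot x)^-1 *: x, (nrm dot x)^-1 *: x] = 1.
  move=> x0; rewrite dotZl dotZr mulrA geC0_conj ?invr_ge0 ?nrm_ge0 //.
  by rewrite -nrm_sqr expr2 mulrACA !mulVf ?mulr1 // sqrtC_eq0 dnorm_eq0.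
have nrm0 : nrm dot 0 = 0 by rewrite /nrm dot0l sqrtC0.
have [|U [isoU UPsi]] := @wigner C H dot Psi.
  move=> x y.
  have [->|x0] := eqVneq x 0; first by rewrite /Psi nrm0 scale0r !dot0l.
  have [->|y0] := eqVneq y 0; first by rewrite /Psi nrm0 scale0r !dot0r.
  have xE z : z != 0 -> nrm dot z *: ((nrm dot z)^-1 *: z) = z.
    by move=> z0; rewrite scalerA mulfV ?scale1r // sqrtC_eq0 dnorm_eq0.
  rewrite -[in RHS](xE x) // -[in RHS](xE y) // /Psi.
  have scale2 a b u v : `|'[a *: u, b *: v]| = `|a| * (`|b| * `|'[u, v]|).
    by rewrite dotZl dotZr !normrM norm_conjC.
  by rewrite (scale2 (nrm dot x)) [RHS]scale2 psid ?unit.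
exists U => // x x1; have [a aE] := UPsi x; exists a.
by rewrite aE /Psi nrm1 // invr1 !scale1r.
Qed.

(** The cosine of two lines is the modulus of the product of unit generators, so a choice of unit
    vectors in the images satisfies the hypothesis of Wigner's theorem. *)
Lemma grassmann_rank1 (phi : set H -> set H) :
  (forall A, gr 1 A -> gr 1 (phi A)) ->
  (forall A B c, gr 1 A -> gr 1 B -> is_cos A B c -> is_cos (phi A) (phi B) c) ->
  exists2 U, semi_isometry U & forall A x, gr 1 A -> A x -> phi A (U x).
Proof.
move=> phi1 phic.
pose L (x : H) := lin_span (fun _ : 'I_1 => x).
have grL x : '[x, x] = 1 -> gr 1 (L x).
  by move=> x1; exists (fun=> x) => // i j; rewrite !ord1 x1.
have inL x u : L x u -> exists a, u = a *: x.
  by move=> [c _ <-]; exists (c ord0); rewrite big_ord1.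
have ex_psi x : exists y, '[x, x] = 1 -> phi (L x) y /\ '[y, y] = 1.
  have [x1|] := pselect ('[x, x] = 1); last by exists 0.
  by have [y] := gr_unit (phi1 _ (grL x x1)); exists y.
have [psi hpsi] := choice ex_psi.
have cosL x y : '[x, x] = 1 -> '[y, y] = 1 -> is_cos (L x) (L y) `|'[x, y]|.
  move=> x1 y1; split.
    exists x, y; split=> //; exact: (span_self (fun _ : 'I_1 => _) ord0).
  move=> u v /inL[a ->] /inL[b ->].
  rewrite !dotZl !dotZr x1 y1 !mulr1 !mulrA -!normCK => a1 b1.
  rewrite !normrM norm_conjC.
  have unit (c : C) : `|c| ^+ 2 = 1 :> C -> `|c| = 1.
    by move/eqP; rewrite sqrp_eq1 // => /eqP.
  by rewrite (unit _ a1) (unit _ b1) !mul1r.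
have lineP x A u : '[x, x] = 1 -> gr 1 A -> A x -> A u -> exists a, u = a *: x.
  move=> x1 gA Ax Au; have [f [_ AE]] := gr_frame gA Ax x1.
  move: Au; rewrite AE => -[c _ <-]; exists (c ord0).
  by rewrite big_ord1 fcons0.
have [||U isoU UE] := @wigner_unit psi.
- by move=> x x1; case: (hpsi x x1).
- move=> x y x1 y1; have [px px1] := hpsi x x1; have [py py1] := hpsi y y1.
  have [[u [v [pu pv u1 v1 <-]]] _] :=
    phic _ _ _ (grL x x1) (grL y y1) (cosL x y x1 y1).
  have [a uE] := lineP _ _ _ px1 (phi1 _ (grL x x1)) px pu.
  have [b vE] := lineP _ _ _ py1 (phi1 _ (grL y y1)) py pv.
  move: u1 v1; rewrite uE vE !dotZl !dotZr px1 py1 !mulr1 -!normCK => a1 b1.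
  have unit (c : C) : `|c| ^+ 2 = 1 :> C -> `|c| = 1.
    by move/eqP; rewrite sqrp_eq1 // => /eqP.
  by rewrite !normrM norm_conjC (unit _ a1) (unit _ b1) !mul1r.
exists U => // A x gA Ax.
have AE z : A z -> '[z, z] = 1 -> A = L z.
  move=> Az z1; apply/esym/(gr_eq (grL _ z1) gA) => _ /inL[a ->]; exact: (grZ _ gA).
apply: (semi_isometry_into isoU gA (phi1 _ gA)) Ax => z Az z1.
have [a ->] := UE z z1; apply: (grZ _ (phi1 _ gA)).
by rewrite (AE z Az z1); case: (hpsi z z1).
Qed.

End Grassmannian.

(** * Infinite dimension *)

Section InfiniteDimension.
Variables (C : numClosedFieldType) (H : lmodType C) (dot : {dot H for Num.conj}).

Local Notation "''[' u , v ]" := (dot u%R v%R) : ring_scope.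
Local Notation onf := (onf dot).
Local Notation is_cos := (is_cos dot).
Local Notation gr := (gr dot).

Hypothesis inf_dim : forall m, dim_ge H m.

Lemma fresh_unit (s : seq H) :
  exists2 x, '[x, x] = 1 & forall y, y \in s -> '[x, y] = 0.
Proof.
have [e ie] := inf_dim (size s).+1.
have [x [_ x1 xs]] := exists_orthogonal_unit dot (fun i : 'I_(size s) => s`_i) ie (ltnSn _).
exists x => // y ys; have iy : (index y s < size s)%N by rewrite index_mem.
by have := xs (Ordinal iy); rewrite /= nth_index.
Qed.

Lemma fresh_frame k (s : seq H) : exists2 f : 'I_k -> H, onf f &
  forall i y, y \in s -> '[f i, y] = 0.
Proof.
elim: k => [|k [f of_ fs]]; first by exists (fun=> 0); case.
have [x x1 xs] := fresh_unit (s ++ codom f).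
exists (fcons x f).
  apply: onf_fcons => // i; apply: xs; rewrite mem_cat codom_f orbT //.
move=> i y ys; have [j ->|->] := unliftP ord0 i; rewrite ?fconsS ?fcons0 ?fs //.
by rewrite xs // mem_cat ys.
Qed.

Variable m : nat.
Local Notation n := m.+1.

(* [A] and [B] commute and [A /\ B] is the line of [x]. *)
Definition ro (x : H) (A B : set H) :=
  forall u v, A u -> '[u, x] = 0 -> B v -> '[u, v] = 0.

Lemma ro_sym x A B : gr n A -> A x -> '[x, x] = 1 -> ro x A B -> ro x B A.
Proof.
move=> gA Ax x1 AB v u Bv vx Au; apply: dot_eq0C.
have -> : u = (u - '[u, x] *: x) + '[u, x] *: x by rewrite subrK.
rewrite dotDl dotZl (dot_eq0C vx) mulr0 addr0; apply: AB => //.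
  by apply: (grB gA) => //; exact: (grZ _ gA).
by rewrite dotBl dotZl x1 mulr1 subrr.
Qed.

Lemma fcons_perp k x (f : 'I_k -> H) u :
  onf (fcons x f) -> lin_span (fcons x f) u -> '[u, x] = 0 -> lin_span f u.
Proof.
move=> of_ fu ux; rewrite -(projf_id of_ fu) /projf big_ord_recl fcons0 ux.
rewrite scale0r add0r; apply: span_sum => i; apply: spanZ.
rewrite fconsS; exact: span_self.
Qed.

Lemma star_frame x (s : seq H) : '[x, x] = 1 -> exists f : 'I_m -> H,
  onf (fcons x f) /\ forall i y, y \in s -> '[f i, y] = 0.
Proof.
move=> x1; have [f of_ fs] := fresh_frame m (x :: s); exists f; split.
  by apply: onf_fcons => // i; apply: dot_eq0C; apply: fs; rewrite mem_head.
by move=> i y ys; apply: fs; rewrite in_cons ys orbT.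
Qed.

(** The axes of [A] other than [x] are fresh. Three subspaces are what [phi_line] asks for, where
    [T] has to be related to [P], [R0] and [S] at once. *)
Lemma star x B1 B2 B3 : '[x, x] = 1 -> gr n B1 -> gr n B2 -> gr n B3 ->
  exists A, [/\ gr n A, A x, ro x A B1, ro x A B2 & ro x A B3].
Proof.
move=> x1 [f1 _ ->] [f2 _ ->] [f3 _ ->].
have [f [of_ fs]] := star_frame (codom f1 ++ codom f2 ++ codom f3) x1.
have perp k (g : 'I_k -> H) : {subset codom g <= codom f1 ++ codom f2 ++ codom f3} ->
    ro x (lin_span (fcons x f)) (lin_span g).
  move=> gs u v fu ux gv; apply: dot_span0 gv => i; apply: dot_eq0C.
  apply: dot_span0 (fcons_perp of_ fu ux) => j; apply: dot_eq0C.
  by apply: fs; apply: gs; rewrite codom_f.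
exists (lin_span (fcons x f)); split.
- by exists (fcons x f).
- by rewrite -[in X in _ X](fcons0 x f); exact: span_self.
- by apply: perp => y yf; rewrite mem_cat yf.
- by apply: perp => y yf; rewrite !mem_cat yf orbT.
- by apply: perp => y yf; rewrite !mem_cat yf !orbT.
Qed.

Variable phi : set H -> set H.
Hypothesis phi_gr : forall A, gr n A -> gr n (phi A).
Hypothesis phi_cos : forall A B c, gr n A -> gr n B ->
  is_cos A B c -> is_cos (phi A) (phi B) c.

Lemma phi_perp A B u v : gr n A -> gr n B ->
  (forall u v, A u -> B v -> '[u, v] = 0) -> phi A u -> phi B v -> '[u, v] = 0.
Proof.
move=> gA gB AB; apply: cos0_perp (phi_gr gA) (phi_gr gB) _.
by apply: phi_cos => //; exact: perp_cos0 gA gB AB.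
Qed.

Lemma phi_meet A B x : gr n A -> gr n B -> A x -> B x -> '[x, x] = 1 ->
  exists y, [/\ phi A y, phi B y & '[y, y] = 1].
Proof.
move=> gA gB Ax Bx x1; apply: cos1_meet.
  by apply: phi_cos => //; exact: meet_cos1 Ax Bx x1.
by move=> a y; exact: grZ (phi_gr gB).
Qed.

(* Completing [B] (resp. [D]) by mutually orthogonal [Q_i], one through each
   remaining axis of [A], splits [phi A] into mutually orthogonal lines; the line
   in [phi B] and the one in [phi D] are both the orthogonal of the others. *)
Lemma phi_meet_indep A B D x v : gr n A -> gr n B -> gr n D ->
  A x -> B x -> D x -> '[x, x] = 1 -> ro x A B -> ro x A D ->
  phi A v -> phi B v -> phi D v.
Proof.
move=> gA gB gD Ax Bx Dx x1 AB AD Av Bv.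
have [f [of_ AE]] := gr_frame gA Ax x1.
have [gb ob BE] := gB; have [gd od DE] := gD.
(* Each of the [m] subspaces [q i] needs [m] fresh axes besides [f i]; the pairs [(i, j)] index
   them. *)
have [h oh hs] := fresh_frame #|{: 'I_m * 'I_m}| (codom (fcons x f) ++ codom gb ++ codom gd).
pose q i := fcons (f i) (fun j => h (enum_rank (i, j))).
have fA i : A (f i) by rewrite AE -(fconsS x); exact: span_self.
have fx i : '[f i, x] = 0.
  by have := of_ (lift ord0 i) ord0; rewrite fconsS fcons0 eq_sym eq_liftF.
have off i j : '[f i, f j] = (i == j)%:R.
  by have := of_ (lift ord0 i) (lift ord0 j); rewrite !fconsS (inj_eq (@lift_inj _ _)).
have hf k i : '[h k, f i] = 0.
  by apply: hs; rewrite mem_cat -(fconsS x) codom_f.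
have hh i j i' j' : '[h (enum_rank (i, j)), h (enum_rank (i', j'))] = ((i, j) == (i', j'))%:R.
  by rewrite oh (inj_eq enum_rank_inj).
have oq i : onf (q i).
  apply: onf_fcons; last by move=> j; apply: dot_eq0C; exact: hf.
    by move=> j j'; rewrite hh xpair_eqE eqxx.
  by rewrite off eqxx.
have gq i : gr n (lin_span (q i)) by exists (q i).
have qq i j : i != j -> forall u v, lin_span (q i) u -> lin_span (q j) v -> '[u, v] = 0.
  move=> ij u w qu qw; apply: dot_span0 qw => k; apply: dot_eq0C.
  apply: dot_span0 qu => l; rewrite /q.
  have [k' ->|->] := unliftP ord0 k; have [l' ->|->] := unliftP ord0 l;
    rewrite ?fconsS ?fcons0.
  - by rewrite hh xpair_eqE eq_sym (negbTE ij).
  - by rewrite hf.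
  - by rewrite dot_eq0C // hf.
  - by rewrite off eq_sym (negbTE ij).
have perpq E g : E = lin_span g -> {subset codom g <= codom (fcons x f) ++ codom gb ++ codom gd} ->
    ro x A E -> forall i (u v : H), E u -> lin_span (q i) v -> '[u, v] = 0.
  move=> EE gs AE' i u w Eu qw; apply: dot_span0 qw => l; rewrite /q.
  have [l' ->|->] := unliftP ord0 l; rewrite ?fconsS ?fcons0.
    apply: dot_eq0C; rewrite EE in Eu; apply: dot_span0 Eu => j.
    by apply: hs; apply: gs; rewrite codom_f.
  by apply: dot_eq0C; apply: AE'.
have sB : {subset codom gb <= codom (fcons x f) ++ codom gb ++ codom gd}.
  by move=> y yb; rewrite !mem_cat yb orbT.
have sD : {subset codom gd <= codom (fcons x f) ++ codom gb ++ codom gd}.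
  by move=> y yb; rewrite !mem_cat yb !orbT.
have perpB := perpq _ _ gb BE sB AB; have perpD := perpq _ _ gd DE sD AD.
have ex_a i : exists y, [/\ phi A y, phi (lin_span (q i)) y & '[y, y] = 1].
  apply: (@phi_meet _ _ (f i)) => //; last by rewrite off eqxx.
  by rewrite -[in X in _ X](fcons0 (f i) (fun j => h (enum_rank (i, j)))); exact: span_self.
have [a ha] := choice ex_a.
have oa : onf a.
  move=> i j; case: eqVneq => [->|ij]; first by case: (ha j).
  have [_ ai _] := ha i; have [_ aj _] := ha j.
  exact: phi_perp (gq i) (gq j) (qq _ _ ij) ai aj.
have [b [Ab Db b1]] := phi_meet gA gD Ax Dx x1.
have ba i : '[b, a i] = 0.
  have [_ ai _] := ha i; exact: phi_perp gD (gq i) (perpD i) Db ai.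
have va i : '[v, a i] = 0.
  have [_ ai _] := ha i; exact: phi_perp gB (gq i) (perpB i) Bv ai.
have oba := onf_fcons oa b1 ba.
have AE' : lin_span (fcons b a) = phi A.
  apply: (gr_eq (n := n) (dot := dot)); [by exists (fcons b a)|exact: phi_gr|].
  have [g og gE] := phi_gr gA; rewrite gE; apply: span_sub => i; rewrite -gE.
  by have [j ->|->] := unliftP ord0 i; rewrite ?fconsS ?fcons0 //; case: (ha j).
move: (Av); rewrite -AE' => /(projf_id oba) <-.
rewrite /projf big_ord_recl fcons0 big1 ?addr0 => [|i _].
  by apply: (grZ _ (phi_gr gD)).
by rewrite fconsS va scale0r.
Qed.

(** [a] is taken in [phi R0] and [phi S] for two fixed subspaces. A given [P] need not be related by
    [ro] to [R0], so an intermediate [T] is used: independence inside [R0] moves [a] from [phi S] to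
    [phi T], then independence inside [T] moves it from [phi R0] to [phi P]. *)
Lemma phi_line x : '[x, x] = 1 ->
  exists2 a, '[a, a] = 1 & forall P, gr n P -> P x -> phi P a.
Proof.
move=> x1.
have [f [of_ _]] := star_frame [::] x1.
have gR : gr n (lin_span (fcons x f)) by exists (fcons x f).
have Rx : lin_span (fcons x f) x.
  by rewrite -[in X in _ X](fcons0 x f); exact: span_self.
set R0 := lin_span _ in gR Rx.
have [S [gS Sx SR _ _]] := star x1 gR gR gR.
have [a [Ra Sa a1]] := phi_meet gR gS Rx Sx x1.
exists a => // P gP Px.
have [T [gT Tx TP TR TS]] := star x1 gP gR gS.
have Ta : phi T a.
  apply: (@phi_meet_indep R0 S T x) => //; exact: ro_sym.
exact: (@phi_meet_indep T R0 P x).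
Qed.

(** The rank is at least 2, so any two vectors lie in a common subspace of rank [n]; rank 1 is
    [grassmann_rank1]. *)
Hypothesis m_gt0 : (0 < m)%N.

Lemma grassmann_infinite :
  exists2 U, semi_isometry dot U & forall A x, gr n A -> A x -> phi A (U x).
Proof.
have ex_psi x : exists a, '[x, x] = 1 ->
    '[a, a] = 1 /\ forall P, gr n P -> P x -> phi P a.
  have [x1|] := pselect ('[x, x] = 1); last by exists 0.
  by have [a a1 ha] := phi_line x1; exists a.
have [psi hpsi] := choice ex_psi.
(* The remaining axes are fresh: those added to [x] are orthogonal to [y], those added to [y] to the
   whole first subspace. The cosine is then exactly [|'[x, y]|], and it bounds the product of
   [psi x] and [psi y], which lie in the images. *)
have psi_le x y : '[x, x] = 1 -> '[y, y] = 1 -> `|'[psi x, psi y]| <= `|'[x, y]|.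
  move=> x1 y1.
  have [f [of_ fy]] := star_frame [:: y] x1.
  have [g [og gf]] := star_frame (codom (fcons x f)) y1.
  have inl k z (p : 'I_k -> H) : lin_span (fcons z p) z.
    by rewrite -[in X in _ X](fcons0 z p); exact: span_self.
  have gP : gr n (lin_span (fcons x f)) by exists (fcons x f).
  have gQ : gr n (lin_span (fcons y g)) by exists (fcons y g).
  have hc : is_cos (lin_span (fcons x f)) (lin_span (fcons y g)) `|'[x, y]|.
    split; first by exists x, y; split.
    move=> u v fu gv u1 v1.
    have ux : `|'[u, x]| <= 1.
      by apply: le_trans (dot_le_nrm _ _ _) _; rewrite !nrm1 // mulr1.
    have vy : `|'[v, y]| <= 1.
      by apply: le_trans (dot_le_nrm _ _ _) _; rewrite !nrm1 // mulr1.
    have uE : '[u, y] = '[u, x] * '[x, y].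
      rewrite -[in LHS](projf_id of_ fu) dot_suml big_ord_recl fcons0 dotZl big1 ?addr0 // => i _.
      by rewrite fconsS dotZl fy ?mulr0 // mem_head.
    have vE : '[u, v] = '[v, y]^* * '[u, y].
      rewrite -[in LHS](projf_id og gv) dot_sumr big_ord_recl fcons0 dotZr big1 ?addr0 // => i _.
      rewrite fconsS dotZr (_ : '[u, g i] = 0) ?mulr0 //.
      apply: dot_eq0C; apply: dot_span0 fu => j; apply: gf; exact: codom_f.
    rewrite vE uE !normrM norm_conjC mulrA; apply: ler_piMl => //.
    by rewrite -[leRHS]mulr1 ler_pM.
  have [_ hle] := phi_cos gP gQ hc.
  have [px1 px] := hpsi x x1; have [py1 py] := hpsi y y1.
  by apply: hle => //; [apply: px|apply: py].
(* Take a frame [e] that starts with [x] and whose span contains [y]. By [psi_le] its image is again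
   orthonormal, and by dimension it spans an image that contains [psi y]. Both Parseval sums are 1
   and are ordered term by term, so all terms agree. *)
have psi_eq x y : '[x, x] = 1 -> '[y, y] = 1 -> `|'[psi x, psi y]| = `|'[x, y]|.
  move=> x1 y1; have [e [oe ex ey]] : exists e : 'I_n -> H,
      [/\ onf e, e ord0 = x & lin_span e y].
    case: m m_gt0 => // k _.
    have [z [z1 zx [a yE]]] : exists z, [/\ '[z, z] = 1, '[x, z] = 0 &
        exists a, y = '[y, x] *: x + a *: z].
      pose y' := y - '[y, x] *: x.
      have y'x : '[x, y'] = 0.
        by apply: dot_eq0C; rewrite /y' dotBl dotZl x1 mulr1 subrr.
      have [y'0|y'0] := eqVneq y' 0.
        have [z z1 zx] := fresh_unit [:: x]; exists z; split => //.
          by apply: dot_eq0C; apply: zx; rewrite mem_head.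
        by exists 0; rewrite scale0r addr0; apply/eqP; rewrite -subr_eq0 -/y' y'0.
      have [a a0 a1] := unit_scale dot y'0; exists (a *: y'); split => //.
        by rewrite dotZr y'x mulr0.
      exists a^-1; rewrite scalerA mulVf ?scale1r ?gt_eqF //.
      by rewrite /y' addrC subrK.
    have [f of_ fs] := fresh_frame k [:: x; z].
    exists (fcons x (fcons z f)); split; last 2 first.
    - by rewrite fcons0.
    - rewrite yE; apply: span_fcons; rewrite -[_ *: z]addr0; apply: span_fcons.
      exact: span0.
    apply: onf_fcons => //.
      apply: onf_fcons => // i; apply: dot_eq0C; apply: fs.
      by rewrite !inE eqxx orbT.
    move=> i; have [j ->|->] := unliftP ord0 i; rewrite ?fconsS ?fcons0 //.
    by apply: dot_eq0C; apply: fs; rewrite mem_head.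
  have e1 i : '[e i, e i] = 1 by rewrite oe eqxx.
  have ope : onf (fun i => psi (e i)).
    move=> i j; case: eqVneq => [->|ij]; first by case: (hpsi _ (e1 j)).
    apply/eqP; rewrite -normr_le0; apply: le_trans (psi_le _ _ (e1 i) (e1 j)) _.
    by rewrite oe (negbTE ij) normr0.
  have gP : gr n (lin_span e) by exists e.
  have [py1 /(_ _ gP ey) py] := hpsi y y1.
  have phE : lin_span (fun i => psi (e i)) = phi (lin_span e).
    apply: (gr_eq (n := n) (dot := dot)); [by exists (fun i => psi (e i))|exact: phi_gr|].
    have [g og gE] := phi_gr gP; rewrite gE; apply: span_sub => i; rewrite -gE.
    have [_] := hpsi _ (e1 i); apply => //; exact: span_self.
  rewrite -phE in py.
  have le0 i : 0 <= `|'[y, e i]| ^+ 2 - `|'[psi y, psi (e i)]| ^+ 2.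
    by rewrite subr_ge0 ler_pXn2r ?nnegrE // psi_le.
  have : \sum_i (`|'[y, e i]| ^+ 2 - `|'[psi y, psi (e i)]| ^+ 2) = 0.
    rewrite sumrB -(parseval oe ey) y1 -(parseval ope py) py1 subrr //.
  move/psumr_eq0P => /(_ (fun i _ => le0 i)) /(_ ord0 isT) /eqP.
  rewrite subr_eq0 ex eqrXn2 // => /eqP xy.
  by rewrite (dotC dot (psi x)) (dotC dot x) !norm_conjC xy.
have [|U isoU UE] := wigner_unit _ psi_eq; first by move=> x /hpsi[].
exists U => // A x gA Ax.
apply: (semi_isometry_into isoU gA (phi_gr gA)) Ax => z Az z1.
have [a ->] := UE z z1; apply: (grZ _ (phi_gr gA)).
by have [_] := hpsi z z1; apply.
Qed.

End InfiniteDimension.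

(** * The Grassmann graph *)

Section GrassmannGraph.
Variables (K : fieldType) (V : vectType K).
Implicit Types (P Q R S A W X Y : {vspace V}).
Local Open Scope vspace_scope.

Lemma exists_subspace Y k : (k <= \dim Y)%N ->
  exists2 X, (X <= Y)%VS & \dim X = k.
Proof.
move=> kY; exists <<take k (vbasis Y)>>.
  by apply/span_subvP => v /mem_take /vbasis_mem.
have fY := basis_free (vbasisP Y).
have : free (take k (vbasis Y)) by apply: (@catl_free _ _ (drop k (vbasis Y))); rewrite cat_take_drop.
by move/eqP ->; rewrite size_take size_tuple; move: kY; case: ltngtP.
Qed.

(** [W] is enlarged inside a complement of [W + R]. *)
Lemma exists_avoiding R W k : (W :&: R = 0)%VS ->
  (\dim W <= k)%N -> (k + \dim R <= \dim {:V})%N ->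
  exists S, [/\ \dim S = k, (W <= S)%VS & (S :&: R = 0)%VS].
Proof.
move=> WR Wk kV.
have dWR : \dim (W + R) = (\dim W + \dim R)%N by rewrite dimv_disjoint_sum.
have [|X XC dX] := @exists_subspace (W + R)^C (k - \dim W).
  by rewrite dimv_compl dWR; lia.
have XWR : (X :&: (W + R) = 0)%VS.
  apply/eqP; rewrite -subv0 -(capv_compl (W + R)) capvC.
  by rewrite subv_cap capvSl (subv_trans (capvSr _ _)).
exists (W + X); split; last 1 first.
- apply/eqP; rewrite -subv0; apply/subvP => v /memv_capP[/memv_addP[w Ww [x Xx vE]] Rv].
  have x0 : x = 0%R.
    apply/eqP; rewrite -memv0 -XWR; apply/memv_capP; split=> //.
    have -> : x = (v - w)%R by rewrite vE addrC addKr.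
    by rewrite addrC memv_add // rpredN.
  by rewrite -WR; apply/memv_capP; split=> //; rewrite vE x0 addr0.
- rewrite dimv_disjoint_sum ?dX; first lia.
  apply/eqP; rewrite -subv0 -XWR capvC capvS //; exact: addvSl.
- exact: addvSl.
Qed.

Lemma dim_add_line W v : v \notin W -> \dim (W + <[v]>) = (\dim W).+1.
Proof.
move=> vW; rewrite dimv_disjoint_sum ?dim_vline.
  by case: eqVneq vW => [->|_ _]; rewrite ?mem0v ?addn1.
apply/eqP; rewrite -subv0; apply/subvP => u /memv_capP[Wu /vlineP[c uE]].
rewrite memv0 uE scaler_eq0; case: eqVneq => //= c0.
by move: Wu; rewrite uE rpredZeq (negbTE c0) (negbTE vW).
Qed.

Lemma exists_between W Y k : (W <= Y)%VS -> (\dim W <= k)%N ->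
  (k <= \dim Y)%N -> exists X, [/\ (W <= X)%VS, (X <= Y)%VS & \dim X = k].
Proof.
move=> WY Wk kY; have [|X XY dX] := @exists_subspace (Y :\: W) (k - \dim W).
  by have := dimv_cap_compl Y W; rewrite (capv_idPr WY); move: kY; clear; lia.
exists (W + X); split; first exact: addvSl.
  by rewrite subv_add WY (subv_trans XY) ?diffvSl.
rewrite dimv_disjoint_sum ?dX; first by move: Wk; clear; lia.
apply/eqP; rewrite -subv0 -(capv_diff Y W) subv_cap capvSl andbT.
exact: subv_trans (capvSr _ _) XY.
Qed.

Lemma eqv_dim W X : (W <= X)%VS -> \dim W = \dim X -> W = X.
Proof. by move=> WX dWX; apply/eqP; rewrite eqEdim WX dWX leqnn. Qed.

Lemma nsub_exists W X : ~~ (W <= X)%VS -> exists2 v, v \in W & v \notin X.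
Proof. by move/subvPn. Qed.

Lemma nz_exists W : (W != 0)%VS -> exists2 v, v \in W & v != 0%R.
Proof.
move=> W0; have /nsub_exists[v vW v0] : ~~ (W <= 0)%VS by rewrite subv0.
by exists v => //; rewrite -memv0.
Qed.

Lemma meet_nz W X v : v \in W -> v \in X -> v != 0%R -> (W :&: X != 0)%VS.
Proof.
move=> vW vX; apply: contraNneq => WX0.
by rewrite -memv0 -WX0; apply/memv_capP.
Qed.

Variable m : nat.
Local Notation n := m.+1.
Hypothesis m_gt0 : (0 < m)%N.
Hypothesis dimV : (n + n <= \dim {:V})%N.

Definition adj P Q := (P != Q) && (\dim (P :&: Q) == m).

(* For distinct [P], [Q], [R] this holds exactly when [P] and [Q] are adjacent and
   [R] lies in their pencil; it only refers to the relation of meeting. *)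
Definition pcl P Q R := forall S, \dim S = n ->
  (S :&: P != 0)%VS -> (S :&: Q != 0)%VS -> (S :&: R != 0)%VS.

Lemma adjC P Q : adj P Q = adj Q P.
Proof. by rewrite /adj eq_sym capvC. Qed.

Lemma adjI P Q : \dim P = n -> \dim Q = n -> (m <= \dim (P :&: Q))%N ->
  P != Q -> adj P Q.
Proof.
move=> dP dQ mPQ PQ; rewrite /adj PQ /= eqn_leq mPQ andbT -ltnS -dP.
rewrite ltn_neqAle dimvS ?capvSl // andbT; apply: contra PQ => /eqP dPQ.
have PQP := eqv_dim (capvSl P Q) dPQ.
rewrite -PQP; apply/eqP/eqv_dim; first exact: capvSr.
by rewrite dPQ dP dQ.
Qed.

Lemma adj_dim P Q : adj P Q -> \dim (P :&: Q) = m.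
Proof. by case/andP => _ /eqP. Qed.

Lemma adj_dim_add P Q : \dim P = n -> \dim Q = n -> adj P Q ->
  \dim (P + Q) = n.+1.
Proof. by move=> dP dQ /adj_dim dPQ; have := dimv_sum_cap P Q; lia. Qed.

(** If [s] in [S :&: P] is outside [R], then [R + <[s]> = P + Q], so a nonzero [t] in [S :&: Q] is
    [r + c *: s] with [r] in [S :&: R]; when [r = 0], [t] itself lies in [P :&: Q], hence in [R]. *)
Lemma pencil_pcl P Q R : \dim P = n -> \dim Q = n -> \dim R = n -> adj P Q ->
  (P :&: Q <= R)%VS -> (R <= P + Q)%VS -> pcl P Q R.
Proof.
move=> dP dQ dR aPQ PQR RPQ S dS /nz_exists[s /memv_capP[sS sP] s0].
move=> /nz_exists[t /memv_capP[tS tQ] t0].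
have [sR|sR] := boolP (s \in R); first exact: meet_nz sS sR s0.
have PQE : R + <[s]> = P + Q.
  apply: eqv_dim; last by rewrite dim_add_line // adj_dim_add // dR.
  by rewrite subv_add RPQ -memvE (subvP (addvSl P Q)).
have : t \in R + <[s]> by rewrite PQE (subvP (addvSr P Q)).
move=> /memv_addP[r rR [_ /vlineP[c ->] tE]].
have [r0|r0] := eqVneq r 0%R.
  apply: (meet_nz tS) t0; apply: (subvP PQR); apply/memv_capP; split=> //.
  by rewrite tE r0 add0r rpredZ.
apply: (meet_nz _ rR r0).
by rewrite (_ : r = (t - c *: s)%R) ?rpredB ?rpredZ // tE addrK.
Qed.

(** If the span of nonzero [p] in [P] and [q] in [Q] missed [R], it would extend to an
    [n]-dimensional [S] that misses [R]. Hence every such span meets [R]: [p = q] gives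
    [P :&: Q <= R], and [p], [q] outside [R] give [R + <[p]> = R + <[q]>], which therefore contains
    [P + Q]. *)
Lemma pcl_pencil P Q R : \dim P = n -> \dim Q = n -> \dim R = n ->
  P != Q -> R != P -> R != Q -> pcl P Q R ->
  [/\ adj P Q, (P :&: Q <= R)%VS & (R <= P + Q)%VS].
Proof.
move=> dP dQ dR PQ RP RQ pc.
have meetR p q : p \in P -> q \in Q -> p != 0%R -> q != 0%R ->
    ((<[p]> + <[q]>) :&: R != 0)%VS.
  move=> pP qQ p0 q0; apply/negP => /eqP W0.
  have dW : (\dim (<[p]> + <[q]>) <= n)%N.
    have := dimv_sum_cap <[p]> <[q]>; rewrite !dim_vline p0 q0 /=; lia.
  have [|S [dS WS /eqP]] := @exists_avoiding R _ n W0 dW.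
    by rewrite dR.
  apply/negP; apply: pc => //.
  - apply: (meet_nz _ pP p0); apply: (subvP WS); apply: (subvP (addvSl _ _)).
    exact: memv_line.
  - apply: (meet_nz _ qQ q0); apply: (subvP WS); apply: (subvP (addvSr _ _)).
    exact: memv_line.
have PQR : (P :&: Q <= R)%VS.
  apply/subvP => v /memv_capP[vP vQ].
  have [->|v0] := eqVneq v 0%R; first exact: mem0v.
  have := meetR v v vP vQ v0 v0; rewrite addvv => /nz_exists[u].
  move=> /memv_capP[/vlineP[c ->] cR] c0.
  move: cR c0; rewrite rpredZeq scaler_eq0 negb_or => cR /andP[c0 _].
  by move: cR; rewrite (negbTE c0).
have nsub X : \dim X = n -> R != X -> exists2 v, v \in X & v \notin R.
  move=> dX RX; apply: nsub_exists; apply: contra RX => XR.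
  by apply/eqP/esym/eqv_dim => //; rewrite dX.
have cover p q : p \in P -> q \in Q -> p \notin R -> q \notin R ->
    q \in R + <[p]> /\ p \in R + <[q]>.
  move=> pP qQ pR qR.
  have p0 : p != 0%R by apply: contraNneq pR => ->; exact: mem0v.
  have q0 : q != 0%R by apply: contraNneq qR => ->; exact: mem0v.
  have /nz_exists[u /memv_capP[/memv_addP[_ /vlineP[a ->] [_ /vlineP[b ->] uE]] uR] u0]
    := meetR p q pP qQ p0 q0.
  have a0 : a != 0%R.
    apply: contraNneq qR => a0; move: uR u0; rewrite uE a0 scale0r add0r.
    by rewrite rpredZeq scaler_eq0 negb_or => uR /andP[b0 _]; move: uR; rewrite (negbTE b0).
  have b0 : b != 0%R.
    apply: contraNneq pR => b0; move: uR u0; rewrite uE b0 scale0r addr0.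
    by rewrite rpredZeq scaler_eq0 negb_or => uR /andP[a0' _]; move: uR; rewrite (negbTE a0').
  split.
    rewrite (_ : q = (b^-1 *: u + (- (b^-1 * a)) *: p)%R).
      by apply: memv_add; rewrite rpredZ ?memv_line.
    by rewrite uE scalerDr !scalerA mulVf // scale1r scaleNr addrC addrA addNr add0r.
  rewrite (_ : p = (a^-1 *: u + (- (a^-1 * b)) *: q)%R).
    by apply: memv_add; rewrite rpredZ ?memv_line.
  by rewrite uE scalerDr !scalerA mulVf // scale1r scaleNr addrK.
have [p pP pR] := nsub P dP RP; have [q qQ qR] := nsub Q dQ RQ.
have Rp : (R <= R + <[p]>)%VS by exact: addvSl.
have QRp : (Q <= R + <[p]>)%VS.
  apply/subvP => q' q'Q; have [q'R|q'R] := boolP (q' \in R); first exact: (subvP Rp).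
  by case: (cover p q').
have PRp : (P <= R + <[p]>)%VS.
  apply/subvP => p' p'P; have [p'R|p'R] := boolP (p' \in R); first exact: (subvP Rp).
  have [_] := cover p' q p'P qQ p'R qR; apply: subvP.
  by rewrite subv_add Rp -memvE (subvP QRp).
have dRp : \dim (R + <[p]>) = n.+1 by rewrite dim_add_line // dR.
have PQRp : (P + Q <= R + <[p]>)%VS by rewrite subv_add PRp QRp.
have dPQ1 : (n.+1 <= \dim (P + Q))%N.
  rewrite ltnNge; apply: contra PQ => le; apply/eqP.
  have PE : P = P + Q.
    by apply: eqv_dim; [exact: addvSl|apply/eqP; rewrite eqn_leq dimvS ?addvSl // dP].
  by apply/esym/eqv_dim; [rewrite PE addvSr|rewrite dP].
have PQE : P + Q = R + <[p]>.
  apply: eqv_dim => //; apply/eqP; rewrite eqn_leq dRp dPQ1 andbT.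
  by rewrite -dRp dimvS.
split=> //; last by rewrite PQE.
apply: adjI => //; have := dimv_sum_cap P Q; rewrite PQE dRp dP dQ; clear; lia.
Qed.

Definition mutual P Q R :=
  [/\ \dim P = n, \dim Q = n & \dim R = n] /\ [/\ adj P Q, adj P R & adj Q R].

(* A triple of mutually adjacent subspaces is a star (a common [m]-dimensional
   intersection) or a top (a common [n.+1]-dimensional sum), or both (a pencil). *)
Definition st P Q R := (P :&: Q <= R)%VS.
Definition tp P Q R := (R <= P + Q)%VS.

Definition pure P Q R := mutual P Q R /\ ~~ (st P Q R && tp P Q R).

(** Either [P :&: R] is contained in [Q], hence equal to [P :&: Q], or [R] is spanned by [Q :&: R]
    and one vector of [P]. *)
Lemma st_tp P Q R : mutual P Q R -> st P Q R || tp P Q R.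
Proof.
move=> [[dP dQ dR] [aPQ aPR aQR]]; rewrite orbC -implyNb.
apply/implyP => nt; apply: contraNT nt => ns.
have dRP := adj_dim aPR; have dRQ := adj_dim aQR.
have nsub : ~~ (P :&: R <= Q :&: R)%VS.
  apply: contra ns => PRQ; rewrite /st.
  have PRPQ : (P :&: R <= P :&: Q)%VS.
    by rewrite subv_cap capvSl (subv_trans PRQ) ?capvSl.
  by rewrite -(eqv_dim PRPQ) ?capvSr // dRP adj_dim.
have [v vPR vQR] := nsub_exists nsub.
have RE : (Q :&: R) + <[v]> = R.
  apply: eqv_dim; last by rewrite dim_add_line // dRQ dR.
  by rewrite subv_add capvSr -memvE; case/memv_capP: vPR.
rewrite /tp -RE subv_add -memvE; apply/andP; split.
  exact: subv_trans (capvSl _ _) (addvSr _ _).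
by case/memv_capP: vPR => vP _; apply: (subvP (addvSl _ _)).
Qed.

Lemma pure_tp P Q R : pure P Q R -> tp P Q R = ~~ st P Q R.
Proof.
move=> [mu]; have := st_tp mu.
by case: (st P Q R); case: (tp P Q R).
Qed.

Lemma st_cap P Q R : mutual P Q R -> st P Q R -> P :&: Q = P :&: R.
Proof.
move=> [[dP dQ dR] [aPQ aPR aQR]] s; apply: eqv_dim.
  by rewrite subv_cap capvSl.
by rewrite !adj_dim.
Qed.

Lemma tp_add P Q R : mutual P Q R -> tp P Q R -> P + Q = P + R.
Proof.
move=> [[dP dQ dR] [aPQ aPR aQR]] s; apply/esym/eqv_dim.
  by rewrite subv_add addvSl.
by rewrite !adj_dim_add.
Qed.

Lemma mutual_swap P Q R : mutual P Q R -> mutual P R Q.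
Proof. by move=> [[dP dQ dR] [aPQ aPR aQR]]; split; split; rewrite // adjC. Qed.

Lemma mutual_rot P Q R : mutual P Q R -> mutual Q P R.
Proof. by move=> [[dP dQ dR] [aPQ aPR aQR]]; split; split; rewrite // adjC. Qed.

Lemma st_swap P Q R : mutual P Q R -> st P Q R = st P R Q.
Proof.
move=> mu; apply/idP/idP => s; rewrite /st.
  by rewrite -(st_cap mu s) capvSr.
by rewrite -(st_cap (mutual_swap mu) s) capvSr.
Qed.

Lemma tp_swap P Q R : mutual P Q R -> tp P Q R = tp P R Q.
Proof.
move=> mu; apply/idP/idP => s; rewrite /tp.
  by rewrite -(tp_add mu s) addvSr.
by rewrite -(tp_add (mutual_swap mu) s) addvSr.
Qed.

Lemma st_rot P Q R : st P Q R = st Q P R.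
Proof. by rewrite /st capvC. Qed.

Lemma tp_rot P Q R : tp P Q R = tp Q P R.
Proof. by rewrite /tp addvC. Qed.

Lemma pure_swap P Q R : pure P Q R -> pure P R Q.
Proof.
move=> [mu nst]; split; first exact: mutual_swap.
by rewrite -st_swap // -tp_swap.
Qed.

Lemma pure_rot P Q R : pure P Q R -> pure Q P R.
Proof. by move=> [mu nst]; split; [exact: mutual_rot|rewrite st_rot tp_rot]. Qed.

(** Two stars on the edge share [P :&: Q] and two tops share [P + Q]; the third vertices of a star
    and a top meet in a proper subspace of [P :&: Q]. Equality of types is thus read from adjacency,
    which [phi] will preserve. *)
Lemma st_same P Q R R1 : pure P Q R -> pure P Q R1 ->
  (st P Q R == st P Q R1) = (R == R1) || adj R R1.
Proof.
move=> pu pu1.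
have [[[dP dQ dR] [aPQ aPR aQR]] _] := pu.
have [[[_ _ dR1] [_ aPR1 aQR1]] _] := pu1.
have mixed X Y : \dim X = n -> \dim Y = n -> st P Q X -> ~~ tp P Q X -> tp P Q Y -> ~~ st P Q Y ->
    (X == Y) || adj X Y = false.
  move=> dX dY sX ntX tY nsY; apply/negbTE; rewrite negb_or; apply/andP; split.
    by apply: contraNneq nsY => <-.
  rewrite /adj negb_and; apply/orP; right; rewrite neq_ltn; apply/orP; left.
  have XB : X :&: (P + Q) = P :&: Q.
    apply/esym/eqv_dim.
      by rewrite subv_cap [X in X && _]sX (subv_trans (capvSl _ _) (addvSl _ _)).
    rewrite adj_dim //; apply/eqP; rewrite eqn_leq; apply/andP; split.
      rewrite -(adj_dim aPQ) dimvS // subv_cap [X in X && _]sX.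
      by rewrite (subv_trans (capvSl _ _) (addvSl _ _)).
    rewrite -ltnS -dX ltn_neqAle dimvS ?capvSl // andbT.
    apply: contra ntX => /eqP dXB; rewrite /tp -(eqv_dim (capvSl _ _) dXB); exact: capvSr.
  have le : (X :&: Y <= (P :&: Q) :&: Y)%VS.
    by rewrite -XB subv_cap capvSr subv_cap capvSl (subv_trans (capvSr _ _)).
  apply: leq_ltn_trans (dimvS le) _.
  rewrite -(adj_dim aPQ) ltn_neqAle dimvS ?capvSl // andbT.
  apply: contra nsY => /eqP dd; rewrite /st -(eqv_dim (capvSl _ _) dd); exact: capvSr.
have tE := pure_tp pu; have tE1 := pure_tp pu1.
case sR : (st P Q R) tE; case sR1 : (st P Q R1) tE1 => /= tE1 tE.
- rewrite eqxx; apply/esym; case: eqVneq => //= RR1; apply: adjI => //.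
  by rewrite -(adj_dim aPQ) dimvS // subv_cap; apply/andP.
- by apply/esym; apply: mixed; rewrite ?sR ?sR1 ?tE ?tE1.
- apply/esym; rewrite eq_sym adjC.
  by apply: mixed; rewrite ?sR ?sR1 ?tE ?tE1.
- rewrite eqxx; apply/esym; case: eqVneq => //= RR1; apply: adjI => //.
  have : (\dim (R + R1) <= n.+1)%N.
    by rewrite -(adj_dim_add dP dQ aPQ) dimvS // subv_add; apply/andP.
  have := dimv_sum_cap R R1; rewrite dR dR1; clear; lia.
Qed.

(** [P + Q] is proper, since [n.+1 < n + n]; a vector outside it, added to [P :&: Q], gives a star
    that is not a top. *)
Lemma exists_pure P Q : \dim P = n -> \dim Q = n -> adj P Q ->
  exists2 R, pure P Q R & st P Q R.
Proof.
move=> dP dQ aPQ.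
have /nsub_exists[v _ vB] : ~~ ({:V} <= P + Q)%VS.
  apply/negP => /dimvS; rewrite adj_dim_add //; lia.
have vP : v \notin P by apply: contra vB; apply: (subvP (addvSl _ _)).
have vQ : v \notin Q by apply: contra vB; apply: (subvP (addvSr _ _)).
have vA : v \notin P :&: Q by apply: contra vP; apply: (subvP (capvSl _ _)).
pose R := (P :&: Q) + <[v]>.
have dR : \dim R = n by rewrite dim_add_line // adj_dim.
have vR : v \in R by apply: (subvP (addvSr _ _)); exact: memv_line.
have AR : (P :&: Q <= R)%VS by exact: addvSl.
have neq X : v \notin X -> X != R by apply: contraNneq => ->.
exists R => //; split.
  split; split=> //; apply: adjI => //; try exact: neq.
    by rewrite -(adj_dim aPQ) dimvS // subv_cap capvSl.
  by rewrite -(adj_dim aPQ) dimvS // subv_cap capvSr.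
rewrite negb_and; apply/orP; right; apply: contra vB => tR.
exact: (subvP tR).
Qed.

(** * Bijections that preserve the meeting relation *)

Section Preserving.
Variable phi : {vspace V} -> {vspace V}.
Hypothesis phi_dim : forall W, \dim W = n -> \dim (phi W) = n.
Hypothesis phi_inj : forall W X, \dim W = n -> \dim X = n -> phi W = phi X -> W = X.
Hypothesis phi_surj : forall W, \dim W = n -> exists2 X, \dim X = n & phi X = W.
Hypothesis phi_meet : forall W X, \dim W = n -> \dim X = n ->
  (W :&: X != 0)%VS = (phi W :&: phi X != 0)%VS.

Lemma phi_neq W X : \dim W = n -> \dim X = n -> (phi W != phi X) = (W != X).
Proof.
move=> dW dX; apply/idP/idP; first by apply: contraNneq => ->.
by apply: contraNneq => /phi_inj ->.
Qed.

Lemma phi_pcl P Q R : \dim P = n -> \dim Q = n -> \dim R = n ->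
  pcl P Q R <-> pcl (phi P) (phi Q) (phi R).
Proof.
move=> dP dQ dR; split=> pc S dS.
  have [T dT <-] := phi_surj dS.
  by rewrite -(phi_meet dT dP) -(phi_meet dT dQ) -(phi_meet dT dR); exact: pc.
rewrite (phi_meet dS dP) (phi_meet dS dQ) (phi_meet dS dR); apply: pc.
exact: phi_dim.
Qed.

Lemma exists_pencil P Q : \dim P = n -> \dim Q = n -> adj P Q ->
  exists R, [/\ \dim R = n, R != P, R != Q & pcl P Q R].
Proof.
move=> dP dQ aPQ.
have nsub X Y : \dim X = n -> adj X Y -> exists2 v, v \in X & v \notin Y.
  move=> dX aXY; apply: nsub_exists; apply/negP => /capv_idPl XY.
  by move: (adj_dim aXY); rewrite XY dX; lia.
have [p pP pQ] := nsub P Q dP aPQ.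
have [q qQ qP] := nsub Q P dQ (etrans (adjC _ _) aPQ).
have pqP : (p + q)%R \notin P.
  by apply: contra qP => pq; rewrite (_ : q = ((p + q) - p)%R) ?rpredB // addrC addKr.
have pqQ : (p + q)%R \notin Q.
  by apply: contra pQ => pq; rewrite (_ : p = ((p + q) - q)%R) ?rpredB // addrK.
pose R := (P :&: Q) + <[(p + q)%R]>.
have dR : \dim R = n.
  by rewrite dim_add_line ?adj_dim //; apply: contra pqP; apply: (subvP (capvSl _ _)).
have pqR : (p + q)%R \in R by apply: (subvP (addvSr _ _)); exact: memv_line.
exists R; split=> //; try by apply: contraNneq pqP => <-.
  by apply: contraNneq pqQ => <-.
apply: pencil_pcl => //; first exact: addvSl.
rewrite subv_add (subv_trans (capvSl _ _) (addvSl _ _)) -memvE.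
exact: memv_add.
Qed.

(** Adjacency amounts to the existence of a third subspace that satisfies [pcl]; for the converse
    direction surjectivity pulls this witness back. *)
Lemma phi_adj P Q : \dim P = n -> \dim Q = n -> adj P Q = adj (phi P) (phi Q).
Proof.
move=> dP dQ; apply/idP/idP => aPQ.
  have [R [dR RP RQ pc]] := exists_pencil dP dQ aPQ.
  have PQ : P != Q by case/andP: aPQ.
  move: PQ RP RQ; rewrite -(phi_neq dP dQ) -(phi_neq dR dP) -(phi_neq dR dQ).
  move=> PQ RP RQ.
  by case: (pcl_pencil (phi_dim dP) (phi_dim dQ) (phi_dim dR) PQ RP RQ
    ((phi_pcl dP dQ dR).1 pc)).
have [R' [dR' RP RQ pc]] := exists_pencil (phi_dim dP) (phi_dim dQ) aPQ.
have [R dR RE] := phi_surj dR'; subst R'.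
have PQ : P != Q by rewrite -phi_neq //; case/andP: aPQ.
rewrite (phi_neq dR dP) in RP; rewrite (phi_neq dR dQ) in RQ.
by case: (pcl_pencil dP dQ dR PQ RP RQ ((phi_pcl dP dQ dR).2 pc)).
Qed.

Lemma phi_mutual P Q R : mutual P Q R -> mutual (phi P) (phi Q) (phi R).
Proof.
move=> [[dP dQ dR] [aPQ aPR aQR]].
by split; split; rewrite -?phi_adj ?phi_dim.
Qed.

Lemma phi_pencil P Q R : mutual P Q R ->
  st P Q R && tp P Q R = st (phi P) (phi Q) (phi R) && tp (phi P) (phi Q) (phi R).
Proof.
move=> mu; have [[dP' dQ' dR'] [aPQ' aPR' aQR']] := phi_mutual mu.
have [[dP dQ dR] [aPQ aPR aQR]] := mu.
have neq X Y : adj X Y -> X != Y by case/andP.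
have neq' X Y : adj X Y -> Y != X by rewrite eq_sym; exact: neq.
apply/andP/andP => -[s t].
  have pc := (phi_pcl dP dQ dR).1 (pencil_pcl dP dQ dR aPQ s t).
  by case: (pcl_pencil dP' dQ' dR' (neq _ _ aPQ') (neq' _ _ aPR') (neq' _ _ aQR') pc).
have pc := (phi_pcl dP dQ dR).2 (pencil_pcl dP' dQ' dR' aPQ' s t).
by case: (pcl_pencil dP dQ dR (neq _ _ aPQ) (neq' _ _ aPR) (neq' _ _ aQR) pc).
Qed.

Lemma phi_pure P Q R : pure P Q R -> pure (phi P) (phi Q) (phi R).
Proof. by move=> [mu np]; split; [exact: phi_mutual|rewrite -phi_pencil]. Qed.

(** On pure triples, [tau] says that [phi] keeps the type instead of exchanging stars and tops. The
    lemmas that follow show it constant there, by moving one vertex at a time. *)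
Let tau P Q R := st P Q R == st (phi P) (phi Q) (phi R).

Lemma tau_pair P Q R R1 : pure P Q R -> pure P Q R1 -> tau P Q R = tau P Q R1.
Proof.
move=> pu pu1; have := st_same pu pu1; have := st_same (phi_pure pu) (phi_pure pu1).
have [[[dP dQ dR] _] _] := pu; have [[[_ _ dR1] _] _] := pu1.
rewrite -phi_adj // -[phi R == _]negbK phi_neq // negbK => <-.
rewrite /tau; by do 4!case: (st _ _ _).
Qed.

Lemma tau_swap P Q R : pure P Q R -> tau P Q R = tau P R Q.
Proof. by move=> [mu _]; rewrite /tau st_swap // (st_swap (phi_mutual mu)). Qed.

Lemma tau_rot P Q R : tau P Q R = tau Q P R.
Proof. by rewrite /tau st_rot (st_rot (phi P)). Qed.

(** A pure [P], [Q], [R] is a triple on both edges. If it is a pencil, some [T] through [P :&: Q]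
    and outside [P + Q] completes both edges to pure triples, which are compared on the edge [P],
    [T]. *)
Lemma tau_adj P Q R S S' : adj Q R -> pure P Q S -> pure P R S' ->
  tau P Q S = tau P R S'.
Proof.
move=> aQR pu pu'.
have [[[dP dQ dS] [aPQ aPS aQS]] _] := pu.
have [[[_ dR dS'] [_ _ _]] _] := pu'.
have [[_ [aPR _ _]] _] := pu'.
have mu : mutual P Q R by split.
have [/andP[s t]|np] := boolP (st P Q R && tp P Q R); last first.
  have puR : pure P Q R by split.
  by rewrite (tau_pair pu puR) tau_swap // (tau_pair (pure_swap puR) pu').
have [T puT sT] := exists_pure dP dQ aPQ.
have [[[_ _ dT] [_ aPT aQT]] nT] := puT.
have PQR := st_cap mu s; have PQR' := tp_add mu t.
have nTP : ~~ tp P R T.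
  by rewrite /tp -PQR'; have := pure_tp puT; rewrite /tp sT => ->.
have sTR : st P R T by rewrite /st -PQR.
have aRT : adj R T.
  apply: adjI => //.
    by rewrite -(adj_dim aPQ) dimvS // subv_cap [X in X && _]s.
  by apply: contraNneq nTP => <-; rewrite /tp addvSr.
have puT' : pure P R T.
  by split; [split; split|rewrite (negbTE nTP) andbF].
rewrite (tau_pair pu puT) (tau_pair pu' puT') tau_swap // (tau_swap puT').
exact: tau_pair (pure_swap puT) (pure_swap puT').
Qed.

(** When [Q] and [R] are not adjacent, [T], spanned by [P :&: Q] and a vector of [R] outside [P], is
    a neighbour of [P], [Q] and [R]. *)
Lemma tau_vertex P Q R S S' : pure P Q S -> pure P R S' -> tau P Q S = tau P R S'.
Proof.
move=> pu pu'.
have [[[dP dQ dS] [aPQ aPS aQS]] _] := pu.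
have [[[_ dR dS'] [aPR _ _]] _] := pu'.
have [QR|QR] := eqVneq Q R; first by subst R; exact: tau_pair.
have [aQR|naQR] := boolP (adj Q R); first exact: tau_adj aQR pu pu'.
have /nsub_exists[r rR rP] : ~~ (R <= P)%VS.
  apply/negP => /capv_idPr RP; move: (adj_dim aPR); rewrite RP dR; lia.
pose A := P :&: Q; pose T := A + <[r]>.
have dA : \dim A = m by exact: adj_dim.
have rA : r \notin A by apply: contra rP; apply: (subvP (capvSl _ _)).
have dT : \dim T = n by rewrite dim_add_line // dA.
have rT : r \in T by apply: (subvP (addvSr _ _)); exact: memv_line.
have AT : (A <= T)%VS by exact: addvSl.
have dRT : (m <= \dim (R :&: T))%N.
  have dAR : (m.-1 <= \dim (A :&: R))%N.
    have := dimv_sum_cap A (P :&: R); rewrite dA (adj_dim aPR) => dd.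
    have : (\dim (A + (P :&: R)) <= n)%N by rewrite -dP dimvS // subv_add !capvSl.
    have : (\dim (A :&: (P :&: R)) <= \dim (A :&: R))%N.
      by rewrite dimvS // capvS // capvSr.
    move: dd; clear; lia.
  have rAR : r \notin A :&: R by apply: contra rA; apply: (subvP (capvSl _ _)).
  apply: leq_trans (_ : (\dim ((A :&: R) + <[r]>) <= _)%N).
    by rewrite dim_add_line //; move: dAR; clear; lia.
  rewrite dimvS // subv_cap !subv_add capvSr -!memvE rR rT !andbT.
  exact: subv_trans (capvSl _ _) AT.
have aPT : adj P T.
  apply: adjI => //; last by apply: contraNneq rP => ->.
  by rewrite -dA dimvS // subv_cap capvSl.
have TQ : Q != T.
  apply: contraNneq naQR => QT; apply: adjI => //; by rewrite QT capvC.
have aQT : adj Q T by apply: adjI => //; rewrite -dA dimvS // subv_cap capvSr.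
have TR : T != R.
  apply: contraNneq naQR => TE; apply: adjI => //.
  by rewrite -dA dimvS // subv_cap capvSr -TE.
have aTR : adj T R by apply: adjI => //; rewrite capvC.
have [T' puT _] := exists_pure dP dT aPT.
by rewrite (tau_adj aQT pu puT) (tau_adj aTR puT pu').
Qed.

(** Connectedness of the graph: [P] is replaced by an adjacent [P1] that contains [P :&: P'] and one
    more vector of [P']. *)
Lemma tau_const k P P' Q Q' S S' : (n <= \dim (P :&: P') + k)%N ->
  pure P Q S -> pure P' Q' S' -> tau P Q S = tau P' Q' S'.
Proof.
elim: k P Q S => [|k IH] P Q S dPP pu pu'.
  have [[[dP dQ dS] _] _] := pu; have [[[dP' _ _] _] _] := pu'.
  have E : P = P'.
    have PE : P :&: P' = P.
      apply: eqv_dim; first exact: capvSl.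
      by apply/eqP; rewrite eqn_leq dimvS ?capvSl //= dP; lia.
    by apply: eqv_dim; [rewrite -PE capvSr|rewrite dP].
  by subst P'; exact: tau_vertex.
have [[[dP dQ dS] _] _] := pu; have [[[dP' _ _] _] _] := pu'.
have [PP|PP] := eqVneq P P'; first by subst P'; exact: tau_vertex.
have /nsub_exists[p' p'P' p'P] : ~~ (P' <= P)%VS.
  by apply: contra PP => P'P; apply/eqP/esym/eqv_dim => //; rewrite dP.
have dPP' : (\dim (P :&: P') <= m)%N.
  rewrite -ltnS -dP ltn_neqAle dimvS ?capvSl // andbT.
  apply: contra PP => /eqP dd; have E := eqv_dim (capvSl _ _) dd.
  by apply/eqP/eqv_dim; [rewrite -E capvSr|rewrite dP].
have [|A [PPA AP dA]] := exists_between (capvSl P P') dPP'.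
  by rewrite dP.
have p'A : p' \notin A by apply: contra p'P; apply: (subvP AP).
pose P1 := A + <[p']>.
have dP1 : \dim P1 = n by rewrite dim_add_line // dA.
have p'P1 : p' \in P1 by apply: (subvP (addvSr _ _)); exact: memv_line.
have aPP1 : adj P P1.
  apply: adjI => //; last by apply: contraNneq p'P => ->.
  by rewrite -dA dimvS // subv_cap AP addvSl.
have [T puT _] := exists_pure dP dP1 aPP1.
rewrite (tau_vertex pu puT) tau_rot.
apply: IH (pure_rot puT) pu'.
have le : (((P :&: P') + <[p']>) <= P1 :&: P')%VS.
  rewrite subv_cap !subv_add capvSr -!memvE p'P1 p'P' !andbT.
  exact: subv_trans PPA (addvSl _ _).
have := dimvS le; rewrite dim_add_line; first by move: dPP; clear; lia.
by apply: contra p'P; apply: (subvP (capvSl _ _)).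
Qed.

Lemma phi_type_uniform :
  (forall P Q R, mutual P Q R -> st P Q R = st (phi P) (phi Q) (phi R)) \/
  (forall P Q R, mutual P Q R -> st P Q R = tp (phi P) (phi Q) (phi R)).
Proof.
(* A pencil goes to a pencil, where both descriptions hold, so it is compatible with either
   alternative. *)
have dich P Q R : mutual P Q R -> ~ pure P Q R ->
    st P Q R = st (phi P) (phi Q) (phi R) /\
    st P Q R = tp (phi P) (phi Q) (phi R).
  move=> mu np; have pe := phi_pencil mu.
  have pq : st P Q R && tp P Q R by apply/negPn/negP => npq; apply: np; split.
  move: (pq) pe => /andP[-> ->] /esym/andP[-> ->]; split=> //.
have [[P [Q [R [pu tt]]]]|none] :=
  pselect (exists P Q R, pure P Q R /\ tau P Q R).
- left=> P' Q' R' mu; have [pu'|npu] := pselect (pure P' Q' R'); last first.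
    by case: (dich _ _ _ mu npu).
  apply/eqP; rewrite -/(tau P' Q' R') -(@tau_const n P P' Q Q' R R') //.
  exact: leq_addl.
- right=> P' Q' R' mu; have [pu'|npu] := pselect (pure P' Q' R'); last first.
    by case: (dich _ _ _ mu npu).
  have : ~~ tau P' Q' R' by apply/negP => t; apply: none; exists P', Q', R'.
  rewrite /tau (pure_tp (phi_pure pu')).
  by case: (st _ _ _); case: (st _ _ _).
Qed.

End Preserving.

End GrassmannGraph.

(** * Minimal angles in finite dimension *)

Section FiniteDimension.
Variables (R : realType) (V : vectType R[i]) (dot : {dot V for Num.conj}).
Implicit Types (P Q S W X Y : {vspace V}).

Local Notation "''[' u , v ]" := (dot u%R v%R) : ring_scope.
Local Notation onf := (onf dot).
Local Notation nrm := (nrm dot).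
Local Notation gr := (gr dot).
Local Notation is_cos := (is_cos dot).
Local Notation perp := (orthov dot).

Definition gs W : set V := [set x | x \in W].

Lemma gs_span n (f : 'I_n -> V) : gs <<codom f>> = lin_span f.
Proof.
apply/seteqP; split=> [x /= xf|x [c _ <-]].
  rewrite (coord_span (X := codom_tuple f) xf).
  apply: span_sum => i; apply: spanZ.
  have /codomP[j ->] : (codom_tuple f)`_i \in codom f.
    by rewrite mem_nth ?size_tuple.
  exact: span_self.
by apply: memv_suml => i _; apply: rpredZ; apply: memv_span; exact: codom_f.
Qed.

Lemma gs_inj W X : gs W = gs X -> W = X.
Proof.
by move=> WX; apply/vspaceP => x; have := congr1 (fun A : set V => A x) WX;
  rewrite /gs /= => E; apply/idP/idP; rewrite E.
Qed.

Lemma gs_gr W n : \dim W = n -> gr n (gs W).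
Proof.
move=> <-; have [|f [of_ fE]] := @gram_schmidt _ _ dot _ (fun i : 'I_(\dim W) => (vbasis W)`_i).
  move=> c c0 i; have /freeP := basis_free (vbasisP W); apply; exact: c0.
exists f => //; rewrite fE; apply/seteqP; split=> [x /= xW|x [c _ <-]].
  by exists (fun i => coord (vbasis W) i x) => //; rewrite -coord_vbasis.
apply: memv_suml => i _; apply: rpredZ; apply: vbasis_mem.
by rewrite mem_nth ?size_tuple.
Qed.

Lemma gr_uniq n k (A : set V) : gr n A -> gr k A -> n = k.
Proof.
move=> [f of_ fE] [g og gE]; apply/eqP; rewrite eqn_leq.
rewrite (onf_leq (onf_indep of_) og) -?fE -?gE //=.
by rewrite (onf_leq (onf_indep og) of_) -?fE -?gE.
Qed.

Lemma gr_gs (A : set V) n : gr n A -> exists2 W, \dim W = n & gs W = A.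
Proof.
move=> gA; have [f of_ fE] := gA; exists <<codom f>>%VS.
  by apply: gr_uniq (gs_gr erefl) _; rewrite gs_span -fE.
by rewrite gs_span.
Qed.

Lemma mem_perp W x : reflect (forall y, y \in W -> '[x, y] = 0) (x \in perp W).
Proof. exact: mem_orthovP. Qed.

Lemma perp_dot W x y : x \in perp W -> y \in W -> '[x, y] = 0.
Proof. by move/mem_perp; apply. Qed.

Lemma cap_perp W : (W :&: perp W = 0)%VS.
Proof.
apply/eqP; rewrite -subv0; apply/subvP => x /memv_capP[xW /perp_dot xp].
by rewrite memv0; apply/eqP/(@dotxx_eq0 _ _ dot); exact: xp.
Qed.

Lemma proj_perp W : exists f : 'I_(\dim W) -> V,
  [/\ onf f, gs W = lin_span f, forall x, projf dot f x \in W &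
      forall x, x - projf dot f x \in perp W].
Proof.
have [f of_ fE] := gs_gr (erefl (\dim W)).
exists f; split=> // x; first by have := projf_span dot f x; rewrite -fE.
apply/mem_perp => y yW; apply: dot_projf_span of_ _.
by rewrite -fE.
Qed.

Lemma add_perp W : (W + perp W = fullv)%VS.
Proof.
apply/eqP; rewrite eqEsubv subvf; apply/subvP => x _.
have [f [_ _ fW fp]] := proj_perp W.
by rewrite -(subrK (projf dot f x) x) addrC memv_add.
Qed.

Lemma dim_perp W : (\dim W + \dim (perp W) = \dim {:V})%N.
Proof. by rewrite -(add_perp W) dimv_disjoint_sum ?cap_perp. Qed.

Lemma perpK W : perp (perp W) = W.
Proof.
apply/esym/eqv_dim; last first.
  by apply: (@addnI (\dim (perp W))); rewrite dim_perp addnC dim_perp.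
apply/subvP => x xW; apply/mem_perp => y yp; apply: dot_eq0C.
exact: perp_dot yp xW.
Qed.

Lemma perpS W X : (W <= X)%VS = (perp X <= perp W)%VS.
Proof.
have half Y Z : (Y <= Z)%VS -> (perp Z <= perp Y)%VS.
  move=> YZ; apply/subvP => x /mem_perp xZ; apply/mem_perp => y yY.
  by apply: xZ; exact: (subvP YZ).
by apply/idP/idP => [/half //|/half]; rewrite !perpK.
Qed.

Lemma perp_add W X : perp (W + X) = (perp W :&: perp X)%VS.
Proof.
apply/eqP; rewrite eqEsubv subv_cap -!perpS addvSl addvSr /=.
apply/subvP => x /memv_capP[xW xX]; apply/mem_perp => _ /memv_addP[w wW [z zX ->]].
by rewrite dotDr (perp_dot xW wW) (perp_dot xX zX) addr0.
Qed.

Lemma is_cos_nrm n k (A B : set V) c x y : gr n A -> gr k B -> is_cos A B c ->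
  A x -> B y -> `|'[x, y]| <= c * (nrm x * nrm y).
Proof.
move=> gA gB [_ hc] Ax By.
have [->|x0] := eqVneq x 0; first by rewrite dot0l normr0 /nrm dot0l sqrtC0 mul0r mulr0.
have [->|y0] := eqVneq y 0; first by rewrite dot0r normr0 /nrm dot0r sqrtC0 !mulr0.
have nz z : z != 0 -> 0 < nrm z.
  by move=> z0; rewrite sqrtC_gt0 dnorm_gt0.
have nrmV z : z != 0 -> '[(nrm z)^-1 *: z, (nrm z)^-1 *: z] = 1.
  move=> z0; rewrite dotZl dotZr mulrA geC0_conj ?invr_ge0 ?nrm_ge0 //.
  by rewrite -nrm_sqr expr2 mulrACA !mulVf ?mulr1 // gt_eqF ?nz.
have := hc _ _ (grZ (nrm x)^-1 gA Ax) (grZ (nrm y)^-1 gB By) (nrmV x x0) (nrmV y y0).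
rewrite dotZl dotZr !normrM norm_conjC !normfV !(gtr0_norm (nz _ _)) //.
by rewrite mulrA -invfM mulrC ler_pdivrMr // mulr_gt0 ?nz.
Qed.

Lemma cosv_exists W X : (0 < \dim W)%N -> (0 < \dim X)%N ->
  exists c, is_cos (gs W) (gs X) c.
Proof.
move=> W0 X0; have [f of_ ->] := gs_gr (erefl (\dim W)).
have [g og ->] := gs_gr (erefl (\dim X)).
exact: is_cos_exists.
Qed.

(** The coordinates of an optimal [x] in [f] define a unit vector [x'] in the span of [g]; each of
    the [n] terms of [x - x'] costs at most [d]. *)
Lemma cos_close n (f g : 'I_n -> V) (B : set V) c c' d : onf f -> onf g ->
  is_cos (lin_span f) B c -> is_cos (lin_span g) B c' ->
  (forall i, nrm (f i - g i) <= d) -> c <= c' + n%:R * d.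
Proof.
move=> of_ og [[x [y [fx By x1 y1 <-]]] _] [_ hc'] fg.
pose x' := \sum_i '[x, f i] *: g i.
have gx' : lin_span g x' by exists (fun i => '[x, f i]).
have x'1 : '[x', x'] = 1.
  rewrite (parseval og gx') -x1 (parseval of_ fx); apply: eq_bigr => i _.
  by rewrite dot_comb.
have -> : '[x, y] = '[x', y] + '[x - x', y] by rewrite dotBl addrC subrK.
apply: le_trans (ler_normD _ _) _; apply: lerD; first exact: hc'.
have -> : x - x' = \sum_i '[x, f i] *: (f i - g i).
  rewrite -{1}(projf_id of_ fx) /x' -sumrB; apply: eq_bigr => i _.
  by rewrite scalerBr.
rewrite dot_suml; apply: le_trans (ler_norm_sum _ _ _) _.
apply: le_trans (_ : \sum_(i < n) d <= _); last first.
  by rewrite sumr_const card_ord mulr_natl.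
apply: ler_sum => i _; rewrite dotZl normrM.
have le1 : `|'[x, f i]| <= 1.
  by apply: le_trans (dot_le_nrm _ _ _) _; rewrite !nrm1 ?mulr1 // of_ eqxx.
have led : `|'[f i - g i, y]| <= d.
  apply: le_trans (dot_le_nrm _ _ _) _; rewrite (nrm1 y1) mulr1; exact: fg.
by rewrite -[leRHS]mul1r ler_pM.
Qed.

Lemma frame_limit F n (f : nat -> 'I_n -> V) : UltraFilter F ->
  (forall k, onf (f k)) -> exists2 L, onf L & forall i, ulim dot F (fun k => f k i) (L i).
Proof.
move=> uF of_.
have [b ob bE] := gs_gr (erefl (\dim {:V})).
have f1 i k : nrm (f k i) <= 1 by rewrite nrm1 // of_ eqxx.
have lim i : exists w, ulim dot F (fun k => f k i) w.
  have [||w _ hw] := @ulim_span _ _ dot F uF _ b (fun k => f k i) 1 ob => //.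
    by move=> k; rewrite -bE; exact: memvf.
  by exists w.
have [L hL] := choice lim; exists L => // i j.
by apply: (ulim_dot_const uF (hL i) (hL j) (f1 j)) => k; exact: of_.
Qed.

Lemma exists_perp_unit W : (\dim W < \dim {:V})%N ->
  exists2 u, u != 0 & u \in perp W.
Proof.
move=> dW; have : (perp W != 0)%VS.
  by rewrite -dimv_eq0; have := dim_perp W; lia.
by case/nz_exists => u up u0; exists u.
Qed.

(** * Orthogonal complements in dimension [2n] *)

Section Perp.
Variable n : nat.
Hypothesis dimV : \dim {:V} = (n + n)%N.

Lemma dim_perp_half W : \dim W = n -> \dim (perp W) = n.
Proof. by move=> dW; have := dim_perp W; rewrite dW dimV => /addnI. Qed.

(** For [c < 1], removing from [y] in [Q] its projection to [P] is injective, hence onto [perp P] by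
    dimension. Write the optimal [u] as the image of [y]. The projection of [y] to [P] has squared
    norm at most [c ^+ 2 * '[y, y]], so [(1 - c ^+ 2) * '[y, y] <= 1]. As ['[u, y] = 1],
    Cauchy-Schwarz shows that the projection of [u] to [Q] has squared norm at least [1 - c ^+ 2],
    which leaves at most [c ^+ 2] for the product with [v]. *)
Lemma cos_perp_le P Q c c1 : \dim P = n -> \dim Q = n ->
  is_cos (gs P) (gs Q) c -> is_cos (gs (perp P)) (gs (perp Q)) c1 -> c1 <= c.
Proof.
move=> dP dQ hc hc1; have c0 := is_cos_ge0 hc; have c10 := is_cos_ge0 hc1.
have [c1E|cn1] := eqVneq c 1; first by rewrite c1E; exact: is_cos_le1 hc1.
have clt : c ^+ 2 < 1.
  by rewrite expr_lt1 // lt_def eq_sym cn1 (is_cos_le1 hc).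
have [[u [v [uP vQ u1 v1 uv]]] _] := hc1.
have [f [of_ fE fP fp]] := proj_perp P; have [g [og gE gQ gp]] := proj_perp Q.
have PQle y : y \in Q -> '[projf dot f y, projf dot f y] <= c ^+ 2 * '[y, y].
  move=> yQ; set z := projf dot f y.
  have zy : '[z, z] = '[z, y] by rewrite dot_projf_idem.
  have := is_cos_nrm (gs_gr dP) (gs_gr dQ) hc (fP y : gs P z) (yQ : gs Q y).
  rewrite -zy ger0_norm ?dnorm_ge0 // -nrm_sqr expr2 mulrCA.
  have [->|z0] := eqVneq z 0.
    by move=> _; rewrite /nrm dot0l sqrtC0 mul0r mulr_ge0 ?exprn_ge0 ?dnorm_ge0.
  have nz : 0 < nrm z by rewrite sqrtC_gt0 dnorm_gt0.
  rewrite ler_pM2l // => le.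
  by rewrite -expr2 -[X in _ * X]nrm_sqr -exprMn ler_pXn2r ?nnegrE ?mulr_ge0 ?nrm_ge0.
have [y yQ uE] : exists2 y, y \in Q & u = y - projf dot f y.
  have [h oh hE] := gs_gr dQ.
  pose t i := h i - projf dot f (h i).
  have tE a : \sum_i a i *: t i = (\sum_i a i *: h i) - projf dot f (\sum_i a i *: h i).
    have -> : projf dot f (\sum_i a i *: h i) = \sum_i a i *: projf dot f (h i).
      elim/big_ind2 : _ => [|x1 x2 y1 y2 <- <-|i _]; last by rewrite projfZ.
        by rewrite -(scale0r 0) projfZ !scale0r.
      by rewrite projfD.
    by rewrite -sumrB; apply: eq_bigr => i _; rewrite scalerBr.
  have hQ a : (\sum_i a i *: h i) \in Q.
    have : lin_span h (\sum_i a i *: h i) by exists a.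
    by rewrite -hE.
  have it_ : lin_indep t.
    move=> a; rewrite tE => /eqP; rewrite subr_eq0 => /eqP hP.
    apply: (onf_indep oh); apply: (@dotxx_eq0 _ _ dot).
    have := PQle _ (hQ a); rewrite -hP -subr_ge0 -[X in _ - X]mul1r -mulrBl => le.
    apply/eqP; rewrite eq_le dnorm_ge0 andbT.
    by move: le; rewrite nmulr_rge0 // subr_lt0.
  have [s [os sE]] := gram_schmidt dot it_.
  have sub : lin_span s `<=` gs (perp P).
    move=> x; rewrite sE => -[a _ <-] /=; apply: memv_suml => i _.
    by apply: rpredZ; exact: fp.
  have spE : lin_span s = gs (perp P).
    apply: (gr_eq (n := n) (dot := dot)) sub; first by exists s.
    by apply: gs_gr; exact: dim_perp_half.
  have : lin_span t u by rewrite -sE spE.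
  by case=> a _ <-; exists (\sum_i a i *: h i); rewrite ?tE ?hQ.
have y0 : y != 0.
  apply/eqP => y0; move/eqP: u1; rewrite uE y0 -(scale0r 0) projfZ !scale0r subr0.
  by rewrite dot0l eq_sym oner_eq0.
have yy : 0 < '[y, y] by rewrite dnorm_gt0.
have uy : '[u, y] = 1.
  rewrite -u1 {3}uE dotBr (perp_dot uP (fP y)) subr0 //.
have Tle : (1 - c ^+ 2) * '[y, y] <= 1.
  have uuE : '[u, u] = '[y, y] - '[projf dot f y, projf dot f y].
    by rewrite [X in _ = X - _](dot_dprojf y of_) addrAC subrr add0r -uE.
  by rewrite mulrBl mul1r -u1 uuE lerB // PQle.
have Qle : 1 <= '[projf dot g u, projf dot g u] * '[y, y].
  have uyE : '[projf dot g u, y] = 1.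
    rewrite -uy -{2}(subrK (projf dot g u) u) dotDl (perp_dot (gp u) yQ) add0r //.
  have := cauchy_schwarz dot (projf dot g u) y.
  by rewrite uyE normr1 expr1n.
have Qle' : 1 - c ^+ 2 <= '[projf dot g u, projf dot g u].
  by rewrite -(ler_pM2r yy); apply: le_trans Tle Qle.
rewrite -(@ler_pXn2r _ 2) ?nnegrE // -uv.
have -> : '[u, v] = '[u - projf dot g u, v].
  by rewrite dotBl (dot_eq0C (perp_dot vQ (gQ u))) subr0.
apply: le_trans (cauchy_schwarz1 _ v1) _.
have -> : '[u - projf dot g u, u - projf dot g u] = 1 - '[projf dot g u, projf dot g u].
  by rewrite -u1 [X in _ = X - _](dot_dprojf u og) addrAC subrr add0r.
by rewrite lerBlDr -lerBlDl.
Qed.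

Lemma cos_perp P Q c : (0 < n)%N -> \dim P = n -> \dim Q = n ->
  is_cos (gs P) (gs Q) c -> is_cos (gs (perp P)) (gs (perp Q)) c.
Proof.
move=> n0 dP dQ hc.
have dP' := dim_perp_half dP; have dQ' := dim_perp_half dQ.
have [||c1 hc1] := @cosv_exists (perp P) (perp Q); rewrite ?dP' ?dQ' //.
suff <- : c1 = c by [].
apply/le_anti; rewrite (cos_perp_le dP dQ hc hc1).
by apply: (cos_perp_le dP' dQ' hc1); rewrite !perpK.
Qed.

End Perp.

End FiniteDimension.

(** * Maps preserving the minimal angle in finite dimension *)

Section CosPreserving.
Variables (R : realType) (V : vectType R[i]) (dot : {dot V for Num.conj}).
Implicit Types (P Q S W X Y : {vspace V}).

Local Notation "''[' u , v ]" := (dot u%R v%R) : ring_scope.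
Local Notation onf := (onf dot).
Local Notation nrm := (nrm dot).
Local Notation gr := (gr dot).
Local Notation is_cos := (is_cos dot).
Local Notation perp := (orthov dot).

Definition cos_preserving n (phi : {vspace V} -> {vspace V}) :=
  (forall W, \dim W = n -> \dim (phi W) = n) /\
  (forall W X c, \dim W = n -> \dim X = n ->
    is_cos (gs W) (gs X) c -> is_cos (gs (phi W)) (gs (phi X)) c).

Section Rank.
Variable n : nat.
Hypothesis n_gt0 : (0 < n)%N.
Hypothesis dimV : (n + n <= \dim {:V})%N.

Lemma cosv_dim W X : \dim W = n -> \dim X = n ->
  exists c, is_cos (gs W) (gs X) c.
Proof. by move=> dW dX; apply: cosv_exists; rewrite ?dW ?dX. Qed.

(** If [x] in [X] is not in [W], its component orthogonal to [W] lies in some [n]-dimensional [Y]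
    inside [perp W]; this [Y] has cosine 0 with [W] but is not orthogonal to [X]. *)
Lemma cos_separates W X : \dim W = n -> \dim X = n ->
  (forall Y c, \dim Y = n -> is_cos (gs W) (gs Y) c -> is_cos (gs X) (gs Y) c) ->
  W = X.
Proof.
move=> dW dX WX; apply/esym/eqv_dim; last by rewrite dW.
apply/negPn/negP => /nsub_exists[x xX xW].
have [f [of_ fE fW fp]] := proj_perp dot W.
set z := x - projf dot f x.
have z0 : z != 0.
  by apply: contraNneq xW => /eqP; rewrite subr_eq0 => /eqP ->; exact: fW.
have [|||Y [zY YW dY]] := @exists_between _ _ <[z]>%VS (perp W) n.
- by rewrite -memvE; exact: fp.
- by rewrite dim_vline z0.
- rewrite -(leq_add2l n); apply: leq_trans dimV _.
  by rewrite -(dim_perp dot W) dW.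
have zzY : z \in Y by rewrite memvE.
have : is_cos (gs W) (gs Y) 0.
  case: (n) n_gt0 dW dY => // k _ dW' dY'.
  apply: (perp_cos0 (gs_gr dot dW') (gs_gr dot dY')) => u v uW vY.
  by apply: dot_eq0C; apply: perp_dot uW; exact: (subvP YW).
move/(WX Y 0 dY)/(cos0_perp (gs_gr dot dX) (gs_gr dot dY)) => /(_ x z xX zzY) xz.
have : '[z, z] = 0.
  rewrite {1}/z dotBl xz (dot_eq0C (perp_dot (fp x) (fW x))) subr0 //.
by move/(@dotxx_eq0 _ _ dot)/eqP; rewrite (negbTE z0).
Qed.

Variable phi : {vspace V} -> {vspace V}.
Hypothesis phi_cp : cos_preserving n phi.

Let phi_dim W : \dim W = n -> \dim (phi W) = n.
Proof. exact: phi_cp.1. Qed.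

Let phi_cos W X c : \dim W = n -> \dim X = n ->
  is_cos (gs W) (gs X) c -> is_cos (gs (phi W)) (gs (phi X)) c.
Proof. exact: phi_cp.2. Qed.

Lemma phi_cosV W X c : \dim W = n -> \dim X = n ->
  is_cos (gs (phi W)) (gs (phi X)) c -> is_cos (gs W) (gs X) c.
Proof.
move=> dW dX hc; have [c' hc'] := cosv_dim dW dX.
by rewrite (is_cos_uniq hc (phi_cos dW dX hc')).
Qed.

Lemma cos_inj W X : \dim W = n -> \dim X = n -> phi W = phi X -> W = X.
Proof.
move=> dW dX WX; apply: cos_separates => // Y c dY hc.
by apply: phi_cosV => //; rewrite -WX; exact: phi_cos.
Qed.

Lemma cos_meet W X : \dim W = n -> \dim X = n ->
  (W :&: X != 0)%VS = (phi W :&: phi X != 0)%VS.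
Proof.
move=> dW dX.
have E Y Z : \dim Y = n -> \dim Z = n ->
    (Y :&: Z != 0)%VS <-> is_cos (gs Y) (gs Z) 1.
  move=> dY dZ; split.
    move=> /nz_exists[v /memv_capP[vY vZ] v0].
    have [a a0 a1] := unit_scale dot v0.
    by apply: (meet_cos1 (x := a *: v)) => //; exact: rpredZ.
  move=> hc; have [a x xZ|x [xY xZ x1]] := cos1_meet hc; first exact: rpredZ.
  apply: (meet_nz xY xZ); apply/eqP => x0; move/eqP: x1.
  by rewrite x0 dot0l eq_sym oner_eq0.
apply/idP/idP => [/(E _ _ dW dX) hc|/(E _ _ (phi_dim dW) (phi_dim dX)) hc].
  by apply/E; rewrite ?phi_dim //; exact: phi_cos.
by apply/E => //; exact: phi_cosV.
Qed.

Lemma iter_dim k W : \dim W = n -> \dim (iter k phi W) = n.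
Proof. by move=> dW; elim: k => //= k IH; exact: phi_dim. Qed.

Lemma iter_cos k W X c : \dim W = n -> \dim X = n ->
  is_cos (gs W) (gs X) c -> is_cos (gs (iter k phi W)) (gs (iter k phi X)) c.
Proof.
by move=> dW dX hc; elim: k => //= k IH; apply: phi_cos; rewrite ?iter_dim.
Qed.

(* The iterates of [phi] recur: by compactness some [phi^k W] and [phi^m W] with
   [k < m] are close, and [phi^k] is cos-preserving, so [phi^(m-k) W] is
   indistinguishable from [W] up to [e]. Doing this along an ultrafilter makes the
   recurrence times [m - k] common to all [W]. *)
Lemma recurrence : exists G : set_system nat, [/\ UltraFilter G,
  G [set j | (0 < j)%N] &
  forall W e, \dim W = n -> 0 < e -> G [set j | forall X c c', \dim X = n ->
    is_cos (gs W) (gs X) c -> is_cos (gs (iter j phi W)) (gs X) c' ->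
    c <= c' + e /\ c' <= c + e]].
Proof.
have [F uF Foo] := free_ultrafilter.
have pF : ProperFilter F := ultra_proper.
(* [D] is generated by the sets of differences [l - k], [k < l], of members of [F]. It is proper
   because every member of [F] is unbounded. *)
pose D : set_system nat := [set B | exists2 A : set nat, F A &
  forall k l, A k -> A l -> (k < l)%N -> B (l - k)%N].
have pairs (A : set nat) : F A -> exists k l, [/\ A k, A l & (k < l)%N].
  move=> FA; have [k Ak] := filter_ex FA.
  by have [l [Al kl]] := filter_ex (filterI FA (Foo k.+1)); exists k, l.
have pD : ProperFilter D.
  split.
    by move=> [A FA hA]; have [k [l [Ak Al kl]]] := pairs A FA; exact: (hA k l).
  split.
  - by exists setT => //; exact: filterT.
  - move=> B B' [A FA hA] [A' FA' hA']; exists (A `&` A'); first exact: filterI.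
    by move=> k l [Ak A'k] [Al A'l] kl; split; [exact: hA|exact: hA'].
  - by move=> B B' BB' [A FA hA]; exists A => // k l Ak Al kl; apply: BB'; exact: hA.
have [G [uG DG]] := ultraFilterLemma pD.
exists G; split=> //.
  apply: DG; exists setT; first exact: filterT.
  by move=> k l _ _ kl /=; rewrite subn_gt0.
move=> W e dW e0; apply: DG.
have ex_f k : exists f : 'I_n -> V, onf f /\ gs (iter k phi W) = lin_span f.
  by have [f of_ fE] := gs_gr dot (iter_dim k dW); exists f.
have [f hf] := choice ex_f.
have [L oL hL] := frame_limit uF (fun k => (hf k).1).
(* The comparison passes through the limit frame [L], so [cos_close] is used twice, at a cost of
   [n * d] each time. *)
pose d := e / (n + n)%:R.
have nn0 : 0 < (n + n)%:R :> R[i] by rewrite ltr0n addn_gt0 n_gt0.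
have d0 : 0 < d by rewrite divr_gt0.
have dE : n%:R * d + n%:R * d = e.
  by rewrite -mulrDl -natrD /d mulrCA divff ?mulr1 // gt_eqF.
exists [set k | forall i, nrm (f k i - L i) < d].
  by apply: filter_forall => i; exact: hL.
move=> k l /= hk hl kl X c c' dX hc hc'.
have lk : (k + (l - k))%N = l by rewrite subnKC // ltnW.
have dXk := iter_dim k dX.
have hck := iter_cos k dW dX hc.
have hcl : is_cos (gs (iter l phi W)) (gs (iter k phi X)) c'.
  by rewrite -lk iterD; apply: iter_cos => //; exact: iter_dim.
have [Z dZ ZE] : exists2 Z, \dim Z = n & gs Z = lin_span L.
  by apply: (gr_gs (dot := dot)); exists L.
have [cL hcL] := cosv_dim dZ dXk.
rewrite ZE in hcL; have [ok kE] := hf k; have [ol lE] := hf l.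
rewrite kE in hck; rewrite lE in hcl.
have hk' i : nrm (f k i - L i) <= d by rewrite ltW.
have hl' i : nrm (f l i - L i) <= d by rewrite ltW.
have hk'' i : nrm (L i - f k i) <= d by rewrite nrm_subC.
have hl'' i : nrm (L i - f l i) <= d by rewrite nrm_subC.
rewrite -dE !addrA; split.
  apply: le_trans (cos_close ok oL hck hcL hk') _; rewrite lerD2r.
  exact: cos_close oL ol hcL hcl hl''.
apply: le_trans (cos_close ol oL hcl hcL hl') _; rewrite lerD2r.
exact: cos_close oL ok hcL hck hk''.
Qed.

(** [T] is the limit of the [phi^(j-1) S]. To compare [phi T] with [S] on a test subspace [Y], the
    recurrence is applied to [Y]: the cosine of [phi T] and [Y] is close to that of [phi T] and
    [phi^j Y], which is that of [T] and [phi^(j-1) Y], itself close to that of [phi^(j-1) S] and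
    [phi^(j-1) Y], which is that of [S] and [Y]. *)
Lemma cos_surj S : \dim S = n -> exists2 T, \dim T = n & phi T = S.
Proof.
move=> dS; have [G [uG Gpos Grec]] := recurrence.
have pG : ProperFilter G := ultra_proper.
have dSj j : \dim (iter j.-1 phi S) = n by exact: iter_dim.
have ex_f j : exists f : 'I_n -> V, onf f /\ gs (iter j.-1 phi S) = lin_span f.
  by have [f of_ fE] := gs_gr dot (dSj j); exists f.
have [f hf] := choice ex_f.
have [L oL hL] := frame_limit uG (fun k => (hf k).1).
have [T dT TE] : exists2 T, \dim T = n & gs T = lin_span L.
  by apply: (gr_gs (dot := dot)); exists L.
exists T => //; apply: cos_separates; rewrite ?phi_dim // => Y c dY hc.
have [c' hc'] := cosv_dim dS dY; suff -> : c = c' by [].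
have close e : 0 < e -> c <= c' + e /\ c' <= c + e.
  (* Half of [e] pays for the recurrence and half for replacing [T] by [phi^(j-1) S]. *)
  move=> e0; pose e1 := e / 2%:R; pose d := e1 / n%:R.
  have e10 : 0 < e1 by rewrite divr_gt0 // ltr0n.
  have d0 : 0 < d by rewrite divr_gt0 // ltr0n.
  have dE : n%:R * d = e1 by rewrite /d mulrC divfK // pnatr_eq0 -lt0n.
  have eE : e = e1 + e1 by rewrite -mulr2n -mulr_natr /e1 divfK // pnatr_eq0.
  have Gd : G [set j | forall i, nrm (f j i - L i) < d].
    by apply: filter_forall => i; exact: hL.
  have [j /= [[j0 hj] hd]] := filter_ex (filterI (filterI Gpos (Grec Y e1 dY e10)) Gd).
  have dYj : \dim (iter j phi Y) = n by exact: iter_dim.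
  have [b hb] := cosv_dim (phi_dim dT) dYj.
  have [h1 h2] := hj _ _ _ (phi_dim dT) (is_cosC hc) (is_cosC hb).
  have hjE : iter j phi Y = phi (iter j.-1 phi Y) by case: (j) j0.
  have dYj1 : \dim (iter j.-1 phi Y) = n by exact: iter_dim.
  rewrite hjE in hb; have hb' := phi_cosV dT dYj1 hb.
  have hc'j := iter_cos j.-1 dS dY hc'.
  have [oj jE] := hf j; rewrite jE in hc'j; rewrite TE in hb'.
  have l1 : b <= c' + e1.
    by rewrite -dE; apply: cos_close oL oj hb' hc'j _ => i; rewrite nrm_subC; apply/ltW/hd.
  have l2 : c' <= b + e1.
    by rewrite -dE; apply: cos_close oj oL hc'j hb' _ => i; apply/ltW/hd.
  rewrite eE !addrA; split.
    by apply: le_trans h1 _; rewrite lerD2r.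
  by apply: le_trans l2 _; rewrite lerD2r.
have creal := ger0_real (is_cos_ge0 hc); have c'real := ger0_real (is_cos_ge0 hc').
have le a b : a \is Num.real -> b \is Num.real ->
    (forall e, 0 < e -> a <= b + e) -> a <= b :> R[i].
  move=> ar br ab; rewrite real_leNgt //; apply/negP => ba.
  have h0 : 0 < (a - b) / 2%:R by rewrite divr_gt0 ?subr_gt0 // ltr0n.
  have := ab _ h0; rewrite -lerBlDl ler_pdivlMr ?ltr0n //.
  by rewrite ger_pMr ?subr_gt0 // lern1.
apply/le_anti; rewrite !le // => e e0; by case: (close e e0).
Qed.

End Rank.

(** * Lowering the rank of a star-preserving map *)

Section Descent.
Variable m : nat.
Local Notation n := m.+1.
Hypothesis m_gt0 : (0 < m)%N.
Hypothesis dimV : (n + n <= \dim {:V})%N.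
Variable phi : {vspace V} -> {vspace V}.
Hypothesis phi_cp : cos_preserving n phi.
Hypothesis phi_st : forall P Q S, mutual m P Q S -> st P Q S = st (phi P) (phi Q) (phi S).

Let phi_dim W : \dim W = n -> \dim (phi W) = n.
Proof. exact: phi_cp.1. Qed.

Let phi_inj := cos_inj (ltn0Sn _) dimV phi_cp.
Let phi_surj := cos_surj (ltn0Sn _) dimV phi_cp.
Let phi_meet := cos_meet (ltn0Sn _) phi_cp.

Let phi_adj' := phi_adj m_gt0 dimV phi_dim phi_inj phi_surj phi_meet.

Lemma star_adj A P Q : \dim A = m -> \dim P = n -> \dim Q = n ->
  (A <= P)%VS -> (A <= Q)%VS -> P != Q -> adj m P Q.
Proof.
move=> dA dP dQ AP AQ PQ; apply: adjI => //.
by rewrite -dA dimvS // subv_cap AP.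
Qed.

Lemma star_cap A P Q : \dim A = m -> \dim P = n -> \dim Q = n ->
  (A <= P)%VS -> (A <= Q)%VS -> P != Q -> (P :&: Q)%VS = A.
Proof.
move=> dA dP dQ AP AQ PQ; apply/esym/eqv_dim; first by rewrite subv_cap AP.
by rewrite dA (adj_dim (star_adj dA dP dQ AP AQ PQ)).
Qed.

Lemma star_pair A : \dim A = m -> exists PQ : {vspace V} * {vspace V},
  [/\ \dim PQ.1 = n, \dim PQ.2 = n, (A <= PQ.1)%VS, (A <= PQ.2)%VS & PQ.1 != PQ.2].
Proof.
move=> dA; have [|u u0 uA] := @exists_perp_unit _ _ dot A.
  by rewrite dA; move: dimV; lia.
have uA' : u \notin A.
  apply: contra u0 => uA'; apply/eqP/(@dotxx_eq0 _ _ dot); exact: perp_dot uA uA'.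
have dP : \dim (A + <[u]>) = n by rewrite dim_add_line // dA.
have [|v v0 vP] := @exists_perp_unit _ _ dot (A + <[u]>)%VS.
  by rewrite dP; move: dimV; lia.
have vP' : v \notin (A + <[u]>)%VS.
  apply: contra v0 => vP'; apply/eqP/(@dotxx_eq0 _ _ dot); exact: perp_dot vP vP'.
have vA : v \notin A by apply: contra vP'; apply: (subvP (addvSl _ _)).
exists (A + <[u]>, A + <[v]>)%VS; split; rewrite ?addvSl ?dim_add_line ?dA //=.
apply: contraNneq vP' => ->; apply: (subvP (addvSr _ _)); exact: memv_line.
Qed.

(** The added directions are orthogonal to each other and to [A + B], for which [2m + 2] dimensions
    suffice. They contribute nothing to inner products and only shorten the components in [A] and
    [B] of unit vectors. *)
Lemma cos_extend A B c : \dim A = m -> \dim B = m -> is_cos (gs A) (gs B) c ->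
  exists P Q, [/\ \dim P = n, \dim Q = n, (A <= P)%VS, (B <= Q)%VS &
    is_cos (gs P) (gs Q) c].
Proof.
move=> dA dB hc.
have dAB : (\dim (A + B) <= m + m)%N.
  by rewrite -{1}dA -dB; exact: dimv_add_leqif.
have [|u u0 uAB] := @exists_perp_unit _ _ dot (A + B)%VS.
  by move: dimV dAB; clear; lia.
have uAB' : u \notin (A + B)%VS.
  apply: contra u0 => uA'; apply/eqP/(@dotxx_eq0 _ _ dot); exact: perp_dot uAB uA'.
have [|v v0 vABu] := @exists_perp_unit _ _ dot (A + B + <[u]>)%VS.
  by rewrite dim_add_line //; move: dimV dAB; clear; lia.
have vABu' : v \notin (A + B + <[u]>)%VS.
  apply: contra v0 => uA'; apply/eqP/(@dotxx_eq0 _ _ dot); exact: perp_dot vABu uA'.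
have AP : (A <= A + B)%VS by exact: addvSl.
have BP : (B <= A + B)%VS by exact: addvSr.
have uA a : a \in A -> '[u, a] = 0 by move=> aA; apply: perp_dot uAB _; exact: (subvP AP).
have uB a : a \in B -> '[u, a] = 0 by move=> aA; apply: perp_dot uAB _; exact: (subvP BP).
have vAB a : a \in (A + B)%VS -> '[v, a] = 0.
  by move=> aA; apply: perp_dot vABu _; exact: (subvP (addvSl _ _)).
have vu : '[v, u] = 0.
  apply: perp_dot vABu _; apply: (subvP (addvSr _ _)); exact: memv_line.
have vB a : a \in B -> '[v, a] = 0 by move=> aA; apply: vAB; exact: (subvP BP).
have vA a : a \in A -> '[v, a] = 0 by move=> aA; apply: vAB; exact: (subvP AP).
exists (A + <[u]>)%VS, (B + <[v]>)%VS; split; rewrite ?addvSl //.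
- by rewrite dim_add_line ?dA //; apply: contra uAB'; exact: (subvP AP).
- rewrite dim_add_line ?dB //; apply: contra vABu' => vB'.
  by apply: (subvP (addvSl _ _)); exact: (subvP BP).
have [[x [y [xA yB x1 y1 xy]]] _] := hc.
split.
  by exists x, y; split=> //; apply: (subvP (addvSl _ _)).
move=> _ _ /memv_addP[a aA [_ /vlineP[s ->] ->]] /memv_addP[b bB [_ /vlineP[t ->] ->]].
rewrite !dotDl !dotDr !dotZl !dotZr (uB _ bB) (uA _ aA) (vB _ bB).
rewrite !(dot_eq0C (uA _ aA)) !(dot_eq0C (vA _ aA)) (dot_eq0C (vB _ bB)) (dot_eq0C vu).
rewrite !(mulr0, addr0, add0r) => a1 b1.
apply: le_trans (is_cos_nrm (gs_gr dot dA) (gs_gr dot dB) hc aA bB) _.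
have le1 (z w : R[i]) (p : V) : '[p, p] + z * (z^* * w) = 1 -> 0 <= w -> nrm p <= 1.
  move=> E w0; rewrite -(@ler_pXn2r _ 2) ?nnegrE ?nrm_ge0 ?ler01 // nrm_sqr expr1n -E.
  by rewrite lerDl mulrA -normCK mulr_ge0 // exprn_ge0.
rewrite -[leRHS]mulr1 ler_wpM2l ?(is_cos_ge0 hc) // -[leRHS]mulr1.
by rewrite ler_pM ?nrm_ge0 ?(le1 _ _ _ a1) ?(le1 _ _ _ b1) ?dnorm_ge0.
Qed.

(** [psi A] is the intersection of the images of two chosen subspaces through [A]; since stars go to
    stars, the image of every other one contains it. For the cosine, enlarging a pair can only
    increase it, while [cos_extend] enlarges without change: applied to [A], [B] and to [psi A],
    [psi B], it gives the two inequalities. *)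
Lemma descent : exists2 psi, cos_preserving m psi &
  forall A W, \dim A = m -> \dim W = n -> (A <= W)%VS -> (psi A <= phi W)%VS.
Proof.
have ex_pq A : exists PQ : {vspace V} * {vspace V}, \dim A = m ->
  [/\ \dim PQ.1 = n, \dim PQ.2 = n, (A <= PQ.1)%VS, (A <= PQ.2)%VS & PQ.1 != PQ.2].
  have [dA|] := pselect (\dim A = m); last by exists (0, 0)%VS.
  by have [PQ hPQ] := star_pair dA; exists PQ.
have [pq hpq] := choice ex_pq.
pose psi A := (phi (pq A).1 :&: phi (pq A).2)%VS.
have psi_dim A : \dim A = m -> \dim (psi A) = m.
  move=> /[dup] dA /hpq[dP dQ AP AQ PQ]; apply: adj_dim.
  by rewrite -phi_adj' //; exact: (star_adj dA dP dQ AP AQ PQ).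
have psi_sub A W : \dim A = m -> \dim W = n -> (A <= W)%VS -> (psi A <= phi W)%VS.
  move=> /[dup] dA /hpq[dP dQ AP AQ PQ] dW AW.
  have [<-|WP] := eqVneq (pq A).1 W; first exact: capvSl.
  have [<-|WQ] := eqVneq (pq A).2 W; first exact: capvSr.
  rewrite -/(st _ _ _) -phi_st.
    by rewrite /st (star_cap dA dP dQ AP AQ PQ).
  by split; split=> //; apply: (star_adj dA).
(* Lifts of [psi A] come from lifts of [A], because [phi_st] also reflects stars. *)
have psi_pre A S : \dim A = m -> \dim S = n -> (psi A <= S)%VS ->
    exists T, [/\ \dim T = n, phi T = S & (A <= T)%VS].
  move=> /[dup] dA /hpq[dP dQ AP AQ PQ] dS AS.
  have [T dT TS] := phi_surj dS; exists T; split=> //.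
  have [<-//|TP] := eqVneq (pq A).1 T.
  have [<-//|TQ] := eqVneq (pq A).2 T.
  rewrite -(star_cap dA dP dQ AP AQ PQ) -/(st _ _ _) phi_st; first by rewrite /st TS.
  have dpA := psi_dim _ dA.
  have nphi X : \dim X = n -> X != T -> phi X != phi T.
    by move=> dX; apply: contra_neq; exact: phi_inj.
  split; split=> //; first exact: (star_adj dA).
    rewrite phi_adj' //; apply: (star_adj dpA); rewrite ?phi_dim ?capvSl ?TS //.
    by rewrite -TS nphi.
  rewrite phi_adj' //; apply: (star_adj dpA); rewrite ?phi_dim ?capvSr ?TS //.
  by rewrite -TS nphi.
exists psi => //; split=> // A B c dA dB hc.
have cle P Q (X Y : {vspace V}) (d d' : R[i]) : (P <= X)%VS -> (Q <= Y)%VS ->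
    is_cos (gs P) (gs Q) d -> is_cos (gs X) (gs Y) d' -> d <= d'.
  move=> PX QY [[x [y [xP yQ x1 y1 <-]]] _] [_ hd'].
  by apply: hd' => //; [exact: (subvP PX)|exact: (subvP QY)].
have [||c' hc'] := @cosv_exists _ _ dot (psi A) (psi B); rewrite ?psi_dim //.
suff -> : c = c' by [].
apply/le_anti/andP; split.
  have [P' [Q' [dP' dQ' AP BQ hPQ]]] := cos_extend (psi_dim _ dA) (psi_dim _ dB) hc'.
  have [P [dP PE AP0]] := psi_pre _ _ dA dP' AP.
  have [Q [dQ QE BQ0]] := psi_pre _ _ dB dQ' BQ.
  rewrite -PE -QE in hPQ.
  exact: cle AP0 BQ0 hc (phi_cosV (ltn0Sn _) phi_cp dP dQ hPQ).
have [P [Q [dP dQ AP BQ hPQ]]] := cos_extend dA dB hc.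
apply: cle hc' (phi_cp.2 _ _ _ dP dQ hPQ); exact: psi_sub.
Qed.

End Descent.

(** In dimension above [2n], take a star [P], [Q], [R] with [R] generated over [A] by some [e3]
    orthogonal to [P + Q]. There is room for an [n]-dimensional [S] through [e3] orthogonal to
    [P + Q]. Then [phi S] is orthogonal to [phi P + phi Q], which contains [phi R] as the star
    becomes a top; but [S] meets [R], so [phi S] meets [phi R]. *)
Lemma reversed_dim m phi : (0 < m)%N -> (m.+1 + m.+1 <= \dim {:V})%N ->
  cos_preserving m.+1 phi ->
  (forall P Q S, mutual m P Q S -> st P Q S = tp (phi P) (phi Q) (phi S)) ->
  \dim {:V} = (m.+1 + m.+1)%N.
Proof.
move=> m0 dimV [phi_dim phi_cos] rev; apply/eqP; rewrite eqn_leq dimV andbT leqNgt.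
apply/negP => dimV1.
have notin W u : u != 0 -> u \in perp W -> u \notin W.
  move=> u0 uW; apply: contra u0 => uW'; apply/eqP/(@dotxx_eq0 _ _ dot).
  exact: perp_dot uW uW'.
have [|A _ dA] := @exists_subspace _ _ {:V}%VS m; first by move: dimV; clear; lia.
have [|e1 e10 e1A] := @exists_perp_unit _ _ dot A.
  by rewrite dA; move: dimV; clear; lia.
have dP : \dim (A + <[e1]>) = m.+1 by rewrite dim_add_line ?notin // dA.
have [|e2 e20 e2P] := @exists_perp_unit _ _ dot (A + <[e1]>)%VS.
  by rewrite dP; move: dimV m0; clear; lia.
have dB : \dim (A + <[e1]> + <[e2]>) = m.+2 by rewrite dim_add_line ?notin // dP.
have [|e3 e30 e3B] := @exists_perp_unit _ _ dot (A + <[e1]> + <[e2]>)%VS.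
  by rewrite dB; move: dimV m0; clear; lia.
have PB : (A + <[e1]> <= A + <[e1]> + <[e2]>)%VS by exact: addvSl.
have AB : (A <= A + <[e1]> + <[e2]>)%VS by apply: subv_trans PB; exact: addvSl.
have QB : (A + <[e2]> <= A + <[e1]> + <[e2]>)%VS by rewrite subv_add AB addvSr.
have e2P' := notin _ _ e20 e2P; have e3B' := notin _ _ e30 e3B.
have e2A' : e2 \notin A by apply: contra e2P'; exact: (subvP (addvSl _ _)).
have e3A' : e3 \notin A by apply: contra e3B'; exact: (subvP AB).
have dQ : \dim (A + <[e2]>) = m.+1 by rewrite dim_add_line // dA.
have dR : \dim (A + <[e3]>) = m.+1 by rewrite dim_add_line // dA.
have inr e : e \in (A + <[e]>)%VS by apply: (subvP (addvSr _ _)); exact: memv_line.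
have PQ : (A + <[e1]> != A + <[e2]>)%VS by apply: contraNneq e2P' => ->.
have PR : (A + <[e1]> != A + <[e3]>)%VS.
  by apply: contraNneq e3B' => E; apply: (subvP PB); rewrite E.
have QR : (A + <[e2]> != A + <[e3]>)%VS.
  by apply: contraNneq e3B' => E; apply: (subvP QB); rewrite E.
have [|||S [e3S SB dS]] := @exists_between _ _ <[e3]>%VS (perp (A + <[e1]> + <[e2]>)) m.+1.
- by rewrite -memvE.
- by rewrite dim_vline e30.
- by have := dim_perp dot (A + <[e1]> + <[e2]>)%VS; rewrite dB; move: dimV1; clear; lia.
have mu : mutual m (A + <[e1]>) (A + <[e2]>) (A + <[e3]>).
  by split; split=> //; apply: (star_adj dA); rewrite ?addvSl.
have s : st (A + <[e1]>) (A + <[e2]>) (A + <[e3]>).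
  by rewrite /st (star_cap dA dP dQ _ _ PQ) ?addvSl.
have t : (phi (A + <[e3]>) <= phi (A + <[e1]>) + phi (A + <[e2]>))%VS.
  by have := rev _ _ _ mu; rewrite s => /esym.
have phi_perp X u v : \dim X = m.+1 -> (X <= A + <[e1]> + <[e2]>)%VS ->
    u \in phi S -> v \in phi X -> '[u, v] = 0.
  move=> dX XB uS vX.
  apply: (cos0_perp (gs_gr dot (phi_dim _ dS)) (gs_gr dot (phi_dim _ dX))) uS vX.
  apply: phi_cos => //; apply: (perp_cos0 (gs_gr dot dS) (gs_gr dot dX)) => u' v' u'S v'X.
  by apply: perp_dot (subvP SB _ u'S) (subvP XB _ v'X).
have [a a0 a1] := unit_scale dot e30.
have meet : is_cos (gs S) (gs (A + <[e3]>)) 1.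
  by apply: (meet_cos1 (x := a *: e3)) => //; apply: rpredZ => //; rewrite memvE.
have [b x xR|x [xS xR x1]] := cos1_meet (phi_cos _ _ _ dS dR meet); first exact: rpredZ.
have /memv_addP[p pP [q qQ xE]] := subvP t x xR.
move/eqP: x1; rewrite {2}xE dotDr (phi_perp _ _ _ dP PB xS pP).
by rewrite (phi_perp _ _ _ dQ QB xS qQ) addr0 eq_sym oner_eq0.
Qed.

Theorem cos_preserving_isometry n phi : (0 < n)%N -> (n + n <= \dim {:V})%N ->
  cos_preserving n phi ->
  exists2 U, semi_isometry dot U &
    (forall W x, \dim W = n -> x \in W -> U x \in phi W) \/
    (\dim {:V} = (n + n)%N /\
     forall W x, \dim W = n -> x \in W -> U x \in perp (phi W)).
Proof.
elim: n phi => // n IH phi _ dimV cp.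
have [n0|n_gt0] := posnP n.
  subst n; pose vs (A : set V) := xget 0%VS [set W | gs W = A].
  have vsK W : vs (gs W) = W.
    by apply: xget_unique => // X XW; exact: gs_inj.
  have [||U isoU UE] := @grassmann_rank1 _ _ dot (fun A => gs (phi (vs A))).
  - move=> A gA; have [W dW WA] := gr_gs gA.
    by rewrite -WA vsK; apply: gs_gr; exact: cp.1.
  - move=> A B c gA gB; have [W dW <-] := gr_gs gA; have [X dX <-] := gr_gs gB.
    by rewrite !vsK; exact: cp.2.
  exists U => //; left=> W x dW xW.
  by have := UE (gs W) x (gs_gr dot dW) xW; rewrite vsK.
have star psi : cos_preserving n.+1 psi ->
    (forall P Q S, mutual n P Q S -> st P Q S = st (psi P) (psi Q) (psi S)) ->
    exists2 U, semi_isometry dot U & forall W x, \dim W = n.+1 -> x \in W -> U x \in psi W.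
  move=> pcp pst; have [chi ccp chiW] := descent n_gt0 dimV pcp pst.
  (* The complementary alternative cannot occur in rank [n], since the dimension is at least
     [2 * n.+1]. *)
  have [|U isoU [UE|[dV _]]] := IH chi n_gt0 _ ccp.
  - by move: dimV; clear; lia.
  - exists U => // W x dW xW.
    have [|||A [xA AW dA]] := @exists_between _ _ <[x]>%VS W n.
    + by rewrite -memvE.
    + by rewrite dim_vline; case: eqP.
    + by rewrite dW.
    by apply: (subvP (chiW _ _ dA dW AW)); apply: UE => //; rewrite memvE.
  - by move: dimV; rewrite dV; clear; lia.
have := phi_type_uniform n_gt0 dimV cp.1 (cos_inj (ltn0Sn _) dimV cp)
  (cos_surj (ltn0Sn _) dimV cp) (cos_meet (ltn0Sn _) cp).
case=> [pst|rev]; first by have [U isoU UE] := star phi cp pst; exists U => //; left.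
have dV := reversed_dim n_gt0 dimV cp rev.
(* Complements preserve cosines in this dimension and turn tops back into stars. *)
have [||U isoU UE] := star (fun W => perp (phi W)).
- split=> [W dW|W X c dW dX hc]; first exact: (dim_perp_half dot dV (cp.1 _ dW)).
  by apply: (cos_perp dV) => //; [exact: cp.1|exact: cp.1|exact: cp.2].
- by move=> P Q S mu; rewrite rev // /tp /st (perpS dot) perp_add.
by exists U => //; right.
Qed.

End CosPreserving.

(** * Passing between bare modules and finite-dimensional vector spaces *)

Section Dichotomy.
Variable R : realType.

Lemma grassmann_finite (V : vectType R[i]) (dot : {dot V for Num.conj}) n
    (phi : set V -> set V) : (0 < n)%N -> (n + n <= \dim {:V})%N ->
  (forall A, gr dot n A -> gr dot n (phi A)) ->
  (forall A B c, gr dot n A -> gr dot n B ->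
    is_cos dot A B c -> is_cos dot (phi A) (phi B) c) ->
  exists2 U, semi_isometry dot U &
    (forall A x, gr dot n A -> A x -> phi A (U x)) \/
    (gr dot (n + n) setT /\
     forall A x y, gr dot n A -> A x -> phi A y -> dot (U x) y = 0).
Proof.
move=> n0 dimV phi_gr phi_cos.
pose vs (A : set V) := xget 0%VS [set W | gs W = A].
have vsK A : gr dot n A -> gs (vs A) = A.
  by move=> gA; have [W _ WA] := gr_gs gA; apply: (@xgetPex _ _ [set W | gs W = A]); exists W.
pose psi W := vs (phi (gs W)).
have psiE W : \dim W = n -> gs (psi W) = phi (gs W).
  by move=> dW; apply: vsK; apply: phi_gr; exact: gs_gr.
have [|U isoU UE] := @cos_preserving_isometry R V dot n psi n0 dimV.
  split=> [W dW|W X c dW dX hc].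
    apply: (@gr_uniq _ _ dot _ _ (gs (psi W))); first exact: gs_gr.
    by rewrite psiE //; apply: phi_gr; exact: gs_gr.
  by rewrite !psiE //; apply: phi_cos => //; exact: gs_gr.
exists U => //; case: UE => [UE|[dV UE]]; [left|right; split].
- move=> A x gA Ax; have [W dW WA] := gr_gs gA; subst A.
  by rewrite -psiE //; exact: UE.
- have -> : [set: V] = gs fullv by apply/seteqP; split=> // x _; exact: memvf.
  exact: gs_gr.
- move=> A x y gA Ax; have [W dW WA] := gr_gs gA; subst A.
  by rewrite -psiE // => yW; exact: perp_dot (UE _ _ dW Ax) yW.
Qed.

(** An equality of modules, and not an isomorphism, allows [H] to be substituted with [dot] and
    [phi] carried along. *)
Lemma vect_of_lmod (K : fieldType) (H : lmodType K) d :
  vector_axiom_def d H -> exists2 V : vectType K, H = V & dim V = d.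
Proof.
move=> ax; pose V : vectType K :=
  HB.pack (GRing.Lmodule.sort H) (Lmodule_hasFinDim.Build K H ax).
by exists V => //; rewrite /V; clear V; destruct H as [T []].
Qed.

Lemma grassmann_finite_frame (H : lmodType R[i]) (dot : {dot H for Num.conj}) d
    (b : 'I_d -> H) n (phi : set H -> set H) : onf dot b -> lin_span b = setT ->
  (0 < n)%N -> (n + n <= d)%N ->
  (forall A, gr dot n A -> gr dot n (phi A)) ->
  (forall A B c, gr dot n A -> gr dot n B ->
    is_cos dot A B c -> is_cos dot (phi A) (phi B) c) ->
  exists2 U, semi_isometry dot U &
    (forall A x, gr dot n A -> A x -> phi A (U x)) \/
    (gr dot (n + n) setT /\
     forall A x y, gr dot n A -> A x -> phi A y -> dot (U x) y = 0).
Proof.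
move=> ob bT n0 dn.
pose v2r (x : H) : 'rV[R[i]]_d := \row_j dot x (b j).
have lin_v2r : linear v2r.
  by move=> a x y; apply/rowP => j; rewrite !mxE dotDl dotZl.
have bij_v2r : bijective v2r.
  exists (fun r : 'rV[R[i]]_d => \sum_j r 0 j *: b j).
    move=> x; have bx : lin_span b x by rewrite bT.
    by rewrite -[RHS](projf_id ob bx); apply: eq_bigr => j _; rewrite mxE.
  by move=> r; apply/rowP => j; rewrite mxE dot_comb.
have ax : vector_axiom_def d _ := exist2 _ _ v2r lin_v2r bij_v2r.
have [V VH dV] := vect_of_lmod ax; subst H.
have dimV : (n + n <= \dim {:V})%N by rewrite dimvf dV.
exact: (@grassmann_finite V dot n phi n0 dimV).
Qed.

End Dichotomy.

Lemma grassmann_infinite_rank (C : numClosedFieldType) (H : lmodType C)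
    (dot : {dot H for Num.conj}) n (phi : set H -> set H) :
  (forall m, dim_ge H m) -> (0 < n)%N ->
  (forall A, gr dot n A -> gr dot n (phi A)) ->
  (forall A B c, gr dot n A -> gr dot n B ->
    is_cos dot A B c -> is_cos dot (phi A) (phi B) c) ->
  exists2 U, semi_isometry dot U & forall A x, gr dot n A -> A x -> phi A (U x).
Proof.
case: n => [//|[|m]] inf _ phi_gr phi_cos; first exact: grassmann_rank1.
exact: grassmann_infinite.
Qed.

(** * Projections and adjoints *)

Section Adjoint.
Variables (R : realType) (H : completeNormedModType R[i]).
Variables (dot : {dot H for Num.conj}).
Hypothesis dot_norm : forall x : H, dot x x = `|x| ^+ 2.

Local Notation "''[' u , v ]" := (dot u%R v%R) : ring_scope.

Lemma semi_isometry_add U x y : semi_isometry dot U -> U (x + y) = U x + U y.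
Proof.
by case=> -[lU _]; have := lU 1 x y; rewrite ?scale1r //= rmorph1 !scale1r.
Qed.

Lemma semi_isometry_norm U x : semi_isometry dot U -> '[U x, U x] = '[x, x].
Proof. by case=> -[_ ->]. Qed.

Lemma semi_isometryZE U a x : semi_isometry dot U -> exists c, U (c *: x) = a *: U x.
Proof.
move=> sU; have U0 := semi_isometry0 sU; case: (sU) => -[lU _].
  by exists a; have := lU a x 0; rewrite U0 !addr0.
by exists a^*; have := lU a^* x 0; rewrite U0 !addr0 /= conjCK.
Qed.

Lemma normc_Re (z : R[i]) : 0 <= z -> z = (complex.Re z)%:C%C.
Proof. by case: z => a b; rewrite lecE /= => /andP[/eqP -> _]. Qed.

(** Nearest point of the range of [U]: a minimizing sequence [s] is Cauchy already in the source, as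
    [U] is isometric, so the completeness of [H] provides [z]. *)
Lemma orthogonal_projection U y : semi_isometry dot U ->
  exists z, forall w, '[y - U z, U w] = 0.
Proof.
move=> sU; have U0 := semi_isometry0 sU.
have UN x : U (- x) = - U x.
  by apply/eqP; rewrite -addr_eq0 -semi_isometry_add // addNr U0.
pose q x := complex.Re '[y - U x, y - U x].
have qE x : '[y - U x, y - U x] = (q x)%:C%C by apply: normc_Re; exact: dnorm_ge0.
have q0 x : 0 <= q x by rewrite -lecR -qE dnorm_ge0.
pose E := [set q x | x in setT].
have lbE : has_lbound E by exists 0 => _ [x _ <-].
have infE : has_inf E by split=> //; exists (q 0), 0.
have dq x : inf E <= q x by apply: (ge_inf lbE); exists x.
have approx k : exists x, q x < inf E + k.+1%:R^-1.
  have k0 : 0 < k.+1%:R^-1 :> R by rewrite invr_gt0 ltr0n.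
  by have [_ [x _ <-] hx] := inf_adherent k0 infE; exists x.
have [s hs] := choice approx.
(* By the parallelogram law the left side is [2 q(s k) + 2 q(s l)] minus four times the value of [q]
   at a preimage of the midpoint, hence at most [2 / k.+1 + 2 / l.+1]. *)
have sN k l : (k <= l)%N -> `|s k - s l| ^+ 2 <= (4%:R * k.+1%:R^-1)%:C%C.
  move=> kl; rewrite -dot_norm -(semi_isometry_norm _ sU) semi_isometry_add // UN.
  have [c cE] := semi_isometryZE (2%:R^-1) (s k + s l) sU.
  set p := y - U (s k); set p' := y - U (s l).
  have -> : U (s k) - U (s l) = p' - p.
    by rewrite /p /p' opprB [RHS]addrC addrA subrK.
  have mid : p' + p = 2%:R *: (y - U (c *: (s k + s l))).
    rewrite cE semi_isometry_add // scalerBr scalerA mulfV ?pnatr_eq0 // scale1r.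
    by rewrite scaler_nat mulr2n opprD addrACA [- U (s l) - _]addrC.
  rewrite parallelogram mid dotZl dotZr conjC_nat mulrA !qE -natrM -!(rmorph_nat (real_complex R)).
  rewrite -!rmorphM -rmorphD -rmorphB lecR.
  have h1 := hs k; have h2 := hs l; have h3 := dq (c *: (s k + s l)).
  have h4 : l.+1%:R^-1 <= k.+1%:R^-1 :> R by rewrite lef_pV2 ?posrE ?ltr0n // ler_nat.
  move: h1 h2 h3 h4; move: (q _) (q _) (q _) (_^-1) (_^-1) (inf _) => a1 a2 a3 a4 a5 a6.
  lra.
have small e : 0 < e -> exists N, (4%:R * N.+1%:R^-1)%:C%C < e ^+ 2 :> R[i].
  move=> e0; have er := normc_Re (ltW e0); set r := complex.Re e in er.
  have r0 : 0 < r by rewrite -ltcR -er.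
  have r20 : 0 < r ^+ 2 / 4%:R by rewrite divr_gt0 ?exprn_gt0 ?ltr0n.
  have hN := archi_boundP (ltW (_ : 0 < (r ^+ 2 / 4%:R)^-1)).
  exists (Num.bound (r ^+ 2 / 4%:R)^-1).
  rewrite er -rmorphXn ltcR mulrC -ltr_pdivlMr ?ltr0n // invf_plt ?posrE ?ltr0n //.
  apply: lt_trans (hN _) _; first by rewrite invr_gt0.
  by rewrite ltr_nat.
have cs : cvg (s @ \oo).
  apply: cauchy_cvg; apply: cauchy_exP => e e0; have [N hN] := small e e0.
  exists (s N); apply: filterS (nbhs_infty_ge N) => k /= Nk.
  rewrite -ball_normE /= -(@ltr_pXn2r _ 2) ?nnegrE ?(ltW e0) //.
  exact: le_lt_trans (sN N k Nk) hN.
have [z hz] : exists z, forall e, 0 < e -> \forall k \near \oo, `|z - s k| < e.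
  exists (lim (s @ \oo)) => e e0.
  by move: e e0; apply/cvgrPdist_lt.
exists z => w.
have [->|w0] := eqVneq w 0; first by rewrite U0 dot0r.
have [a a0 a1] := unit_scale dot w0.
pose v := a *: w.
suff h : '[y - U z, U v] = 0.
  have [b bE] := semi_isometryZ a^-1 v sU.
  move: bE; rewrite /v scalerA mulVf ?gt_eqF // scale1r => ->.
  by rewrite dotZr h mulr0.
have v1 : '[U v, U v] = 1 by rewrite semi_isometry_norm.
(* Subtracting the component along [U v] lowers [q] by exactly this square, and [q (s k)] exceeds
   the infimum by less than [1 / k.+1]. *)
have hk k : `|'[y - U (s k), U v]| ^+ 2 <= (k.+1%:R^-1)%:C%C.
  have [c cE] := semi_isometryZE '[y - U (s k), U v] v sU.
  have := dot_proj_line (y - U (s k)) v1.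
  rewrite -cE -addrA -opprD -semi_isometry_add // qE qE => E1.
  have -> : `|'[y - U (s k), U v]| ^+ 2 = (q (s k))%:C%C - (q (s k + c *: v))%:C%C.
    by rewrite E1 opprB [RHS]addrC subrK.
  rewrite -rmorphB lecR; have := hs k; have := dq (s k + c *: v).
  move: (q _) (q _) (inf _) (_^-1) => b1 b2 b3 b4; lra.
apply/eqP; rewrite -normr_eq0; apply/negPn/negP => t0.
have t_gt0 : 0 < `|'[y - U z, U v]| by rewrite lt_def t0 normr_ge0.
set t := `|_| in t0 t_gt0.
have t2 : 0 < t / 2%:R by rewrite divr_gt0 // ltr0n.
have [N hN] := small _ t2.
have [k /= [zk Nk]] := filter_ex (filterI (hz _ t2) (nbhs_infty_ge N)).
have : t < t / 2%:R + t / 2%:R.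
  have zE : y - U z = (y - U (s k)) + U (s k - z).
    by rewrite semi_isometry_add // UN addrA subrK.
  rewrite {1}/t zE dotDl; apply: le_lt_trans (ler_normD _ _) _; apply: ltrD.
    rewrite -(@ltr_pXn2r _ 2) ?nnegrE ?(ltW t2) //.
    apply: le_lt_trans (hk k) _; apply: le_lt_trans hN; rewrite lecR.
    have l1 : k.+1%:R^-1 <= N.+1%:R^-1 :> R by rewrite lef_pV2 ?posrE ?ltr0n // ler_nat.
    have l2 : 0 <= N.+1%:R^-1 :> R by rewrite invr_ge0 ler0n.
    move: l1 l2; move: (_^-1) (_^-1) => b1 b2; lra.
  apply: le_lt_trans (dot_le_nrm _ _ _) _; rewrite (nrm1 v1) mulr1.
  have -> : nrm dot (U (s k - z)) = `|z - s k|.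
    rewrite /nrm semi_isometry_norm // dot_norm sqrCK // distrC //.
  exact: zk.
by rewrite -mulr2n -[_ / _ *+ 2]mulr_natr divfK ?pnatr_eq0 // ltxx.
Qed.

Lemma semi_isometry_adjoint U : semi_isometry dot U -> exists Us,
  (linear_isometry dot U /\ is_adjoint dot U Us) \/
  (conj_linear_isometry dot U /\ is_conj_adjoint dot U Us).
Proof.
move=> sU; have [Us hUs] := choice (fun y => orthogonal_projection y sU).
have E x y : '[U x, y] = '[U x, U (Us y)].
  have := dot_eq0C (hUs y x); rewrite dotBr => /eqP.
  by rewrite subr_eq0 => /eqP.
exists Us; case: (sU) => -[lU iU]; [left|right]; split=> // x y; rewrite E iU //.
by rewrite (dotC dot (Us y)).
Qed.

Lemma Pn_char n (P : Pn dot n) x y : range P y ->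
  (forall v, range P v -> '[x - y, v] = 0) -> P x = y.
Proof.
have [f [of_ fE PE]] := Pn_frame P; rewrite fE => fy xy.
rewrite PE -[RHS](projf_id of_ fy); apply: eq_bigr => i _; congr (_ *: _).
apply/eqP; rewrite -subr_eq0 -dotBl xy //; exact: span_self.
Qed.

Lemma Pn_range_inj n (P Q : Pn dot n) : range P = range Q -> P = Q.
Proof.
move=> PQ; have E : Pn_fun P = Pn_fun Q.
  apply/funext => x; apply: Pn_char; first by rewrite PQ; exists x.
  rewrite PQ => v; have [f [of_ -> QE]] := Pn_frame Q.
  by rewrite QE; exact: dot_projf_span.
case: P Q E {PQ} => [p hp rp] [q hq rq] /= E; subst q.
by rewrite (Prop_irrelevance hp hq) (Prop_irrelevance rp rq).
Qed.

(** [Q] is the projection onto [A]: it will be a projection of rank [n] or its complement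
    [idfun \- P]. By dimension, [U] carries a frame of [A] to a frame of the range of [P]. *)
Lemma Pn_conjugate n (P : Pn dot n) (A : set H) (Q U Us : H -> H) :
  (linear_isometry dot U /\ is_adjoint dot U Us) \/
    (conj_linear_isometry dot U /\ is_conj_adjoint dot U Us) ->
  gr dot n A -> (forall x, A (Q x)) ->
  (forall x p, A p -> '[Q x, p] = '[x, p]) ->
  (forall x, A x -> range P (U x)) -> P =1 U \o Q \o Us.
Proof.
move=> hU [f of_ AE] AQ Qsym UA x /=.
apply: Pn_char; first exact: UA.
have Af i : A (f i) by rewrite AE; exact: span_self.
have oUf : onf dot (U \o f).
  move=> i j /=; case: hU => -[[_ ->] _]; rewrite of_ // eq_sym //.
have PE : lin_span (U \o f) = range P.
  have [g [og gE _]] := Pn_frame P.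
  apply: (gr_eq (n := n) (dot := dot)); [by exists (U \o f)|by exists g|].
  by rewrite gE; apply: span_sub => i; rewrite -gE; exact: UA.
move=> v; rewrite -PE; apply: dot_span0 => i /=; rewrite dotBl.
case: hU => -[[_ iU] adj]; rewrite iU.
  by rewrite Qsym // (dotC _ x) adj -(dotC _ (Us x)) subrr.
rewrite (dotC _ x) adj conjCK (dotC _ (f i) (Q _)) Qsym // -(dotC _ (f i)) subrr //.
Qed.

Variable n : nat.
Hypothesis n_gt0 : (0 < n)%N.
Variable phi : Pn dot n -> Pn dot n.
Hypothesis phi_ma : forall P Q : Pn dot n, ma (phi P) (phi Q) = ma P Q.

Lemma gr_Pn A : gr dot n A -> exists P : Pn dot n, range P = A.
Proof. by move=> [f of_ ->]; exact: Pn_of_frame. Qed.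

Lemma Pn_gr (P : Pn dot n) : gr dot n (range P).
Proof. by have [f [of_ fE _]] := Pn_frame P; exists f. Qed.

Lemma dim_ge_frame m : dim_ge H m -> exists b : 'I_m -> H, onf dot b.
Proof. by move=> [e ie]; have [b [ob _]] := gram_schmidt dot ie; exists b. Qed.

Lemma exists_isometry : dim_ge H (2 * n) ->
  exists2 U, semi_isometry dot U &
    (forall (P : Pn dot n) x, range P x -> range (phi P) (U x)) \/
    (gr dot (n + n) setT /\
     forall (P : Pn dot n) x y, range P x -> range (phi P) y -> '[U x, y] = 0).
Proof.
move=> dimH.
(* [Phi] is [phi] read on ranges, well defined because the range determines the projection; [set0]
   only occurs for sets that are not such ranges. *)
pose Phi (A : set H) := xget set0 [set B | exists2 P, range (Pn_fun P) = A & range (phi P) = B].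
have PhiE (P : Pn dot n) : Phi (range P) = range (phi P).
  by apply: xget_unique; [exists P|move=> B [Q /Pn_range_inj -> <-]].
have Phi_gr A : gr dot n A -> gr dot n (Phi A).
  by move=> /gr_Pn[P <-]; rewrite PhiE; exact: Pn_gr.
have Phi_cos A B c : gr dot n A -> gr dot n B ->
    is_cos dot A B c -> is_cos dot (Phi A) (Phi B) c.
  move=> /gr_Pn[P <-] /gr_Pn[Q <-]; rewrite !PhiE.
  exact: (ma_cos dot_norm n_gt0 (esym (phi_ma P Q))).
have first_case U : semi_isometry dot U ->
    (forall A x, gr dot n A -> A x -> Phi A (U x)) ->
    (forall (P : Pn dot n) x, range P x -> range (phi P) (U x)).
  by move=> sU hU P x Px; rewrite -PhiE; apply: hU => //; exact: Pn_gr.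
have [inf|/existsNP[M nM]] := pselect (forall m, dim_ge H m).
  have [U sU hU] := grassmann_infinite_rank inf n_gt0 Phi_gr Phi_cos.
  by exists U => //; left; exact: first_case.
have [d [dd nd]] : exists d, dim_ge H d /\ ~ dim_ge H d.+1.
  apply: contrapT => no; apply: nM; elim: (M) => [|k IH].
    by exists (fun=> 0) => c _ [].
  by apply: contrapT => nk; apply: no; exists k.
have [b ob] := dim_ge_frame dd.
have bT : lin_span b = setT.
  apply/seteqP; split=> // x _; apply: contrapT => nbx; apply: nd.
  have x0 : x - projf dot b x != 0.
    rewrite subr_eq0; apply/eqP => E; apply: nbx; rewrite E; exact: projf_span.
  have [a a0 a1] := unit_scale dot x0.
  exists (fcons (a *: (x - projf dot b x)) b); apply: onf_indep.
  by apply: onf_fcons => // i; rewrite dotZl dot_projf // mulr0.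
have nd2 : (n + n <= d)%N.
  have [e oe] := dim_ge_frame dimH.
  by rewrite addnn -mul2n; apply: (onf_leq (onf_indep oe) ob); rewrite bT.
have [U sU hU] := grassmann_finite_frame ob bT n_gt0 nd2 Phi_gr Phi_cos.
exists U => //; case: hU => [hU|[gT hU]]; [left; exact: first_case|right; split=> //].
by move=> P x y Px phiy; apply: (hU _ _ _ (Pn_gr P) Px); rewrite PhiE.
Qed.

(** While [k < n], [n + k] conditions leave a unit vector in dimension [2n]. The resulting [g]
    exhausts the complement, since a further direction would give [2n + 1] orthonormal vectors. *)
Lemma gr_complement (P : Pn dot n) : gr dot (n + n) setT ->
  gr dot n [set x | forall y, range P y -> '[x, y] = 0].
Proof.
move=> [b ob bT]; have [f [of_ fE _]] := Pn_frame P.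
have step k : (k <= n)%N -> exists g : 'I_k -> H,
    onf dot g /\ forall i j, '[g i, f j] = 0.
  elim: k => [|k IH] kn; first by exists (fun=> 0); split; case.
  have [g [og gf]] := IH (ltnW kn).
  pose h (i : 'I_(n + k)) := match fintype.split i with inl i => f i | inr i => g i end.
  have [|x [_ x1 xh]] := @exists_orthogonal_unit _ _ dot _ _ b h (onf_indep ob).
    by rewrite ltn_add2l.
  exists (fcons x g); split.
    apply: onf_fcons => // i; have := xh (unsplit (inr i)).
    by rewrite /h unsplitK.
  move=> i j; have [i' ->|->] := unliftP ord0 i; rewrite ?fconsS ?fcons0 //.
  by have := xh (unsplit (inl j)); rewrite /h unsplitK.
have [g [og gf]] := step n (leqnn n); exists g => //.
apply/seteqP; split=> [x xP'|x gx y]; last first.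
  rewrite fE => fy; apply: dot_span0 fy => i; apply: dot_eq0C.
  by apply: dot_span0 gx => j; exact/dot_eq0C.
have xP : forall y, range P y -> '[x, y] = 0 := xP'.
apply: contrapT => ngx.
have x0 : x - projf dot g x != 0.
  rewrite subr_eq0; apply/eqP => E; apply: ngx; rewrite E; exact: projf_span.
have [a a0 a1] := unit_scale dot x0; set z := a *: _ in a1.
pose h (i : 'I_(n + n)) := match fintype.split i with inl i => f i | inr i => g i end.
have zf j : '[z, f j] = 0.
  rewrite dotZl dotBl xP ?sub0r; last by rewrite fE; exact: span_self.
  rewrite (_ : '[projf dot g x, f j] = 0) ?oppr0 ?mulr0 //.
  apply: dot_eq0C; apply: dot_span0 (projf_span _ _ _) => i; exact/dot_eq0C.
have oh : onf dot h.
  move=> i j; rewrite /h -(inj_eq (can_inj (@splitK _ _))).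
  case: (fintype.split i) => i'; case: (fintype.split j) => j';
    by rewrite ?of_ ?og ?gf // dot_eq0C.
have zh i : '[z, h i] = 0.
  rewrite /h; case: (fintype.split i) => j //; by rewrite dotZl dot_projf // mulr0.
have : ((n + n).+1 <= n + n)%N.
  apply: (onf_leq (onf_indep (onf_fcons oh a1 zh)) ob); by rewrite -bT.
by rewrite ltnn.
Qed.

End Adjoint.

Theorem theorem1p3 (R : realType) (H : completeNormedModType R[i])
    (dot : {dot H for Num.conj})
    (dot_norm : forall x : H, dot x x = `|x| ^+ 2)
    (n : nat) (n_gt0 : (0 < n)%N) (dimH : dim_ge H (2 * n))
    (phi : Pn dot n -> Pn dot n)
    (phi_ma : forall P Q : Pn dot n, ma (phi P) (phi Q) = ma P Q) :
  exists U Us : H -> H,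
    ((linear_isometry dot U /\ is_adjoint dot U Us) \/
     (conj_linear_isometry dot U /\ is_conj_adjoint dot U Us)) /\
    ((forall P : Pn dot n, phi P =1 U \o P \o Us) \/
     (has_dim [set: H] (2 * n) /\
      forall P : Pn dot n, phi P =1 U \o (idfun \- P) \o Us)).
Proof.
have [U sU hU] := exists_isometry dot_norm n_gt0 phi_ma dimH.
have [Us hUs] := semi_isometry_adjoint dot_norm sU.
exists U, Us; split=> //; case: hU => [hU|[gT hU]]; [left=> P|right; split].
- apply: Pn_conjugate hUs (Pn_gr P) _ _ (hU P) => [x|x p]; first by exists x.
  move/Pn_range => Pp; have [_ _ adj _] := Pn_projection P.
  by rewrite adj Pp.
- by rewrite mul2n -addnn; case: gT => b ob ->; exists b; split=> //; exact: onf_indep ob.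
move=> P; have [_ _ adj idem] := Pn_projection P.
have gP := gr_complement P gT.
apply: Pn_conjugate hUs gP _ _ _ => [x y|x p pP|x xP].
- move/Pn_range => Py; rewrite /= dotBl adj Py subrr //.
- have Px : range P (P x) by exists x.
  by rewrite /= dotBl (dot_eq0C (pP _ Px)) subr0.
have [f [of_ fE _]] := Pn_frame P.
have Uf i : forall y, range (phi P) y -> dot (U (f i)) y = 0.
  by move=> y; apply: hU; rewrite fE; exact: span_self.
(* By dimension, [U] sends the range of [P] onto the whole complement of the range of [phi P]. *)
have KE : lin_span (U \o f) = [set x | forall y, range (phi P) y -> dot x y = 0].
  apply: (gr_eq (n := n) (dot := dot)).
  - exists (U \o f) => // i j /=.
    by case: sU => -[_ ->]; rewrite of_ // eq_sym.
  - exact: gr_complement.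
  - move=> _ [c _ <-] y phiy; rewrite dot_suml big1 // => i _.
    by rewrite dotZl Uf // mulr0.
have [g [og gE phiE]] := Pn_frame (phi P).
(* The part [k] of [U x] off the range of [phi P] lies in the image under [U] of the range of [P],
   to which [U x] is orthogonal; so [k] is orthogonal to itself. *)
set k := U x - projf dot g (U x).
have kK : lin_span (U \o f) k.
  by rewrite KE => y; rewrite gE; exact: dot_projf_span.
have xf i : dot x (f i) = 0 by apply: xP; rewrite fE; exact: span_self.
have Uxk : dot (U x) k = 0.
  apply: dot_span0 kK => i /=; case: sU => -[_ ->] //; exact: dot_eq0C.
have k0 : k = 0.
  apply: (@dotxx_eq0 _ _ dot); rewrite {1}/k dotBl Uxk sub0r.
  by rewrite dot_eq0C ?oppr0 //; apply: dot_projf_span og (projf_span _ _ _).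
move/eqP: k0; rewrite subr_eq0 => /eqP ->; rewrite gE; exact: projf_span.
Qed.
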